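(* The family of quantum automorphism groups of finite trees is the smallest family $\mathcal I$ of compact quantum groups (here: quantum permutation groups, up to isomorphism) such that: (1) $\mathcal I$ contains the trivial quantum group; (2) if $A,B\in\mathcal I$, then $A*B\in\mathcal I$; (3) for $A\in\mathcal I$ and $n\ge1$, we have $A\wr S_n^+\in\mathcal I$.
   Context: Graphs are finite, simple and undirected, with at least one vertex. A quantum permutation group of size $n$ is a pair $\Gamma=(\mathcal A,p)$ where $\mathcal A=\mathcal O(\Gamma)$ is a unital complex $*$-algebra generated by $p=(p_{ij})_{1\le i,j\le n}$ satisfying relations ($\mathcal P_s$): $p_{ij}^*=p_{ij}=p_{ij}^2$, $\sum_j p_{ij}=1=\sum_j p_{ji}$, $p_{ij}p_{ik}=0=p_{ji}p_{ki}$ for $j\neq k$, and such that there is a unital $*$-morphism $\Delta:\mathcal A\to\mathcal A\otimes\mathcal A$ (algebraic tensor product) with $\Delta(p_{ij})=\sum_k p_{ik}\otimes p_{kj}$. Quantum permutation groups (of possibly different sizes) are identified when isomorphic, i.e. when there is a $*$-isomorphism of the algebras intertwining the comultiplications $\Delta$. The trivial quantum group has algebra $\mathbb C$. $S_n^+$ is the quantum permutation group whose algebra is universal for ($\mathcal P_s$). The quantum automorphism group $\mathrm{Qu}(G)$ of a graph $G$ is the quantum permutation group whose algebra is the universal unital $*$-algebra generated by $u=(u_{xy})_{x,y\in V(G)}$ with relations ($\mathcal P_s$) and $u\,\mathrm{Adj}(G)=\mathrm{Adj}(G)\,u$, where $\mathrm{Adj}(G)$ is the adjacency matrix. The free product of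 $(\mathcal A,p)$ and $(\mathcal B,q)$ is $(\mathcal A*\mathcal B,\mathrm{Diag}(p,q))$ with $*$ the unital free product of $*$-algebras. The wreath product $(\mathcal A,u)\wr S_n^+$, for $(\mathcal A,u)$ of size $m$ and $S_n^+=(\mathcal S,p)$, has algebra $\mathcal A^{*n}*\mathcal S$ modulo the ideal generated by the commutators $[\nu_i(a),p_{ij}]$ ($a\in\mathcal A$, $1\le i,j\le n$), where $\nu_i:\mathcal A\to\mathcal A^{*n}$ is the $i$-th inclusion, and fundamental representation of size $mn$ with coefficients $w_{ij,kl}=\nu_i(u_{kl})p_{ij}$ (row $(i,k)$, column $(j,l)$). *)

(* Defs.v *)
From HB Require Import structures.
From mathcomp Require Import all_boot all_order all_algebra generic_quotient.
From mathcomp Require Import boolp.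
Set Implicit Arguments.
Unset Strict Implicit.
Unset Printing Implicit Defensive.
Import Order.TTheory GRing.Theory Num.Theory.
Local Open Scope ring_scope.
Local Open Scope quotient_scope.

(* The library's algType excludes the zero ring, which a presentation by
   generators and relations may a priori produce, and the library has no join
   of PzRing and Lmodule: the scaling is part of the mixin, and the module
   structure is recovered right below. *)
HB.mixin Record isStarAlgebra (C : numClosedFieldType) A of GRing.PzRing A := {
  ascale : C -> A -> A;
  ascaleA : forall k l x, ascale k (ascale l x) = ascale (k * l) x;
  ascale1 : left_id 1 ascale;
  ascaleDr : right_distributive ascale +%R;
  ascaleDl : forall x, {morph ascale^~ x : k l / k + l};
  ascaleAl : forall k x y, ascale k (x * y) = ascale k x * y;
  ascaleAr : forall k x y, ascale k (x * y) = x * ascale k y;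
  star : A -> A;
  starD : {morph star : x y / x + y};
  star_ascale : forall k x, star (ascale k x) = ascale k^* (star x);
  starM : forall x y : A, star (x * y) = star y * star x;
  starK : involutive star
}.

#[short(type="starAlgType")]
HB.structure Definition StarAlgebra (C : numClosedFieldType) :=
  {A of GRing.PzRing A & isStarAlgebra C A}.

HB.instance Definition _ (C : numClosedFieldType) (A : starAlgType C) :=
  GRing.Zmodule_isLmodule.Build C (StarAlgebra.sort A)
    (@ascaleA C A) (@ascale1 C A) (@ascaleDr C A) (@ascaleDl C A).

Section Scaling.
Variables (C : numClosedFieldType) (A : starAlgType C).
Implicit Types (k : C) (x y : A).
Lemma sscalerAl k x y : k *: (x * y) = (k *: x) * y.
Proof. exact: ascaleAl. Qed.
Lemma sscalerAr k x y : k *: (x * y) = x * (k *: y).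
Proof. exact: ascaleAr. Qed.
Lemma starZ k x : star (k *: x) = k^* *: star x.
Proof. exact: star_ascale. Qed.
End Scaling.

Section RegularStarAlgebra.
Variable C : numClosedFieldType.

Let rAl (k : C) (x y : C^o) : k *: (x * y) = (k *: x) * y.
Proof. exact: mulrA. Qed.
Let rAr (k : C) (x y : C^o) : k *: (x * y) = x * (k *: y).
Proof. exact: mulrCA. Qed.
Let cD : {morph (fun x : C^o => (x : C)^* : C^o) : x y / x + y}.
Proof. by move=> x y; rewrite rmorphD. Qed.
Let cZ (k : C) (x : C^o) :
  ((k *: x : C^o) : C)^* = (k^* *: ((x : C)^* : C^o) : C^o).
Proof. by rewrite /GRing.scale /= rmorphM. Qed.
Let cM (x y : C^o) : ((x * y : C^o) : C)^* = ((y : C)^* : C^o) * (x : C)^*.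
Proof. by rewrite rmorphM /= mulrC. Qed.
Let cK : involutive (fun x : C^o => (x : C)^* : C^o).
Proof. exact: conjCK. Qed.

HB.instance Definition _ :=
  isStarAlgebra.Build C C^o (@scalerA C C^o) (@scale1r C C^o)
    (@scalerDr C C^o) (@scalerDl C C^o) rAl rAr cD cZ cM cK.
End RegularStarAlgebra.

Section StarAlgebraTheory.
Variable C : numClosedFieldType.
Implicit Types A B D : starAlgType C.

Lemma star0 A : star (0 : A) = 0.
Proof. by apply: (addrI (star (0 : A))); rewrite -starD !addr0. Qed.

Lemma star1 A : star (1 : A) = 1.
Proof. by rewrite -[LHS]mulr1 -{2}[1]starK -starM mulr1 starK. Qed.

Lemma star_sum A (I : Type) (r : seq I) (P : pred I) (F : I -> A) :
  star (\sum_(i <- r | P i) F i) = \sum_(i <- r | P i) star (F i).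
Proof. by apply: (big_morph star (@starD _ A) (star0 A)). Qed.

Definition star_morphism A B (f : A -> B) : Prop :=
  [/\ linear f, monoid_morphism f & {morph f : a / star a}].

Section Morphism.
Variables (A B : starAlgType C) (f : A -> B).
Hypothesis fm : star_morphism f.
Lemma sm1 : f 1 = 1. Proof. by case: fm => _ []. Qed.
Lemma smM : {morph f : x y / x * y}. Proof. by case: fm => _ []. Qed.
Lemma smS : {morph f : x / star x}. Proof. by case: fm. Qed.
Lemma smD : {morph f : x y / x + y}.
Proof. by case: fm => fl _ _ x y; rewrite -[x]scale1r fl !scale1r. Qed.
Lemma sm0 : f 0 = 0.
Proof. by apply: (addrI (f 0)); rewrite -smD !addr0. Qed.
Lemma smZ k x : f (k *: x) = k *: f x.
Proof. by case: fm => fl _ _; rewrite -[k *: x]addr0 fl sm0 addr0. Qed.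
Lemma sm_sum (I : Type) (r : seq I) (P : pred I) (F : I -> A) :
  f (\sum_(i <- r | P i) F i) = \sum_(i <- r | P i) f (F i).
Proof. exact: (big_morph f smD sm0). Qed.
End Morphism.

Lemma star_morphismP A B (f : A -> B) :
  f 1 = 1 -> {morph f : x y / x + y} -> {morph f : x y / x * y} ->
  (forall k x, f (k *: x) = k *: f x) -> {morph f : x / star x} ->
  star_morphism f.
Proof. by move=> f1 fD fM fZ fS; split=> // k x y; rewrite fD fZ. Qed.

Lemma star_morphism_comp A B D (g : B -> D) (f : A -> B) :
  star_morphism g -> star_morphism f -> star_morphism (g \o f).
Proof.
move=> gm fm; apply: star_morphismP => /=.
- by rewrite (sm1 fm) (sm1 gm).
- by move=> x y /=; rewrite (smD fm) (smD gm).
- by move=> x y /=; rewrite (smM fm) (smM gm).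
- by move=> k x; rewrite (smZ fm) (smZ gm).
- by move=> x /=; rewrite (smS fm) (smS gm).
Qed.

Record star_subalgebra A (P : A -> Prop) : Prop := {
  ssub1 : P 1;
  ssubD : forall a b, P a -> P b -> P (a + b);
  ssubM : forall a b, P a -> P b -> P (a * b);
  ssubZ : forall k a, P a -> P (k *: a);
  ssubS : forall a, P a -> P (star a)
}.

Definition generates A (S : A -> Prop) : Prop :=
  forall P : A -> Prop, star_subalgebra P -> (forall a, S a -> P a) ->
  forall a, P a.

End StarAlgebraTheory.

Definition conj_mod (C : numClosedFieldType) (V : lmodType C) : Type := V.

Section ConjugateModule.
Variables (C : numClosedFieldType) (V : lmodType C).
HB.instance Definition _ := GRing.Zmodule.on (conj_mod V).
Let cscale (k : C) (v : conj_mod V) : conj_mod V := (k^* *: (v : V) : V).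
Let cscaleA k l v : cscale k (cscale l v) = cscale (k * l) v.
Proof. by rewrite /cscale scalerA rmorphM. Qed.
Let cscale1 : left_id 1 cscale.
Proof. by move=> v; rewrite /cscale rmorph1 scale1r. Qed.
Let cscaleDr : right_distributive cscale +%R.
Proof. by move=> k u v; rewrite /cscale scalerDr. Qed.
Let cscaleDl v : {morph cscale^~ v : k l / k + l}.
Proof. by move=> k l; rewrite /cscale rmorphD scalerDl. Qed.
HB.instance Definition _ := GRing.Zmodule_isLmodule.Build C (conj_mod V)
  cscaleA cscale1 cscaleDr cscaleDl.
Lemma conj_modZ (k : C) (v : conj_mod V) : k *: v = (k^* *: (v : V) : V).
Proof. by []. Qed.
End ConjugateModule.

Section TensorConstruction.
Variable C : numClosedFieldType.

Definition bilin (A B : starAlgType C) (V : lmodType C) (phi : A -> B -> V) :=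
  (forall b, linear (phi ^~ b)) /\ (forall a, linear (phi a)).

Section BilinTheory.
Variables (A B : starAlgType C) (V : lmodType C) (phi : A -> B -> V).
Hypothesis bp : bilin phi.
Lemma bilDl a a' b : phi (a + a') b = phi a b + phi a' b.
Proof. by have := bp.1 b 1 a a'; rewrite /= !scale1r. Qed.
Lemma bilDr a b b' : phi a (b + b') = phi a b + phi a b'.
Proof. by have := bp.2 a 1 b b'; rewrite /= !scale1r. Qed.
Lemma bil0l b : phi 0 b = 0.
Proof. by apply: (addrI (phi 0 b)); rewrite -bilDl !addr0. Qed.
Lemma bil0r a : phi a 0 = 0.
Proof. by apply: (addrI (phi a 0)); rewrite -bilDr !addr0. Qed.
Lemma bilZl k a b : phi (k *: a) b = k *: phi a b.
Proof. by have := bp.1 b k a 0; rewrite /= !addr0 bil0l addr0. Qed.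
Lemma bilZr k a b : phi a (k *: b) = k *: phi a b.
Proof. by have := bp.2 a k b 0; rewrite /= !addr0 bil0r addr0. Qed.
End BilinTheory.

Variables A B : starAlgType C.

Definition tsum (V : lmodType C) (phi : A -> B -> V) (s : seq (A * B)) : V :=
  \sum_(x <- s) phi x.1 x.2.

(* The algebraic tensor product: formal sums of pairs (a, b), two of them
   being identified when no bilinear map tells them apart. *)
Definition teq (s t : seq (A * B)) : bool :=
  `[< forall (V : lmodType C) (phi : A -> B -> V), bilin phi ->
      tsum phi s = tsum phi t >].

Let teq_refl : reflexive teq. Proof. by move=> s; apply/asboolP. Qed.
Let teq_sym : symmetric teq.
Proof.
by move=> s t; apply/asboolP/asboolP => H V phi bp; rewrite (H V phi bp).
Qed.
Let teq_trans : transitive teq.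
Proof.
move=> t s u /asboolP H /asboolP K; apply/asboolP => V phi bp.
by rewrite (H V phi bp) (K V phi bp).
Qed.
Canonical teq_equiv := EquivRel teq teq_refl teq_sym teq_trans.

Definition tensor_car : Type := {eq_quot teq_equiv}.
HB.instance Definition _ := Choice.on tensor_car.

Local Notation cls s := (\pi_({eq_quot teq_equiv}) s : tensor_car).

Let teqP s t :
  (forall (V : lmodType C) (phi : A -> B -> V), bilin phi ->
     tsum phi s = tsum phi t) <-> cls s = cls t.
Proof.
by split=> [H|/eqmodP/asboolP//]; apply/eqmodP/asboolP.
Qed.

Definition tlift_car (V : lmodType C) (phi : A -> B -> V) (x : tensor_car) : V :=
  tsum phi (repr (x : {eq_quot teq_equiv})).

Let tlift_pi (V : lmodType C) (phi : A -> B -> V) s :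
  bilin phi -> tlift_car phi (cls s) = tsum phi s.
Proof.
by move=> bp; apply: (proj2 (teqP _ s) _ V phi bp); rewrite reprK.
Qed.

Let tensorE (x : tensor_car) : exists s, x = cls s.
Proof. by exists (repr (x : {eq_quot teq_equiv})); rewrite reprK. Qed.

Let tensor_eq (x y : tensor_car) :
  (forall (V : lmodType C) (phi : A -> B -> V), bilin phi ->
     tlift_car phi x = tlift_car phi y) -> x = y.
Proof.
have [s ->] := tensorE x; have [t ->] := tensorE y => H.
by apply/teqP => V phi bp; rewrite -!tlift_pi // H.
Qed.

Let addt (x y : tensor_car) : tensor_car :=
  cls (repr (x : {eq_quot teq_equiv}) ++ repr (y : {eq_quot teq_equiv})).
Let scalet (k : C) (x : tensor_car) : tensor_car :=
  cls [seq (k *: p.1, p.2) | p <- repr (x : {eq_quot teq_equiv})].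
Let oppt (x : tensor_car) : tensor_car := scalet (-1) x.
Let zerot : tensor_car := cls [::].
Let mult (x y : tensor_car) : tensor_car :=
  cls [seq (p.1 * q.1, p.2 * q.2) | p <- repr (x : {eq_quot teq_equiv}),
                                    q <- repr (y : {eq_quot teq_equiv})].
Let start (x : tensor_car) : tensor_car :=
  cls [seq (star p.1, star p.2) | p <- repr (x : {eq_quot teq_equiv})].
Let onet : tensor_car := cls [:: (1, 1)].

Let tliftD (V : lmodType C) (phi : A -> B -> V) x y :
  bilin phi -> tlift_car phi (addt x y) = tlift_car phi x + tlift_car phi y.
Proof. by move=> bp; rewrite tlift_pi // /tsum big_cat. Qed.
Let tliftZ (V : lmodType C) (phi : A -> B -> V) k x :
  bilin phi -> tlift_car phi (scalet k x) = k *: tlift_car phi x.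
Proof.
move=> bp; rewrite tlift_pi // /tsum big_map scaler_sumr.
by apply: eq_bigr => p _; rewrite bilZl.
Qed.
Let tlift0 (V : lmodType C) (phi : A -> B -> V) :
  bilin phi -> tlift_car phi zerot = 0.
Proof. by move=> bp; rewrite tlift_pi // /tsum big_nil. Qed.

Let addtA : associative addt.
Proof. by move=> x y z; apply: tensor_eq => V p b; rewrite !tliftD // addrA. Qed.
Let addtC : commutative addt.
Proof. by move=> x y; apply: tensor_eq => V p b; rewrite !tliftD // addrC. Qed.
Let add0t : left_id zerot addt.
Proof.
by move=> x; apply: tensor_eq => V p b; rewrite !tliftD // tlift0 // add0r.
Qed.
Let addNt : left_inverse zerot oppt addt.
Proof.
move=> x; apply: tensor_eq => V p b.
by rewrite !tliftD // tlift0 // tliftZ // scaleN1r addNr.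
Qed.
HB.instance Definition _ :=
  GRing.isZmodule.Build tensor_car addtA addtC add0t addNt.

Let scaletA k l x : scalet k (scalet l x) = scalet (k * l) x.
Proof. by apply: tensor_eq => V p b; rewrite !tliftZ // scalerA. Qed.
Let scale1t : left_id 1 scalet.
Proof. by move=> x; apply: tensor_eq => V p b; rewrite tliftZ // scale1r. Qed.
Let scaletDr : right_distributive scalet +%R.
Proof.
move=> k x y; apply: tensor_eq => V p b.
by rewrite tliftZ // !tliftD // !tliftZ // scalerDr.
Qed.
Let scaletDl x : {morph scalet^~ x : k l / k + l}.
Proof.
move=> k l; apply: tensor_eq => V p b.
by rewrite tliftD // !tliftZ // scalerDl.
Qed.
HB.instance Definition _ :=
  GRing.Zmodule_isLmodule.Build C tensor_car scaletA scale1t scaletDr scaletDl.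

Definition tens_car (a : A) (b : B) : tensor_car := cls [:: (a, b)].

Lemma tlift_tens_car (V : lmodType C) (phi : A -> B -> V) a b :
  bilin phi -> tlift_car phi (tens_car a b) = phi a b.
Proof. by move=> bp; rewrite tlift_pi // /tsum big_seq1. Qed.

Lemma tlift_linear_car (V : lmodType C) (phi : A -> B -> V) :
  bilin phi -> linear (tlift_car phi).
Proof. by move=> bp k x y; rewrite tliftD // tliftZ. Qed.

Lemma tens_bilin_car : bilin tens_car.
Proof.
split=> [b|a] k x y; apply: tensor_eq => V phi bp; rewrite tlift_linear_car //.
  by rewrite /= !tlift_tens_car // bilDl // bilZl.
by rewrite /= !tlift_tens_car // bilDr // bilZr.
Qed.

Lemma tensor_sum_car (x : tensor_car) :
  exists s : seq (A * B), x = \sum_(p <- s) tens_car p.1 p.2.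
Proof.
have [s ->] := tensorE x; exists s; elim: s => [|p s IHs].
  by rewrite big_nil.
rewrite big_cons -IHs; apply: tensor_eq => V phi bp.
by rewrite tliftD // tlift_tens_car // !tlift_pi // /tsum big_cons.
Qed.

Lemma tensor_ind_car (P : tensor_car -> Prop) :
  P 0 -> (forall a b, P (tens_car a b)) -> (forall x y, P x -> P y -> P (x + y)) ->
  forall x, P x.
Proof.
move=> P0 Pt PD x; have [s ->] := tensor_sum_car x.
by elim/big_ind: _ => [||p _]; [exact: P0|exact: PD|exact: Pt].
Qed.

Let bilin_mul (V : lmodType C) (phi : A -> B -> V) (t : seq (A * B)) :
  bilin phi ->
  bilin (fun a b => \sum_(q <- t) phi (a * q.1) (b * q.2)).
Proof.
move=> bp; split=> [b|a] k x y /=; rewrite scaler_sumr -big_split;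
  apply: eq_bigr => q _ /=.
  by rewrite mulrDl (bilDl bp) -sscalerAl (bilZl bp).
by rewrite mulrDl (bilDr bp) -sscalerAl (bilZr bp).
Qed.
Let bilin_mulr (V : lmodType C) (phi : A -> B -> V) (s : seq (A * B)) :
  bilin phi ->
  bilin (fun a b => \sum_(p <- s) phi (p.1 * a) (p.2 * b)).
Proof.
move=> bp; split=> [b|a] k x y /=; rewrite scaler_sumr -big_split;
  apply: eq_bigr => q _ /=.
  by rewrite mulrDr (bilDl bp) -sscalerAr (bilZl bp).
by rewrite mulrDr (bilDr bp) -sscalerAr (bilZr bp).
Qed.

Let mult_pi s t :
  mult (cls s) (cls t) = cls [seq (p.1 * q.1, p.2 * q.2) | p <- s, q <- t].
Proof.
apply/teqP => V phi bp; rewrite /tsum !big_allpairs_dep /=.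
set s' := repr _; set t' := repr _.
have Hs : cls s' = cls s by rewrite /s' reprK.
have Ht : cls t' = cls t by rewrite /t' reprK.
have := proj2 (teqP _ _) Hs V _ (bilin_mul t' bp); rewrite /tsum => ->.
rewrite exchange_big [RHS]exchange_big /=.
exact: (proj2 (teqP _ _) Ht V _ (bilin_mulr s bp)).
Qed.

Let bilin_star (V : lmodType C) (phi : A -> B -> V) : bilin phi ->
  bilin ((fun a b => phi (star a) (star b)) : A -> B -> conj_mod V).
Proof.
move=> bp; split=> [b|a] k x y /=; rewrite starD starZ conj_modZ.
  by rewrite (bilDl bp) (bilZl bp).
by rewrite (bilDr bp) (bilZr bp).
Qed.

Let start_pi s :
  start (cls s) = cls [seq (star p.1, star p.2) | p <- s].
Proof.
apply/teqP => V phi bp; rewrite /tsum !big_map /=.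
set s' := repr _; have Hs : cls s' = cls s by rewrite /s' reprK.
exact: (proj2 (teqP _ _) Hs _ _ (bilin_star bp)).
Qed.

Let tlift_mul (V : lmodType C) (phi : A -> B -> V) s t : bilin phi ->
  tlift_car phi (mult (cls s) (cls t)) =
  \sum_(p <- s) \sum_(q <- t) phi (p.1 * q.1) (p.2 * q.2).
Proof. by move=> bp; rewrite mult_pi tlift_pi // /tsum big_allpairs_dep. Qed.

Let cls_add s t : cls s + cls t = cls (s ++ t).
Proof.
by apply: tensor_eq => V p b; rewrite tliftD // !tlift_pi // /tsum big_cat.
Qed.

Let multA : associative mult.
Proof.
move=> x y z; have [s ->] := tensorE x; have [t ->] := tensorE y.
have [u ->] := tensorE z; rewrite !mult_pi; apply: tensor_eq => V p b.
rewrite !tlift_pi // /tsum [LHS]big_allpairs_dep [RHS]big_allpairs_dep /=.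
rewrite [RHS]big_allpairs_dep /=; apply: eq_bigr => i _.
rewrite big_allpairs_dep /=; apply: eq_bigr => j _.
by apply: eq_bigr => k _; rewrite !mulrA.
Qed.
Let mul1t : left_id onet mult.
Proof.
move=> x; have [s ->] := tensorE x; apply: tensor_eq => V p b.
rewrite tlift_mul // tlift_pi // big_seq1.
by apply: eq_bigr => i _; rewrite !mul1r.
Qed.
Let mult1 : right_id onet mult.
Proof.
move=> x; have [s ->] := tensorE x; apply: tensor_eq => V p b.
rewrite tlift_mul // tlift_pi //.
by apply: eq_bigr => i _; rewrite big_seq1 !mulr1.
Qed.
Let multDl : left_distributive mult +%R.
Proof.
move=> x y z; have [s ->] := tensorE x; have [t ->] := tensorE y.
have [u ->] := tensorE z; apply: tensor_eq => V p b.
by rewrite cls_add [RHS]tliftD // !tlift_mul // big_cat.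
Qed.
Let multDr : right_distributive mult +%R.
Proof.
move=> x y z; have [s ->] := tensorE x; have [t ->] := tensorE y.
have [u ->] := tensorE z; apply: tensor_eq => V p b.
rewrite cls_add [RHS]tliftD // !tlift_mul // -big_split.
by apply: eq_bigr => i _; rewrite big_cat.
Qed.
HB.instance Definition _ :=
  GRing.Zmodule_isPzRing.Build tensor_car multA mul1t mult1 multDl multDr.

Let cls_scale k s : k *: cls s = cls [seq (k *: p.1, p.2) | p <- s].
Proof.
apply: tensor_eq => V p b; rewrite [LHS]tliftZ // !tlift_pi // /tsum big_map.
by rewrite scaler_sumr; apply: eq_bigr => i _; rewrite bilZl.
Qed.
Let tscalerAl (k : C) (x y : tensor_car) : k *: (x * y) = (k *: x) * y.
Proof.
have [s ->] := tensorE x; have [t ->] := tensorE y.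
apply: tensor_eq => V p b; rewrite [LHS]tliftZ // cls_scale !tlift_mul //.
rewrite big_map scaler_sumr; apply: eq_bigr => i _; rewrite scaler_sumr.
by apply: eq_bigr => j _; rewrite -sscalerAl bilZl.
Qed.
Let tscalerAr (k : C) (x y : tensor_car) : k *: (x * y) = x * (k *: y).
Proof.
have [s ->] := tensorE x; have [t ->] := tensorE y.
apply: tensor_eq => V p b; rewrite [LHS]tliftZ // cls_scale !tlift_mul //.
rewrite scaler_sumr; apply: eq_bigr => i _; rewrite scaler_sumr big_map.
by apply: eq_bigr => j _; rewrite -sscalerAr bilZl.
Qed.
Let tstarD : {morph start : x y / x + y}.
Proof.
move=> x y; have [s ->] := tensorE x; have [t ->] := tensorE y.
by rewrite cls_add !start_pi cls_add map_cat.
Qed.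
Let tstarZ (k : C) (x : tensor_car) : start (k *: x) = k^* *: start x.
Proof.
have [s ->] := tensorE x; rewrite cls_scale !start_pi cls_scale -!map_comp.
by congr (cls _); apply: eq_map => p /=; rewrite starZ.
Qed.
Let tstarM (x y : tensor_car) : start (x * y) = start y * start x.
Proof.
have [s ->] := tensorE x; have [t ->] := tensorE y.
rewrite [_ * _]mult_pi !start_pi [RHS]mult_pi.
apply: tensor_eq => V p b; rewrite !tlift_pi // /tsum big_map.
rewrite !big_allpairs_dep /= exchange_big big_map; apply: eq_bigr => i _.
by rewrite big_map; apply: eq_bigr => j _ /=; rewrite !starM.
Qed.
Let tstarK : involutive start.
Proof.
move=> x; have [s ->] := tensorE x; rewrite !start_pi -map_comp.
by congr (cls _); rewrite -[RHS]map_id; apply: eq_map => -[a b] /=; rewrite !starK.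
Qed.
HB.instance Definition _ := isStarAlgebra.Build C tensor_car
  scaletA scale1t scaletDr scaletDl tscalerAl tscalerAr tstarD tstarZ tstarM tstarK.

Lemma tensM_car a b a' b' : tens_car a b * tens_car a' b' = tens_car (a * a') (b * b').
Proof. exact: mult_pi. Qed.
Lemma tens1_car : tens_car 1 1 = 1. Proof. by []. Qed.
Lemma tens_star_car a b : star (tens_car a b) = tens_car (star a) (star b).
Proof. exact: start_pi. Qed.

End TensorConstruction.

Section Tensor.
Variable C : numClosedFieldType.
Implicit Types A B : starAlgType C.

Definition tensor A B : starAlgType C := tensor_car A B.
Definition tens A B (a : A) (b : B) : tensor A B := tens_car a b.
Definition tlift A B (V : lmodType C) (phi : A -> B -> V) :
  tensor A B -> V := tlift_car phi.

Lemma tlift_tens A B (V : lmodType C) (phi : A -> B -> V) a b :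
  bilin phi -> tlift phi (tens a b) = phi a b.
Proof. exact: tlift_tens_car. Qed.

Lemma tlift_linear A B (V : lmodType C) (phi : A -> B -> V) :
  bilin phi -> linear (tlift phi).
Proof. exact: tlift_linear_car. Qed.

Lemma tens_bilin A B : bilin (@tens A B).
Proof. exact: tens_bilin_car. Qed.

Lemma tensor_sum A B (x : tensor A B) :
  exists s : seq (A * B), x = \sum_(p <- s) tens p.1 p.2.
Proof. exact: tensor_sum_car. Qed.

Lemma tensor_ind A B (P : tensor A B -> Prop) :
  P 0 -> (forall a b, P (tens a b)) -> (forall x y, P x -> P y -> P (x + y)) ->
  forall x, P x.
Proof. exact: tensor_ind_car. Qed.

Lemma tensM A B (a a' : A) (b b' : B) :
  tens a b * tens a' b' = tens (a * a') (b * b').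
Proof. exact: tensM_car. Qed.
Lemma tens1 A B : tens (1 : A) (1 : B) = 1. Proof. exact: tens1_car. Qed.
Lemma tens_star A B (a : A) (b : B) :
  star (tens a b) = tens (star a) (star b).
Proof. exact: tens_star_car. Qed.
End Tensor.

Section TensorMorphisms.
Variable C : numClosedFieldType.
Implicit Types A B D : starAlgType C.

Lemma tensDl A B (a a' : A) (b : B) :
  tens (a + a') b = tens a b + tens a' b.
Proof. exact: (bilDl (tens_bilin A B)). Qed.
Lemma tensDr A B (a : A) (b b' : B) :
  tens a (b + b') = tens a b + tens a b'.
Proof. exact: (bilDr (tens_bilin A B)). Qed.
Lemma tens0l A B (b : B) : tens (0 : A) b = 0.
Proof. exact: (bil0l (tens_bilin A B)). Qed.
Lemma tens0r A B (a : A) : tens a (0 : B) = 0.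
Proof. exact: (bil0r (tens_bilin A B)). Qed.
Lemma tensZl A B k (a : A) (b : B) : tens (k *: a) b = k *: tens a b.
Proof. exact: (bilZl (tens_bilin A B)). Qed.
Lemma tensZr A B k (a : A) (b : B) : tens a (k *: b) = k *: tens a b.
Proof. exact: (bilZr (tens_bilin A B)). Qed.
Lemma tens_suml A B (I : Type) (r : seq I) (P : pred I) (F : I -> A) (b : B) :
  tens (\sum_(i <- r | P i) F i) b = \sum_(i <- r | P i) tens (F i) b.
Proof.
by apply: (big_morph (fun a => tens a b)) => [x y|];
  rewrite ?tensDl ?tens0l.
Qed.
Lemma tens_sumr A B (I : Type) (r : seq I) (P : pred I) (a : A) (F : I -> B) :
  tens a (\sum_(i <- r | P i) F i) = \sum_(i <- r | P i) tens a (F i).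
Proof.
by apply: (big_morph (fun b => tens a b)) => [x y|];
  rewrite ?tensDr ?tens0r.
Qed.

Lemma tlift_star_morphism A B D (phi : A -> B -> D) :
  bilin phi -> phi 1 1 = 1 ->
  (forall a a' b b', phi (a * a') (b * b') = phi a b * phi a' b') ->
  (forall a b, phi (star a) (star b) = star (phi a b)) ->
  star_morphism (tlift phi : tensor A B -> D).
Proof.
move=> bp p1 pM pS; have pl := tlift_linear bp.
have pD : {morph (tlift phi : tensor A B -> D) : x y / x + y}.
  by move=> x y; have := pl 1 x y; rewrite !scale1r.
have p0 : tlift phi (0 : tensor A B) = 0.
  by apply: (addrI (tlift phi (0 : tensor A B))); rewrite -pD !addr0.
apply: star_morphismP => //.
- by rewrite -tens1 tlift_tens.
- elim/tensor_ind => [y|a b|x x' Hx Hx' y]; first by rewrite !mul0r p0 mul0r.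
    elim/tensor_ind => [|a' b'|y y' Hy Hy']; first by rewrite !mulr0 p0 mulr0.
      by rewrite tensM !tlift_tens.
    by rewrite mulrDr !pD mulrDr Hy Hy'.
  by rewrite mulrDl !pD mulrDl Hx Hx'.
- by move=> k x; have := pl k x 0; rewrite !addr0 p0 addr0.
- elim/tensor_ind => [|a b|x y Hx Hy]; first by rewrite star0 p0 star0.
    by rewrite tens_star !tlift_tens.
  by rewrite starD !pD starD Hx Hy.
Qed.

Definition tmap A B A' B' (f : A -> A') (g : B -> B') :
    tensor A B -> tensor A' B' :=
  tlift (fun a b => tens (f a) (g b)).

Section TmapTheory.
Variables (A B A' B' : starAlgType C) (f : A -> A') (g : B -> B').
Hypotheses (fm : star_morphism f) (gm : star_morphism g).

Let tmap_bilin : bilin (fun a b => tens (f a) (g b)).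
Proof.
split=> [b|a] k x y /=.
  by rewrite (smD fm) (smZ fm) tensDl tensZl.
by rewrite (smD gm) (smZ gm) tensDr tensZr.
Qed.

Lemma tmap_tens a b : tmap f g (tens a b) = tens (f a) (g b).
Proof. by rewrite /tmap tlift_tens. Qed.

Lemma tmap_star_morphism : star_morphism (tmap f g).
Proof.
apply: tlift_star_morphism => [||a a' b b'|a b]; first exact: tmap_bilin.
- by rewrite (sm1 fm) (sm1 gm) tens1.
- by rewrite (smM fm) (smM gm) tensM.
- by rewrite (smS fm) (smS gm) tens_star.
Qed.
End TmapTheory.
End TensorMorphisms.

Inductive sterm (C : numClosedFieldType) (X : Type) : Type :=
| SGen of X
| SZero
| SOne
| SAdd of sterm C X & sterm C X
| SMul of sterm C X & sterm C X
| SScale of C & sterm C X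
| SStar of sterm C X.
Arguments SZero {C X}.
Arguments SOne {C X}.

Fixpoint teval (C : numClosedFieldType) (X : Type) (A : starAlgType C)
    (f : X -> A) (t : sterm C X) : A :=
  match t with
  | SGen x => f x
  | SZero => 0
  | SOne => 1
  | SAdd s t => teval f s + teval f t
  | SMul s t => teval f s * teval f t
  | SScale k t => k *: teval f t
  | SStar t => star (teval f t)
  end.

HB.instance Definition _ (C : numClosedFieldType) (X : Type) :=
  gen_eqMixin (sterm C X).
HB.instance Definition _ (C : numClosedFieldType) (X : Type) :=
  gen_choiceMixin (sterm C X).

(* The universal unital *-algebra generated by X with relations P: terms in X,
   two of them being identified when they agree in every *-algebra and for all
   values of the generators satisfying P. Below P is always a conjunction of
   identities, so that the generators themselves satisfy it. *)
Section UniversalAlgebra.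
Variables (C : numClosedFieldType) (X : Type).
Variable P : forall A : starAlgType C, (X -> A) -> Prop.

Definition ueq (s t : sterm C X) : bool :=
  `[< forall (A : starAlgType C) (f : X -> A), P f -> teval f s = teval f t >].

Let ueq_refl : reflexive ueq. Proof. by move=> s; apply/asboolP. Qed.
Let ueq_sym : symmetric ueq.
Proof. by move=> s t; apply/asboolP/asboolP => H A f Pf; rewrite (H A f Pf). Qed.
Let ueq_trans : transitive ueq.
Proof.
move=> t s u /asboolP H /asboolP K; apply/asboolP => A f Pf.
by rewrite (H A f Pf) (K A f Pf).
Qed.
Canonical ueq_equiv := EquivRel ueq ueq_refl ueq_sym ueq_trans.

Definition univ_alg : Type := {eq_quot ueq_equiv}.
HB.instance Definition _ := Choice.on univ_alg.

Local Notation cls s := (\pi_({eq_quot ueq_equiv}) s : univ_alg).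
Local Notation rep x := (repr (x : {eq_quot ueq_equiv})).

Let ul (A : starAlgType C) (f : X -> A) (x : univ_alg) : A :=
  teval f (rep x).

Let ul_pi (A : starAlgType C) (f : X -> A) t :
  P f -> ul f (cls t) = teval f t.
Proof.
move=> Pf; have /eqmodP/asboolP H : rep (cls t) = t %[mod {eq_quot ueq_equiv}].
  by rewrite reprK.
exact: H.
Qed.

Let ul_eq (x y : univ_alg) :
  (forall (A : starAlgType C) (f : X -> A), P f -> ul f x = ul f y) ->
  x = y.
Proof.
move=> H; rewrite -[x](reprK (x : {eq_quot ueq_equiv})).
rewrite -[y](reprK (y : {eq_quot ueq_equiv})).
by apply/eqmodP/asboolP => A f Pf; exact: H.
Qed.

Let addu (x y : univ_alg) : univ_alg := cls (SAdd (rep x) (rep y)).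
Let mulu (x y : univ_alg) : univ_alg := cls (SMul (rep x) (rep y)).
Let scaleu (k : C) (x : univ_alg) : univ_alg := cls (SScale k (rep x)).
Let oppu (x : univ_alg) : univ_alg := scaleu (-1) x.
Let staru (x : univ_alg) : univ_alg := cls (SStar (rep x)).
Let zerou : univ_alg := cls SZero.
Let oneu : univ_alg := cls SOne.

Let ulE (A : starAlgType C) (f : X -> A) : P f ->
  ((ul f zerou = 0)%R * (ul f oneu = 1)%R *
   (forall x y, ul f (addu x y) = ul f x + ul f y)%R *
   (forall x y, ul f (mulu x y) = ul f x * ul f y)%R *
   (forall k x, ul f (scaleu k x) = k *: ul f x)%R *
   (forall x, ul f (staru x) = star (ul f x)))%type.
Proof. by move=> Pf; do !split=> *; rewrite ul_pi. Qed.

Let adduA : associative addu.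
Proof. by move=> x y z; apply: ul_eq => A f Pf; rewrite !(ulE Pf) addrA. Qed.
Let adduC : commutative addu.
Proof. by move=> x y; apply: ul_eq => A f Pf; rewrite !(ulE Pf) addrC. Qed.
Let add0u : left_id zerou addu.
Proof. by move=> x; apply: ul_eq => A f Pf; rewrite !(ulE Pf) add0r. Qed.
Let addNu : left_inverse zerou oppu addu.
Proof.
by move=> x; apply: ul_eq => A f Pf; rewrite !(ulE Pf) scaleN1r addNr.
Qed.
HB.instance Definition _ :=
  GRing.isZmodule.Build univ_alg adduA adduC add0u addNu.

Let muluA : associative mulu.
Proof. by move=> x y z; apply: ul_eq => A f Pf; rewrite !(ulE Pf) mulrA. Qed.
Let mul1u : left_id oneu mulu.
Proof. by move=> x; apply: ul_eq => A f Pf; rewrite !(ulE Pf) mul1r. Qed.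
Let mulu1 : right_id oneu mulu.
Proof. by move=> x; apply: ul_eq => A f Pf; rewrite !(ulE Pf) mulr1. Qed.
Let muluDl : left_distributive mulu +%R.
Proof. by move=> x y z; apply: ul_eq => A f Pf; rewrite !(ulE Pf) mulrDl. Qed.
Let muluDr : right_distributive mulu +%R.
Proof. by move=> x y z; apply: ul_eq => A f Pf; rewrite !(ulE Pf) mulrDr. Qed.
HB.instance Definition _ :=
  GRing.Zmodule_isPzRing.Build univ_alg muluA mul1u mulu1 muluDl muluDr.

Let scaleuA k l x : scaleu k (scaleu l x) = scaleu (k * l) x.
Proof. by apply: ul_eq => A f Pf; rewrite !(ulE Pf) scalerA. Qed.
Let scale1u : left_id 1 scaleu.
Proof. by move=> x; apply: ul_eq => A f Pf; rewrite !(ulE Pf) scale1r. Qed.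
Let scaleuDr : right_distributive scaleu +%R.
Proof.
by move=> k x y; apply: ul_eq => A f Pf; rewrite !(ulE Pf) scalerDr.
Qed.
Let scaleuDl x : {morph scaleu^~ x : k l / k + l}.
Proof.
by move=> k l; apply: ul_eq => A f Pf; rewrite !(ulE Pf) scalerDl.
Qed.
HB.instance Definition _ :=
  GRing.Zmodule_isLmodule.Build C univ_alg scaleuA scale1u scaleuDr scaleuDl.

Let scaleuAl k (x y : univ_alg) : scaleu k (x * y) = scaleu k x * y.
Proof. by apply: ul_eq => A f Pf; rewrite !(ulE Pf) sscalerAl. Qed.
Let scaleuAr k (x y : univ_alg) : scaleu k (x * y) = x * scaleu k y.
Proof. by apply: ul_eq => A f Pf; rewrite !(ulE Pf) sscalerAr. Qed.
Let staruD : {morph staru : x y / x + y}.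
Proof. by move=> x y; apply: ul_eq => A f Pf; rewrite !(ulE Pf) starD. Qed.
Let staruZ k x : staru (scaleu k x) = scaleu k^* (staru x).
Proof. by apply: ul_eq => A f Pf; rewrite !(ulE Pf) starZ. Qed.
Let staruM (x y : univ_alg) : staru (x * y) = staru y * staru x.
Proof. by apply: ul_eq => A f Pf; rewrite !(ulE Pf) starM. Qed.
Let staruK : involutive staru.
Proof. by move=> x; apply: ul_eq => A f Pf; rewrite !(ulE Pf) starK. Qed.
HB.instance Definition _ := isStarAlgebra.Build C univ_alg
  scaleuA scale1u scaleuDr scaleuDl scaleuAl scaleuAr
  staruD staruZ staruM staruK.

Definition univ : starAlgType C := univ_alg.
Definition ulift (A : starAlgType C) (f : X -> A) (x : univ) : A :=
  teval f (rep x).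

Lemma univ_eq (x y : univ) :
  (forall (A : starAlgType C) (f : X -> A), P f -> ulift f x = ulift f y) ->
  x = y.
Proof. exact: ul_eq. Qed.

Let ulift_pi (A : starAlgType C) (f : X -> A) t :
  P f -> ulift f (cls t) = teval f t.
Proof. exact: ul_pi. Qed.

Definition gen (x : X) : univ := cls (SGen C x).

Lemma ulift_gen (A : starAlgType C) (f : X -> A) x :
  P f -> ulift f (gen x) = f x.
Proof. by move=> Pf; rewrite ulift_pi. Qed.

Lemma ulift_morphism (A : starAlgType C) (f : X -> A) :
  P f -> star_morphism (ulift f).
Proof.
move=> Pf; apply: star_morphismP; have [[[[[_ u1] uD] uM] uZ] uS] := ulE Pf.
- exact: u1.
- exact: uD.
- exact: uM.
- exact: uZ.
- exact: uS.
Qed.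

Lemma gen_generates : generates (fun a : univ => exists x, a = gen x).
Proof.
move=> Q Qs Qg a; rewrite -[a](reprK (a : {eq_quot ueq_equiv})).
elim: (rep a) => [x|||s Ps t Pt|s Ps t Pt|k t Pt|t Pt].
- by apply: Qg; exists x.
- have -> : cls SZero = 0 *: (1 : univ) by rewrite scale0r.
  by apply: (ssubZ Qs); apply: (ssub1 Qs).
- exact: (ssub1 Qs).
- have -> : cls (SAdd s t) = (cls s : univ) + cls t.
    by apply: univ_eq => A f Pf; rewrite (smD (ulift_morphism Pf)) !ulift_pi.
  exact: (ssubD Qs).
- have -> : cls (SMul s t) = (cls s : univ) * cls t.
    by apply: univ_eq => A f Pf; rewrite (smM (ulift_morphism Pf)) !ulift_pi.
  exact: (ssubM Qs).
- have -> : cls (SScale k t) = k *: (cls t : univ).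
    by apply: univ_eq => A f Pf; rewrite (smZ (ulift_morphism Pf)) !ulift_pi.
  exact: (ssubZ Qs).
- have -> : cls (SStar t) = star (cls t : univ).
    by apply: univ_eq => A f Pf; rewrite (smS (ulift_morphism Pf)) !ulift_pi.
  exact: (ssubS Qs).
Qed.

Lemma gen_star_morphism (A : starAlgType C) (g : A -> X) :
  (forall (D : starAlgType C) (f : X -> D),
     P f -> star_morphism (fun a => f (g a))) ->
  star_morphism (fun a => gen (g a)).
Proof.
move=> H; apply: star_morphismP => [|x y|x y|k x|x]; apply: univ_eq => D f Pf;
  have lm := ulift_morphism Pf; have fm := H D f Pf;
  rewrite ?(sm1 lm) ?(smD lm) ?(smM lm) ?(smZ lm) ?(smS lm) !ulift_gen //.
- exact: (sm1 fm).
- exact: (smD fm).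
- exact: (smM fm).
- exact: (smZ fm).
- exact: (smS fm).
Qed.
End UniversalAlgebra.

Section QuantumPermutationGroups.
Variable C : numClosedFieldType.

Record magic_unitary (I : finType) (A : starAlgType C) (p : I -> I -> A) : Prop := {
  magic_star : forall i j, star (p i j) = p i j;
  magic_idem : forall i j, p i j * p i j = p i j;
  magic_row : forall i, \sum_j p i j = 1;
  magic_col : forall i, \sum_j p j i = 1;
  magic_orthr : forall i j k, j != k -> p i j * p i k = 0;
  magic_orthc : forall i j k, j != k -> p j i * p k i = 0
}.

(* The finite index set pts replaces {1, ..., n}. *)
Record qpg := Qpg {
  pts : finType;
  alg : starAlgType C;
  pts_gt0 : (0 < #|pts|)%N;
  fund : pts -> pts -> alg;
  comul : alg -> tensor alg alg;
  fund_magic : magic_unitary fund;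
  fund_generates : generates (fun a => exists i j, a = fund i j);
  comul_morphism : star_morphism comul;
  comul_fund : forall i j,
    comul (fund i j) = \sum_k tens (fund i k) (fund k j)
}.

Definition qpg_iso (G H : qpg) : Prop :=
  exists f : alg G -> alg H, [/\ star_morphism f, bijective f &
    forall a, comul (f a) = tmap f f (comul a)].

Section MagicTheory.
Variables (I : finType) (A : starAlgType C) (p : I -> I -> A).
Hypothesis pm : magic_unitary p.

Lemma magicMr i j k : p i j * p i k = (j == k)%:R * p i j.
Proof.
case: eqVneq => [<-|njk]; first by rewrite mul1r (magic_idem pm).
by rewrite mul0r (magic_orthr pm).
Qed.
Lemma magicMc i j k : p j i * p k i = (j == k)%:R * p j i.
Proof.
case: eqVneq => [<-|njk]; first by rewrite mul1r (magic_idem pm).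
by rewrite mul0r (magic_orthc pm).
Qed.

Lemma magic_morph (B : starAlgType C) (f : A -> B) :
  star_morphism f -> magic_unitary (fun i j => f (p i j)).
Proof.
move=> fm; split=> [i j|i j|i|i|i j k njk|i j k njk].
- by rewrite -(smS fm) (magic_star pm).
- by rewrite -(smM fm) (magic_idem pm).
- by rewrite -(sm_sum fm) (magic_row pm) (sm1 fm).
- by rewrite -(sm_sum fm) (magic_col pm) (sm1 fm).
- by rewrite -(smM fm) (magic_orthr pm) // (sm0 fm).
- by rewrite -(smM fm) (magic_orthc pm) // (sm0 fm).
Qed.
End MagicTheory.

Lemma magic_tens (I : finType) (A B : starAlgType C) (p : I -> I -> A)
    (q : I -> I -> B) :
  magic_unitary p -> magic_unitary q -> magic_unitary (fun i j => \sum_k tens (p i k) (q k j)).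
Proof.
move=> pm qm.
have row i j k :
    (\sum_z tens (p i z) (q z j)) * (\sum_z tens (p i z) (q z k)) =
    \sum_z tens (p i z) (q z j * q z k).
  rewrite mulr_suml; apply: eq_bigr => z _; rewrite mulr_sumr (bigD1 z) //=.
  rewrite tensM (magic_idem pm) big1 ?addr0 // => t ntz.
  by rewrite tensM (magic_orthr pm) ?tens0l // eq_sym.
have col i j k :
    (\sum_z tens (p j z) (q z i)) * (\sum_z tens (p k z) (q z i)) =
    \sum_z tens (p j z * p k z) (q z i).
  rewrite mulr_suml; apply: eq_bigr => z _; rewrite mulr_sumr (bigD1 z) //=.
  rewrite tensM (magic_idem qm) big1 ?addr0 // => t ntz.
  by rewrite tensM (magic_orthc qm) ?tens0r // eq_sym.
split=> [i j|i j|i|i|i j k njk|i j k njk].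
- rewrite star_sum; apply: eq_bigr => k _.
  by rewrite tens_star (magic_star pm) (magic_star qm).
- by rewrite row; apply: eq_bigr => z _; rewrite (magic_idem qm).
- rewrite exchange_big -tens1 -(magic_row pm i) tens_suml /=.
  by apply: eq_bigr => z _; rewrite -tens_sumr (magic_row qm).
- rewrite exchange_big -tens1 -[in RHS](magic_col qm i) tens_sumr /=.
  by apply: eq_bigr => z _; rewrite -tens_suml (magic_col pm).
- by rewrite row big1 // => z _; rewrite (magic_orthr qm) // tens0r.
- by rewrite col big1 // => z _; rewrite (magic_orthc pm) // tens0l.
Qed.

Lemma magic_gen (I : finType) (Y : Type)
    (P : forall A : starAlgType C, (Y -> A) -> Prop) (p : I -> I -> Y) :
  (forall (A : starAlgType C) (f : Y -> A), P A f ->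
     magic_unitary (fun i j => f (p i j))) ->
  magic_unitary (fun i j => gen P (p i j)).
Proof.
move=> H; split=> [i j|i j|i|i|i j k njk|i j k njk]; apply: univ_eq => A f Pf;
  have lm := ulift_morphism Pf; have fm := H A f Pf;
  have sE (F : I -> Y) : \sum_j ulift f (gen P (F j)) = \sum_j f (F j)
    by apply: eq_bigr => z _; rewrite ulift_gen.
all: rewrite ?(sm0 lm) ?(sm1 lm) ?(smM lm) ?(smS lm) ?(sm_sum lm) ?sE.
all: rewrite ?ulift_gen //.
- exact: (magic_star fm).
- exact: (magic_idem fm).
- exact: (magic_row fm).
- exact: (magic_col fm).
- exact: (magic_orthr fm).
- exact: (magic_orthc fm).
Qed.

Lemma comul_ulift (I : finType)
    (P : forall A : starAlgType C, (I * I -> A) -> Prop) (i j : I) :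
  P _ (fun ij => \sum_k tens (gen P (ij.1, k)) (gen P (k, ij.2))) ->
  ulift (fun ij => \sum_k tens (gen P (ij.1, k)) (gen P (k, ij.2)))
    (gen P (i, j)) =
  \sum_k tens (gen P (i, k)) (gen P (k, j)).
Proof. by move=> HP; rewrite ulift_gen. Qed.

Lemma gen_generates2 (I : finType)
    (P : forall A : starAlgType C, (I * I -> A) -> Prop) :
  generates (fun a => exists i j, a = gen P (i, j)).
Proof.
move=> Q Qs Qg; apply: gen_generates => // a [[i j] ->].
by apply: Qg; exists i, j.
Qed.

Definition Splus_rel (n : nat) (A : starAlgType C) (p : 'I_n * 'I_n -> A) :=
  magic_unitary (fun i j => p (i, j)).
Arguments Splus_rel : clear implicits.

Lemma Splus_magic n : magic_unitary (fun i j => gen (Splus_rel n) (i, j)).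
Proof. by apply: magic_gen. Qed.

Lemma Splus_comul n : Splus_rel n _ (fun ij : 'I_n * 'I_n =>
  \sum_k tens (gen (Splus_rel n) (ij.1, k)) (gen (Splus_rel n) (k, ij.2))).
Proof. exact: magic_tens (Splus_magic n) (Splus_magic n). Qed.

Lemma card_ord_gt0 n : (0 < n)%N -> (0 < #|'I_n|)%N.
Proof. by rewrite card_ord. Qed.

Definition Splus (n : nat) (n_gt0 : (0 < n)%N) : qpg := {|
  pts_gt0 := card_ord_gt0 n_gt0;
  fund := fun i j => gen (Splus_rel n) (i, j);
  fund_magic := Splus_magic n;
  fund_generates := gen_generates2 (P := Splus_rel n);
  comul_morphism := ulift_morphism (Splus_comul n);
  comul_fund := fun i j => comul_ulift i j (Splus_comul n)
|}.

Record sgraph := SGraph {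
  vert : finType;
  edge : rel vert;
  edge_sym : symmetric edge;
  edge_irrefl : irreflexive edge;
  vert_gt0 : (0 < #|vert|)%N
}.

Definition is_tree (T : sgraph) : Prop :=
  (forall x y : vert T, connect (@edge T) x y) /\
  (forall c : seq (vert T), (2 < size c)%N -> ~ ucycle (@edge T) c).

Definition commutes_adj (I : finType) (e : rel I) (A : starAlgType C)
    (u : I -> I -> A) : Prop :=
  forall x y, \sum_z u x z * (e z y)%:R = \sum_z (e x z)%:R * u z y.

Definition Qu_rel (G : sgraph) (A : starAlgType C) (u : vert G * vert G -> A) :=
  magic_unitary (fun x y => u (x, y)) /\ commutes_adj (@edge G) (fun x y => u (x, y)).
Arguments Qu_rel : clear implicits.

Lemma sm_bool (A B : starAlgType C) (f : A -> B) (b : bool) :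
  star_morphism f -> f b%:R = b%:R.
Proof. by move=> fm; case: b; rewrite ?(sm1 fm) ?(sm0 fm). Qed.

Lemma Qu_magic G : magic_unitary (fun x y => gen (Qu_rel G) (x, y)).
Proof. by apply: magic_gen => A f []. Qed.

Lemma Qu_adj G : commutes_adj (@edge G) (fun x y => gen (Qu_rel G) (x, y)).
Proof.
move=> x y; apply: univ_eq => A f Pf; have lm := ulift_morphism Pf.
rewrite !(sm_sum lm).
under eq_bigr do rewrite (smM lm) (sm_bool _ lm) ulift_gen //.
under [RHS]eq_bigr do rewrite (smM lm) (sm_bool _ lm) ulift_gen //.
exact: (proj2 Pf).
Qed.

Lemma tens_boolMr (A B : starAlgType C) (b : bool) (x : A) (y : B) :
  tens x y * b%:R = tens x (y * b%:R).
Proof. by case: b; rewrite ?mulr1 // !mulr0 tens0r. Qed.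
Lemma tens_boolMl (A B : starAlgType C) (b : bool) (x : A) (y : B) :
  b%:R * tens x y = tens (b%:R * x) y.
Proof. by case: b; rewrite ?mul1r // !mul0r tens0l. Qed.
Lemma tens_boolC (A B : starAlgType C) (b : bool) (x : A) (y : B) :
  tens x (b%:R * y) = tens (x * b%:R) y.
Proof. by case: b; rewrite ?mulr1 ?mul1r // mul0r mulr0 tens0l tens0r. Qed.

Lemma commutes_adj_tens (I : finType) (e : rel I) (A B : starAlgType C)
    (u : I -> I -> A) (v : I -> I -> B) :
  commutes_adj e u -> commutes_adj e v ->
  commutes_adj e (fun x y => \sum_z tens (u x z) (v z y)).
Proof.
move=> uadj vadj x y.
transitivity (\sum_k tens (u x k) (\sum_z v k z * (e z y)%:R)).
  under eq_bigr do rewrite mulr_suml.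
  rewrite exchange_big; apply: eq_bigr => k _; rewrite tens_sumr.
  by apply: eq_bigr => z _; rewrite tens_boolMr.
under eq_bigr do rewrite vadj tens_sumr.
rewrite exchange_big /=; under [RHS]eq_bigr do rewrite mulr_sumr.
rewrite [RHS]exchange_big; apply: eq_bigr => z _.
under eq_bigr do rewrite tens_boolC.
under [RHS]eq_bigr do rewrite tens_boolMl.
by rewrite -!tens_suml uadj.
Qed.

Lemma Qu_comul G : Qu_rel G _ (fun xy : vert G * vert G =>
  \sum_z tens (gen (Qu_rel G) (xy.1, z)) (gen (Qu_rel G) (z, xy.2))).
Proof.
split; first exact: magic_tens (Qu_magic G) (Qu_magic G).
exact: commutes_adj_tens (@Qu_adj G) (@Qu_adj G).
Qed.

Definition Qu (G : sgraph) : qpg := {|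
  pts_gt0 := vert_gt0 G;
  fund := fun x y => gen (Qu_rel G) (x, y);
  fund_magic := Qu_magic G;
  fund_generates := gen_generates2 (P := Qu_rel G);
  comul_morphism := ulift_morphism (Qu_comul G);
  comul_fund := fun x y => comul_ulift x y (Qu_comul G)
|}.

Definition trivial_comul (c : C^o) : tensor C^o C^o := tens c 1.

Lemma trivial_magic : magic_unitary (fun _ _ : 'I_1 => 1 : C^o).
Proof.
split=> [i j|i j|i|i|i j k|i j k]; rewrite ?star1 ?mulr1 ?big_ord1 //;
  by rewrite (ord1 j) (ord1 k) eqxx.
Qed.

Lemma trivial_generates :
  generates (fun a : C^o => exists i j : 'I_1, a = 1).
Proof.
move=> Q Qs _ a; rewrite -[a]mulr1.
exact: (ssubZ Qs a (ssub1 Qs)).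
Qed.

Lemma trivial_comul_morphism : star_morphism trivial_comul.
Proof.
apply: star_morphismP => [|x y|x y|k x|x]; rewrite /trivial_comul.
- exact: tens1.
- exact: tensDl.
- by rewrite tensM mulr1.
- exact: tensZl.
- by rewrite tens_star star1.
Qed.

Lemma trivial_comul_fund (i j : 'I_1) :
  trivial_comul 1 = \sum_(k < 1) tens (1 : C^o) (1 : C^o).
Proof. by rewrite big_ord1. Qed.

Definition trivial_qpg : qpg := {|
  pts_gt0 := card_ord_gt0 (ltn0Sn 0);
  fund := fun _ _ : 'I_1 => 1 : C^o;
  fund_magic := trivial_magic;
  fund_generates := trivial_generates;
  comul_morphism := trivial_comul_morphism;
  comul_fund := trivial_comul_fund
|}.

Section FreeProduct.
Variables A B : starAlgType C.
Definition free_rel (D : starAlgType C) (f : A + B -> D) : Prop :=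
  star_morphism (fun a => f (inl a)) /\ star_morphism (fun b => f (inr b)).
Definition free_prod : starAlgType C := univ free_rel.
Definition finl (a : A) : free_prod := gen free_rel (inl a).
Definition finr (b : B) : free_prod := gen free_rel (inr b).

Lemma finl_morphism : star_morphism finl.
Proof. by apply: (gen_star_morphism (g := inl)) => D f []. Qed.
Lemma finr_morphism : star_morphism finr.
Proof. by apply: (gen_star_morphism (g := inr)) => D f []. Qed.

Definition free_lift (D : starAlgType C) (f : A -> D) (g : B -> D) :
  free_prod -> D := ulift (fun x => match x with inl a => f a | inr b => g b end).

Section FreeLift.
Variables (D : starAlgType C) (f : A -> D) (g : B -> D).
Hypotheses (fm : star_morphism f) (gm : star_morphism g).
Lemma free_lift_morphism : star_morphism (free_lift f g).
Proof. exact: ulift_morphism. Qed.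
Lemma free_lift_inl a : free_lift f g (finl a) = f a.
Proof. exact: ulift_gen. Qed.
Lemma free_lift_inr b : free_lift f g (finr b) = g b.
Proof. exact: ulift_gen. Qed.
End FreeLift.
End FreeProduct.
Arguments finl : clear implicits.
Arguments finr : clear implicits.

Lemma ssub_preim (A D : starAlgType C) (f : A -> D) (P : D -> Prop) :
  star_morphism f -> star_subalgebra P -> star_subalgebra (fun a => P (f a)).
Proof.
move=> fm Ps; split=> [|a b|a b|k a|a].
- by rewrite (sm1 fm); apply: (ssub1 Ps).
- by rewrite (smD fm); apply: (ssubD Ps).
- by rewrite (smM fm); apply: (ssubM Ps).
- by rewrite (smZ fm); apply: (ssubZ Ps).
- by rewrite (smS fm); apply: (ssubS Ps).
Qed.

Lemma ssub_sum (D : starAlgType C) (P : D -> Prop) (I : Type) (r : seq I)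
    (F : I -> D) :
  star_subalgebra P -> (forall i, P (F i)) -> P (\sum_(i <- r) F i).
Proof.
move=> Ps PF; apply: (big_ind P) => //; last by move=> x y; apply: (ssubD Ps).
by rewrite -(scale0r (1 : D)); apply: (ssubZ Ps); apply: (ssub1 Ps).
Qed.

Section FreeQpg.
Variables G H : qpg.
Local Notation il := (finl (alg G) (alg H)).
Local Notation ir := (finr (alg G) (alg H)).

Definition diag_fund (x y : pts G + pts H) : free_prod (alg G) (alg H) :=
  match x, y with
  | inl i, inl j => il (fund i j)
  | inr i, inr j => ir (fund i j)
  | _, _ => 0
  end.

Lemma diag_magic : magic_unitary diag_fund.
Proof.
have lm := finl_morphism (alg G) (alg H).
have rm := finr_morphism (alg G) (alg H).
have gm := magic_morph (fund_magic G) lm.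
have hm := magic_morph (fund_magic H) rm.
split.
- by move=> [i|i] [j|j] /=; rewrite ?star0 ?(magic_star gm) ?(magic_star hm).
- by move=> [i|i] [j|j] /=; rewrite ?mul0r ?(magic_idem gm) ?(magic_idem hm).
- move=> [i|i]; rewrite big_sumType /=.
    by rewrite (magic_row gm) big1 ?addr0.
  by rewrite (magic_row hm) big1 ?add0r.
- move=> [i|i]; rewrite big_sumType /=.
    by rewrite (magic_col gm) big1 ?addr0.
  by rewrite (magic_col hm) big1 ?add0r.
- move=> [i|i] [j|j] [k|k] njk //=; rewrite ?mul0r ?mulr0 //.
    by rewrite (magic_orthr gm).
  by rewrite (magic_orthr hm).
- move=> [i|i] [j|j] [k|k] njk //=; rewrite ?mul0r ?mulr0 //.
    by rewrite (magic_orthc gm).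
  by rewrite (magic_orthc hm).
Qed.

Lemma diag_generates : generates (fun a => exists i j, a = diag_fund i j).
Proof.
move=> P Ps Pg; apply: gen_generates => // a [[x|x] ->].
  apply: (fund_generates (ssub_preim (finl_morphism (alg G) (alg H)) Ps)).
  by move=> _ [i [j ->]]; apply: Pg; exists (inl i), (inl j).
apply: (fund_generates (ssub_preim (finr_morphism (alg G) (alg H)) Ps)).
by move=> _ [i [j ->]]; apply: Pg; exists (inr i), (inr j).
Qed.

Let lm := finl_morphism (alg G) (alg H).
Let rm := finr_morphism (alg G) (alg H).
Let dl (a : alg G) := tmap il il (comul a).
Let dr (b : alg H) := tmap ir ir (comul b).
Let dlm : star_morphism dl.
Proof.
exact: star_morphism_comp (tmap_star_morphism lm lm) (comul_morphism G).
Qed.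
Let drm : star_morphism dr.
Proof.
exact: star_morphism_comp (tmap_star_morphism rm rm) (comul_morphism H).
Qed.

Definition free_comul := free_lift
  (fun a : alg G => tmap il il (comul a))
  (fun b : alg H => tmap ir ir (comul b)).

Lemma free_comul_morphism : star_morphism free_comul.
Proof. exact: free_lift_morphism. Qed.

Lemma free_comul_fund i j :
  free_comul (diag_fund i j) = \sum_k tens (diag_fund i k) (diag_fund k j).
Proof.
rewrite big_sumType /=; case: i j => [i|i] [j|j] /=.
- rewrite [in RHS]addrC big1 ?add0r => [|k _]; last by rewrite tens0l.
  rewrite /free_comul free_lift_inl // comul_fund (sm_sum (tmap_star_morphism lm lm)).
  by apply: eq_bigr => k _; rewrite tmap_tens.
- rewrite (sm0 free_comul_morphism) !big1 ?addr0 // => k _.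
    by rewrite tens0l.
  by rewrite tens0r.
- rewrite (sm0 free_comul_morphism) !big1 ?addr0 // => k _.
    by rewrite tens0r.
  by rewrite tens0l.
- rewrite big1 ?add0r => [|k _]; last by rewrite tens0l.
  rewrite /free_comul free_lift_inr // comul_fund (sm_sum (tmap_star_morphism rm rm)).
  by apply: eq_bigr => k _; rewrite tmap_tens.
Qed.

Lemma diag_gt0 : (0 < #|{: pts G + pts H}|)%N.
Proof. by rewrite card_sum addn_gt0 pts_gt0. Qed.

Definition free_qpg : qpg := {|
  pts_gt0 := diag_gt0;
  fund := diag_fund;
  fund_magic := diag_magic;
  fund_generates := diag_generates;
  comul_morphism := free_comul_morphism;
  comul_fund := free_comul_fund
|}.
End FreeQpg.

Section FreePower.
Variables (A : starAlgType C) (n : nat).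
Definition fpower_rel (D : starAlgType C) (f : 'I_n * A -> D) : Prop :=
  forall i, star_morphism (fun a => f (i, a)).
Definition free_power : starAlgType C := univ fpower_rel.
Definition fpin (i : 'I_n) (a : A) : free_power := gen fpower_rel (i, a).
Lemma fpin_morphism i : star_morphism (fpin i).
Proof. by apply: (gen_star_morphism (g := pair i)) => D f; apply. Qed.
End FreePower.

Section Quotient.
Variables (A : starAlgType C) (R : A -> Prop).
Definition quot_rel (D : starAlgType C) (f : A -> D) : Prop :=
  star_morphism f /\ forall a, R a -> f a = 0.
(* The quotient of A by the smallest *-ideal that contains R *)
Definition quot : starAlgType C := univ quot_rel.
Definition qproj (a : A) : quot := gen quot_rel a.
Lemma qproj_morphism : star_morphism qproj.
Proof. by apply: (gen_star_morphism (g := id)) => D f []. Qed.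
Lemma qproj0 a : R a -> qproj a = 0.
Proof.
move=> Ra; apply: univ_eq => D f Pf.
by rewrite (sm0 (ulift_morphism Pf)) ulift_gen // (proj2 Pf).
Qed.
End Quotient.

Lemma orth_sum_morphism (A D : starAlgType C) (I : finType)
    (F : I -> A -> D) (E : I -> D) :
  (forall k, star_morphism (F k)) ->
  (forall k, star (E k) = E k) -> (forall k, E k * E k = E k) ->
  (forall k l, k != l -> E k * E l = 0) -> \sum_k E k = 1 ->
  (forall k a, F k a * E k = E k * F k a) ->
  star_morphism (fun a => \sum_k F k a * E k).
Proof.
move=> Fm Es Ei Eo E1 FE; apply: star_morphismP => [|x y|x y|c x|x].
- by rewrite -E1; apply: eq_bigr => k _; rewrite (sm1 (Fm k)) mul1r.
- rewrite -big_split; apply: eq_bigr => k _.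
  by rewrite (smD (Fm k)) mulrDl.
- rewrite mulr_suml; apply: eq_bigr => k _; rewrite mulr_sumr (bigD1 k) //=.
  rewrite big1 ?addr0 => [|l nlk].
    by rewrite (smM (Fm k)) -[RHS]mulrA (mulrA (E k)) -FE -!mulrA Ei.
  by rewrite (FE l) mulrA -(mulrA (F k x)) Eo ?mulr0 ?mul0r // eq_sym.
- rewrite scaler_sumr; apply: eq_bigr => k _.
  by rewrite (smZ (Fm k)) sscalerAl.
- rewrite star_sum; apply: eq_bigr => k _.
  by rewrite starM Es -(smS (Fm k)) FE.
Qed.

Section Wreath.
Variables (G : qpg) (n : nat) (n_gt0 : (0 < n)%N).
Local Notation S := (Splus n_gt0).

Definition wreath_free : starAlgType C :=
  free_prod (free_power (alg G) n) (alg S).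
Definition wnu0 (i : 'I_n) (a : alg G) : wreath_free := finl _ _ (fpin i a).
Definition wp0 (i j : 'I_n) : wreath_free :=
  finr _ _ (fund (q := S) i j).
(* The adjoint of the commutator of nu_i(a) and p_ij is minus the commutator of
   nu_i(star a) and p_ij: the ideal generated by these elements is a *-ideal. *)
Definition wreath_comm (x : wreath_free) : Prop :=
  exists i j a, x = wnu0 i a * wp0 i j - wp0 i j * wnu0 i a.

Definition wreath_alg : starAlgType C := quot wreath_comm.
Definition wnu (i : 'I_n) (a : alg G) : wreath_alg :=
  qproj wreath_comm (wnu0 i a).
Definition wp (i j : 'I_n) : wreath_alg := qproj wreath_comm (wp0 i j).

Definition wreath_fund (x y : 'I_n * pts G) : wreath_alg :=
  wnu x.1 (fund x.2 y.2) * wp x.1 y.1.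

Let wqm : star_morphism (qproj wreath_comm) := qproj_morphism wreath_comm.
Let wrm : star_morphism (fun s : alg S => qproj wreath_comm (finr _ _ s)).
Proof. exact: star_morphism_comp wqm (finr_morphism _ _). Qed.

Lemma wnu_morphism i : star_morphism (wnu i).
Proof.
apply: (star_morphism_comp wqm).
exact: star_morphism_comp (finl_morphism _ _) (fpin_morphism _ i).
Qed.

Lemma wp_magic : magic_unitary wp.
Proof. exact: (magic_morph (fund_magic S) wrm). Qed.

Lemma wnuC i j a : wnu i a * wp i j = wp i j * wnu i a.
Proof.
apply/eqP; rewrite -subr_eq0; apply/eqP.
have qB x y : qproj wreath_comm x - qproj wreath_comm y =
              qproj wreath_comm (x - y).
  by rewrite (smD wqm) -[- y]scaleN1r (smZ wqm) scaleN1r.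
by rewrite -!(smM wqm) qB qproj0 //; exists i, j, a.
Qed.

Lemma wreath_magic : magic_unitary wreath_fund.
Proof.
have num i := magic_morph (fund_magic G) (wnu_morphism i).
have pm := wp_magic.
have row i k j l j' l' :
  wreath_fund (i, k) (j, l) * wreath_fund (i, k) (j', l') =
  wnu i (fund k l) * wnu i (fund k l') * (wp i j * wp i j').
  by rewrite /wreath_fund /= -!mulrA (mulrA (wp i j)) -wnuC !mulrA.
split=> [[i k] [j l]|[i k] [j l]|[i k]|[i k]||].
- by rewrite /wreath_fund /= starM (magic_star pm) (magic_star (num i)) wnuC.
- by rewrite row (magic_idem pm) (magic_idem (num i)).
- rewrite -(pair_big xpredT xpredT (fun j l => wreath_fund (i, k) (j, l))) /=.
  rewrite -(magic_row pm i); apply: eq_bigr => j _.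
  by rewrite /wreath_fund /= -mulr_suml (magic_row (num i)) mul1r.
- rewrite -(pair_big xpredT xpredT (fun j l => wreath_fund (j, l) (i, k))) /=.
  rewrite -(magic_col pm i); apply: eq_bigr => j _.
  by rewrite /wreath_fund /= -mulr_suml (magic_col (num j)) mul1r.
- move=> [i k] [j l] [j' l'] njl; rewrite row.
  case: (eqVneq j j') njl => [<-|njj' _]; last by rewrite (magic_orthr pm) ?mulr0.
  rewrite xpair_eqE eqxx /= => nll'.
  by rewrite (magic_orthr (num i)) ?mul0r.
- move=> [i k] [j l] [j' l'] njl; rewrite /wreath_fund /= wnuC.
  rewrite [X in _ * X]wnuC -wnuC -mulrA (mulrA (wp j i)).
  case: (eqVneq j j') njl => [<-|njj' _]; last first.
    by rewrite (magic_orthc pm) // mul0r mulr0.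
  rewrite xpair_eqE eqxx /= => nll'.
  by rewrite (magic_idem pm) -wnuC mulrA (magic_orthc (num j)) ?mul0r.
Qed.

Lemma wnu_fund i k l : wnu i (fund k l) = \sum_j wreath_fund (i, k) (j, l).
Proof.
by rewrite /wreath_fund /= -mulr_sumr (magic_row wp_magic) mulr1.
Qed.

Lemma wp_fund (k : pts G) i j : wp i j = \sum_l wreath_fund (i, k) (j, l).
Proof.
rewrite /wreath_fund /= -mulr_suml.
by rewrite (magic_row (magic_morph (fund_magic G) (wnu_morphism i))) mul1r.
Qed.

Lemma wreath_generates : generates (fun a => exists i j, a = wreath_fund i j).
Proof.
move=> P Ps Pg; have Pf x y : P (wreath_fund x y) by apply: Pg; exists x, y.
apply: gen_generates => // _ [x ->].
apply: (gen_generates (ssub_preim wqm Ps)) => _ [[[i a]|s] ->].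
- have fim := star_morphism_comp wqm (finl_morphism (free_power (alg G) n) (alg S)).
  apply: (gen_generates (ssub_preim fim Ps)) => _ [[j b] ->].
  apply: (fund_generates (ssub_preim (wnu_morphism j) Ps)) => _ [k [l ->]].
  by rewrite wnu_fund; apply: ssub_sum.
- have /card_gt0P[k _] := pts_gt0 G.
  apply: (fund_generates (ssub_preim wrm Ps)) => _ [j [l ->]].
  by rewrite -[X in P X]/(wp j l) (wp_fund k); apply: ssub_sum.
Qed.

Definition wreath_dnu (i : 'I_n) (a : alg G) : tensor wreath_alg wreath_alg :=
  \sum_k tmap (wnu i) (wnu k) (comul a) * tens (wp i k) 1.

Lemma tmap_wnuC i k (t : tensor (alg G) (alg G)) j :
  tmap (wnu i) (wnu k) t * tens (wp i j) 1 =
  tens (wp i j) 1 * tmap (wnu i) (wnu k) t.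
Proof.
have tm := tmap_star_morphism (wnu_morphism i) (wnu_morphism k).
elim/tensor_ind: t => [|a b|x y Hx Hy].
- by rewrite (sm0 tm) mul0r mulr0.
- rewrite (tmap_tens (wnu_morphism i) (wnu_morphism k)) !tensM mulr1 mul1r.
  by rewrite wnuC.
- by rewrite (smD tm) mulrDl mulrDr Hx Hy.
Qed.

Lemma tmap_wnuCr i k (t : tensor (alg G) (alg G)) j :
  tmap (wnu i) (wnu k) t * tens 1 (wp k j) =
  tens 1 (wp k j) * tmap (wnu i) (wnu k) t.
Proof.
have tm := tmap_star_morphism (wnu_morphism i) (wnu_morphism k).
elim/tensor_ind: t => [|a b|x y Hx Hy].
- by rewrite (sm0 tm) mul0r mulr0.
- rewrite (tmap_tens (wnu_morphism i) (wnu_morphism k)) !tensM mulr1 mul1r.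
  by rewrite wnuC.
- by rewrite (smD tm) mulrDl mulrDr Hx Hy.
Qed.

Lemma wreath_dnu_morphism i : star_morphism (wreath_dnu i).
Proof.
have pm := wp_magic.
apply: orth_sum_morphism => [k|k|k|k l nkl||k a].
- apply: star_morphism_comp (comul_morphism G).
  exact: tmap_star_morphism (wnu_morphism i) (wnu_morphism k).
- by rewrite tens_star (magic_star pm) star1.
- by rewrite tensM (magic_idem pm) mulr1.
- by rewrite tensM (magic_orthr pm) // tens0l.
- by rewrite -tens_suml (magic_row pm) tens1.
- exact: tmap_wnuC.
Qed.

Definition wreath_dp (s : alg S) : tensor wreath_alg wreath_alg :=
  tmap (fun s => qproj wreath_comm (finr (free_power (alg G) n) (alg S) s))
       (fun s => qproj wreath_comm (finr (free_power (alg G) n) (alg S) s))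
       (comul s).

Lemma wreath_dp_morphism : star_morphism wreath_dp.
Proof.
exact: star_morphism_comp (tmap_star_morphism wrm wrm) (comul_morphism S).
Qed.

Lemma wreath_dp_fund i j :
  wreath_dp (fund (q := S) i j) = \sum_k tens (wp i k) (wp k j).
Proof.
rewrite /wreath_dp comul_fund (sm_sum (tmap_star_morphism wrm wrm)).
by apply: eq_bigr => k _; rewrite (tmap_tens wrm wrm).
Qed.

Lemma wreath_dnu_pow :
  fpower_rel (fun ia : 'I_n * alg G => wreath_dnu ia.1 ia.2).
Proof. exact: wreath_dnu_morphism. Qed.

Definition wreath_comul0 : wreath_free -> tensor wreath_alg wreath_alg :=
  free_lift (ulift (fun ia : 'I_n * alg G => wreath_dnu ia.1 ia.2)) wreath_dp.

Lemma wreath_comul0_morphism : star_morphism wreath_comul0.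
Proof.
apply: free_lift_morphism wreath_dp_morphism.
exact: (ulift_morphism wreath_dnu_pow).
Qed.

Lemma wreath_comul0_nu i a : wreath_comul0 (wnu0 i a) = wreath_dnu i a.
Proof.
rewrite /wreath_comul0 (free_lift_inl (ulift_morphism wreath_dnu_pow)) //.
  by rewrite (ulift_gen _ wreath_dnu_pow).
exact: wreath_dp_morphism.
Qed.

Lemma wreath_comul0_p i j :
  wreath_comul0 (wp0 i j) = \sum_k tens (wp i k) (wp k j).
Proof.
rewrite /wreath_comul0 (free_lift_inr (ulift_morphism wreath_dnu_pow)).
  exact: wreath_dp_fund.
exact: wreath_dp_morphism.
Qed.

Lemma wreath_dnu_p i j a :
  wreath_dnu i a * (\sum_k tens (wp i k) (wp k j)) =
  \sum_k tmap (wnu i) (wnu k) (comul a) * tens (wp i k) (wp k j).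
Proof.
rewrite mulr_suml; apply: eq_bigr => k _; rewrite mulr_sumr (bigD1 k) //=.
rewrite big1 ?addr0 => [|l nlk]; rewrite -mulrA tensM mul1r.
  by rewrite (magic_idem wp_magic).
by rewrite (magic_orthr wp_magic) ?tens0l ?mulr0 // eq_sym.
Qed.

Lemma wreath_p_dnu i j a :
  (\sum_k tens (wp i k) (wp k j)) * wreath_dnu i a =
  \sum_k tmap (wnu i) (wnu k) (comul a) * tens (wp i k) (wp k j).
Proof.
rewrite mulr_suml; apply: eq_bigr => k _; rewrite mulr_sumr (bigD1 k) //=.
rewrite big1 ?addr0 => [|l nlk]; rewrite tmap_wnuC mulrA tensM mulr1.
  rewrite (magic_idem wp_magic) -[X in tens X _]mulr1 -[X in tens _ X]mul1r.
  rewrite -tensM -mulrA -tmap_wnuCr mulrA -tmap_wnuC -mulrA tensM.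
  by rewrite mulr1 mul1r.
by rewrite (magic_orthr wp_magic) ?tens0l ?mul0r // eq_sym.
Qed.

Lemma wreath_comul_rel : quot_rel wreath_comm wreath_comul0.
Proof.
split=> [|_ [i [j [a ->]]]]; first exact: wreath_comul0_morphism.
have cm := wreath_comul0_morphism.
rewrite (smD cm) -scaleN1r (smZ cm) scaleN1r !(smM cm).
rewrite wreath_comul0_nu wreath_comul0_p wreath_dnu_p wreath_p_dnu.
exact: subrr.
Qed.

Definition wreath_comul : wreath_alg -> tensor wreath_alg wreath_alg :=
  ulift wreath_comul0.

Lemma wreath_comul_morphism : star_morphism wreath_comul.
Proof. exact: (ulift_morphism wreath_comul_rel). Qed.

Lemma wreath_comul_fund x y :
  wreath_comul (wreath_fund x y) =
  \sum_z tens (wreath_fund x z) (wreath_fund z y).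
Proof.
case: x y => i k [j l].
rewrite (smM wreath_comul_morphism) /wreath_comul !(ulift_gen _ wreath_comul_rel).
rewrite wreath_comul0_nu wreath_comul0_p wreath_dnu_p.
rewrite -(pair_big xpredT xpredT (fun s m =>
  tens (wreath_fund (i, k) (s, m)) (wreath_fund (s, m) (j, l)))) /=.
apply: eq_bigr => s _; rewrite comul_fund.
rewrite (sm_sum (tmap_star_morphism (wnu_morphism i) (wnu_morphism s))).
rewrite mulr_suml; apply: eq_bigr => m _.
by rewrite (tmap_tens (wnu_morphism i) (wnu_morphism s)) tensM.
Qed.

Lemma wreath_gt0 : (0 < #|{: 'I_n * pts G}|)%N.
Proof. by rewrite card_prod card_ord muln_gt0 n_gt0 pts_gt0. Qed.

Definition wreath_qpg : qpg := {|
  pts_gt0 := wreath_gt0;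
  fund := wreath_fund;
  fund_magic := wreath_magic;
  fund_generates := wreath_generates;
  comul_morphism := wreath_comul_morphism;
  comul_fund := wreath_comul_fund
|}.
End Wreath.

Definition iso_invariant (F : qpg -> Prop) : Prop :=
  forall G H, qpg_iso G H -> F G -> F H.

Definition free_wreath_closed (F : qpg -> Prop) : Prop :=
  [/\ F trivial_qpg,
      forall G H, F G -> F H -> F (free_qpg G H) &
      forall G (n : nat) (n_gt0 : (0 < n)%N), F G -> F (wreath_qpg G n_gt0)].

Definition tree_family (G : qpg) : Prop :=
  exists2 T : sgraph, is_tree T & qpg_iso (Qu T) G.
End QuantumPermutationGroups.

Arguments finl {C} A B a.
Arguments finr {C} A B b.
Arguments Splus_rel C n {A} p.
Arguments Qu_rel C G {A} u.

(* Main.v *)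
(* A rooted forest is a finite set with a parent function fixing the roots; its
   quantum automorphism group Q is universal among the magic unitaries u that
   commute with the graph of that function. All relations come from one principle:
   u commutes with a relation e iff u x z * u y w = 0 whenever e x y != e z w, so
   whatever can be defined from preserved data, including by counting, is preserved.

   Decomposition. If u r s != 0 for roots r and s, the trees at r and s are
   isomorphic. Hence Q of a forest is obtained from the trivial group by: removing a
   unique root, which does not change Q; a free product, over the trees isomorphic to
   a given one and the others; and a wreath product with S_n^+, when all n trees are
   isomorphic.

   Trees to forests. Remove the leaves of a tree repeatedly. The parent of a vertex
   is its unique neighbour that survives longer, if any; the roots are the one or two
   vertices of the centre. The stage of removal is obtained by counting neighbours,
   so it is preserved, and Qu of the tree is Q of this forest.

   Forests to trees. Adding paths longer than the rest of the forest does not change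
   Q, but creates new roots. With enough of them, a new root put on top of everything
   is the only vertex of maximal degree of the resulting tree, so it is fixed, and the
   tree has the same quantum automorphism group as the forest. Free products and
   wreath products of trees are thus trees again. *)
Require Import Defs.
From mathcomp Require Import all_boot all_order all_algebra.
From mathcomp Require Import reals complex.
From mathcomp Require Import boolp.
Set Implicit Arguments.
Unset Strict Implicit.
Unset Printing Implicit Defensive.
Import Order.TTheory GRing.Theory Num.Theory.
Local Open Scope ring_scope.

(** * Isomorphisms of quantum permutation groups *)

Section Isomorphisms.
Variable C : numClosedFieldType.
Implicit Types (A B D : starAlgType C) (G H K : qpg C).

Lemma star_morphism_id A : star_morphism (@id A).
Proof. exact: star_morphismP. Qed.

Lemma smB A B (f : A -> B) : star_morphism f -> {morph f : x y / x - y}.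
Proof. by move=> fm x y; rewrite -!scaleN1r (smD fm) (smZ fm). Qed.

Lemma star_morphism_ext A B (S : A -> Prop) (f g : A -> B) :
  generates S -> star_morphism f -> star_morphism g ->
  (forall a, S a -> f a = g a) -> f =1 g.
Proof.
move=> gS fm gm fg; apply: gS fg; split=> [|a b ha hb|a b ha hb|k a ha|a ha].
- by rewrite (sm1 fm) (sm1 gm).
- by rewrite (smD fm) (smD gm) ha hb.
- by rewrite (smM fm) (smM gm) ha hb.
- by rewrite (smZ fm) (smZ gm) ha.
- by rewrite (smS fm) (smS gm) ha.
Qed.

Lemma can_star_morphism A B (f : A -> B) (g : B -> A) :
  star_morphism f -> cancel f g -> cancel g f -> star_morphism g.
Proof.
move=> fm fK gK; apply: star_morphismP => [|x y|x y|k x|x];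
  apply: (can_inj fK);
  by rewrite ?(sm1 fm) ?(smD fm) ?(smM fm) ?(smZ fm) ?(smS fm) !gK.
Qed.

Lemma tmap_comp A B D A' B' D' (f : A -> B) (g : B -> D) (f' : A' -> B')
    (g' : B' -> D') :
  star_morphism f -> star_morphism g -> star_morphism f' -> star_morphism g' ->
  forall t, tmap g g' (tmap f f' t) = tmap (g \o f) (g' \o f') t.
Proof.
move=> fm gm fm' gm'.
have gfm := star_morphism_comp gm fm; have gfm' := star_morphism_comp gm' fm'.
elim/tensor_ind => [|a b|x y Hx Hy].
- by rewrite !(sm0 (tmap_star_morphism _ _)).
- by rewrite !tmap_tens.
- by rewrite !(smD (tmap_star_morphism _ _)) // Hx Hy.
Qed.

Lemma tmap_id A B : tmap (@id A) (@id B) =1 id.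
Proof.
have m1 := star_morphism_id A; have m2 := star_morphism_id B.
elim/tensor_ind => [|a b|x y Hx Hy].
- by rewrite (sm0 (tmap_star_morphism _ _)).
- by rewrite tmap_tens.
- by rewrite (smD (tmap_star_morphism _ _)) // Hx Hy.
Qed.

Lemma qpg_iso_refl G : qpg_iso G G.
Proof.
exists id; split; [exact: star_morphism_id|by exists id|].
by move=> a; rewrite tmap_id.
Qed.

Lemma qpg_iso_sym G H : qpg_iso G H -> qpg_iso H G.
Proof.
case=> f [fm [g fK gK] fc]; have gm := can_star_morphism fm fK gK.
exists g; split=> //; first by exists f.
move=> a; rewrite -{2}[a]gK fc tmap_comp //.
have gf : g \o f = id by apply/funext => x /=; rewrite fK.
by rewrite gf tmap_id.
Qed.

Lemma qpg_iso_trans H G K : qpg_iso G H -> qpg_iso H K -> qpg_iso G K.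
Proof.
case=> f [fm fb fc] [g [gm gb gc]].
exists (g \o f); split; first exact: star_morphism_comp.
  exact: bij_comp.
by move=> a; rewrite /= gc fc tmap_comp.
Qed.

(** Two star morphisms agree on a star subalgebra, so inverses and the compatibility with [comul]
    need only be checked on generators. *)
Lemma qpg_iso_gen G H (S : alg G -> Prop) (T : alg H -> Prop)
    (f : alg G -> alg H) (g : alg H -> alg G) :
  generates S -> generates T -> star_morphism f -> star_morphism g ->
  (forall a, S a -> g (f a) = a) -> (forall b, T b -> f (g b) = b) ->
  (forall a, S a -> comul (f a) = tmap f f (comul a)) ->
  qpg_iso G H.
Proof.
move=> gS gT fm gm gf fg fc; exists f; split=> //.
  exists g.
    apply: (star_morphism_ext gS _ (star_morphism_id _)) => //.
    exact: star_morphism_comp.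
  apply: (star_morphism_ext gT _ (star_morphism_id _)) => //.
  exact: star_morphism_comp.
apply: (star_morphism_ext gS _ _ fc).
  exact: star_morphism_comp (comul_morphism _) fm.
exact: star_morphism_comp (tmap_star_morphism fm fm) (comul_morphism _).
Qed.

(** The criterion behind most isomorphisms below. The sizes of [G] and [H] may differ: [f] is not
    asked to send [fund] to [fund], only to respect the formula for [comul]. *)
Lemma qpg_iso_fund G H (f : alg G -> alg H) (g : alg H -> alg G) :
  star_morphism f -> star_morphism g ->
  (forall i j, g (f (fund i j)) = fund i j) ->
  (forall i j, f (g (fund i j)) = fund i j) ->
  (forall i j : pts G, comul (f (fund i j)) =
     \sum_k tens (f (fund i k)) (f (fund k j))) ->
  qpg_iso G H.
Proof.
move=> fm gm gf fg fc.
apply: (qpg_iso_gen (fund_generates (q := G)) (fund_generates (q := H)) fm gm).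
- by move=> _ [i [j ->]].
- by move=> _ [i [j ->]].
move=> _ [i [j ->]]; rewrite fc comul_fund (sm_sum (tmap_star_morphism fm fm)).
by apply: eq_bigr => k _; rewrite tmap_tens.
Qed.

Lemma free_prod_generates A B :
  generates (fun x : free_prod A B =>
    (exists a, x = finl A B a) \/ (exists b, x = finr A B b)).
Proof.
move=> P Ps Pg; apply: gen_generates => // _ [[a|b] ->]; apply: Pg.
  by left; exists a.
by right; exists b.
Qed.

Lemma free_qpg_iso G G' H H' :
  qpg_iso G G' -> qpg_iso H H' -> qpg_iso (free_qpg G H) (free_qpg G' H').
Proof.
case=> f [fm [f' fK fK'] fc] [g [gm [g' gK gK'] gc]].
have fm' := can_star_morphism fm fK fK'; have gm' := can_star_morphism gm gK gK'.
have lm A B := finl_morphism A B; have rm A B := finr_morphism A B.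
have lG := lm (alg G) (alg H); have lG' := lm (alg G') (alg H').
have rG := rm (alg G) (alg H); have rG' := rm (alg G') (alg H').
pose F := free_lift (fun a => finl (alg G') (alg H') (f a))
                    (fun b => finr (alg G') (alg H') (g b)).
pose F' := free_lift (fun a => finl (alg G) (alg H) (f' a))
                     (fun b => finr (alg G) (alg H) (g' b)).
have m1 := star_morphism_comp lG' fm.
have m2 := star_morphism_comp rG' gm.
have m1' := star_morphism_comp lG fm'.
have m2' := star_morphism_comp rG gm'.
have Fm : star_morphism F by apply: free_lift_morphism.
have Fm' : star_morphism F' by apply: free_lift_morphism.
have Fl a : F (finl _ _ a) = finl _ _ (f a) by apply: free_lift_inl.
have Fr b : F (finr _ _ b) = finr _ _ (g b) by apply: free_lift_inr.
have Fl' a : F' (finl _ _ a) = finl _ _ (f' a) by apply: free_lift_inl.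
have Fr' b : F' (finr _ _ b) = finr _ _ (g' b) by apply: free_lift_inr.
apply: (@qpg_iso_gen (free_qpg G H) (free_qpg G' H') _ _ F F'
  (@free_prod_generates _ _) (@free_prod_generates _ _)) => //.
- by move=> _ [[a ->]|[b ->]]; rewrite ?Fl ?Fr ?Fl' ?Fr' ?fK ?gK.
- by move=> _ [[a ->]|[b ->]]; rewrite ?Fl' ?Fr' ?Fl ?Fr ?fK' ?gK'.
have cl G1 H1 a : comul (q := free_qpg G1 H1) (finl _ _ a) =
    tmap (finl _ _) (finl _ _) (comul a).
  apply: (free_lift_inl (f := fun a => tmap _ _ (comul a))).
    exact: star_morphism_comp (tmap_star_morphism (lm _ _) (lm _ _)) (comul_morphism _).
  exact: star_morphism_comp (tmap_star_morphism (rm _ _) (rm _ _)) (comul_morphism _).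
have cr G1 H1 a : comul (q := free_qpg G1 H1) (finr _ _ a) =
    tmap (finr _ _) (finr _ _) (comul a).
  apply: (free_lift_inr (g := fun a => tmap _ _ (comul a))).
    exact: star_morphism_comp (tmap_star_morphism (lm _ _) (lm _ _)) (comul_morphism _).
  exact: star_morphism_comp (tmap_star_morphism (rm _ _) (rm _ _)) (comul_morphism _).
move=> _ [[a ->]|[b ->]].
  rewrite Fl !cl fc !tmap_comp //.
  by congr (tmap _ _ _); apply/funext => x /=; rewrite Fl.

rewrite Fr !cr gc !tmap_comp //.
by congr (tmap _ _ _); apply/funext => x /=; rewrite Fr.
Qed.

End Isomorphisms.

(** * Universal property and functoriality of the wreath product *)

Section WreathIso.
Variable C : numClosedFieldType.
Variables (n : nat) (n_gt0 : (0 < n)%N).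

(** A lift is prescribed on these elements, so identities are checked on them rather than on the
    products [wreath_fund]. *)
Definition wreath_gens (G : qpg C) (x : wreath_alg G n_gt0) : Prop :=
  (exists i a, x = wnu n_gt0 i a) \/ (exists i j, x = wp G n_gt0 i j).

Lemma wreath_gens_generates G : generates (@wreath_gens G).
Proof.
move=> P Ps Pg; apply: (wreath_generates (G := G)) => // _ [x [y ->]].
apply: (ssubM Ps); apply: Pg; first by left; exists x.1, (fund x.2 y.2).
by right; exists x.1, y.1.
Qed.

Section Lift.
Variables (G : qpg C) (D : starAlgType C).
Variables (f : 'I_n -> alg G -> D) (p : 'I_n -> 'I_n -> D).
Hypothesis fm : forall i, star_morphism (f i).
Hypothesis pm : magic_unitary p.
Hypothesis fpC : forall i j a, f i a * p i j = p i j * f i a.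

Let pS : Splus_rel C n (fun ij => p ij.1 ij.2).
Proof. exact: pm. Qed.
Let fP : fpower_rel (fun ia : 'I_n * alg G => f ia.1 ia.2).
Proof. exact: fm. Qed.

(** Given by the universal properties of the free power, of [Splus] and of their free product; [fpC]
    makes it vanish on the commutators, whence [wlift]. *)
Definition wlift0 : wreath_free G n_gt0 -> D :=
  free_lift (ulift (P := @fpower_rel C (alg G) n) (fun ia => f ia.1 ia.2))
    (ulift (P := @Splus_rel C n) (fun ij => p ij.1 ij.2)).
Definition wlift : wreath_alg G n_gt0 -> D := ulift wlift0.

Let m1 := ulift_morphism fP.
Let m2 := ulift_morphism pS.

Let wlift_rel : quot_rel (@wreath_comm C G n n_gt0) wlift0.
Proof.
have m : star_morphism wlift0 by apply: free_lift_morphism.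
split=> // _ [i [j [a ->]]].
have E1 : wlift0 (wnu0 n_gt0 i a) = f i a.
  by rewrite /wlift0 free_lift_inl // (ulift_gen _ fP).
have E2 : wlift0 (wp0 G n_gt0 i j) = p i j.
  by rewrite /wlift0 free_lift_inr // (ulift_gen _ pS).
by rewrite (smB m) !(smM m) E1 E2 fpC subrr.
Qed.

Lemma wlift_morphism : star_morphism wlift.
Proof. exact: (ulift_morphism wlift_rel). Qed.

Lemma wlift_nu i a : wlift (wnu n_gt0 i a) = f i a.
Proof.
rewrite /wlift (ulift_gen _ wlift_rel).
by rewrite /wlift0 free_lift_inl // (ulift_gen _ fP).
Qed.

Lemma wlift_p i j : wlift (wp G n_gt0 i j) = p i j.
Proof.
rewrite /wlift (ulift_gen _ wlift_rel).
by rewrite /wlift0 free_lift_inr // (ulift_gen _ pS).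
Qed.
End Lift.

Lemma wreath_comul_nu (G : qpg C) i a :
  comul (q := wreath_qpg G n_gt0) (wnu n_gt0 i a) = wreath_dnu n_gt0 i a.
Proof.
rewrite /= /wreath_comul (ulift_gen _ (wreath_comul_rel G n_gt0)).
exact: wreath_comul0_nu.
Qed.

Lemma wreath_comul_p (G : qpg C) i j :
  comul (q := wreath_qpg G n_gt0) (wp G n_gt0 i j) =
  \sum_k tens (wp G n_gt0 i k) (wp G n_gt0 k j).
Proof.
rewrite /= /wreath_comul (ulift_gen _ (wreath_comul_rel G n_gt0)).
exact: wreath_comul0_p.
Qed.

Lemma wreath_qpg_iso (G H : qpg C) :
  qpg_iso G H -> qpg_iso (wreath_qpg G n_gt0) (wreath_qpg H n_gt0).
Proof.
case=> f [fm [g fK gK] fc]; have gm := can_star_morphism fm fK gK.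
pose F := wlift (fun i a => wnu n_gt0 i (f a)) (wp H n_gt0).
pose F' := wlift (fun i a => wnu n_gt0 i (g a)) (wp G n_gt0).
have m1 i := star_morphism_comp (wnu_morphism H n_gt0 i) fm.
have m2 i := star_morphism_comp (wnu_morphism G n_gt0 i) gm.
have pm1 := wp_magic G n_gt0; have pm2 := wp_magic H n_gt0.
have c1 i j a : wnu n_gt0 i (f a) * wp H n_gt0 i j =
    wp H n_gt0 i j * wnu n_gt0 i (f a) by apply: wnuC.
have c2 i j a : wnu n_gt0 i (g a) * wp G n_gt0 i j =
    wp G n_gt0 i j * wnu n_gt0 i (g a) by apply: wnuC.
have Fm : star_morphism F by apply: wlift_morphism.
have Fm' : star_morphism F' by apply: wlift_morphism.
have Fn i a : F (wnu n_gt0 i a) = wnu n_gt0 i (f a) by apply: wlift_nu.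
have Fn' i a : F' (wnu n_gt0 i a) = wnu n_gt0 i (g a) by apply: wlift_nu.
have Fp i j : F (wp G n_gt0 i j) = wp H n_gt0 i j by apply: wlift_p.
have Fp' i j : F' (wp H n_gt0 i j) = wp G n_gt0 i j by apply: wlift_p.
apply: (@qpg_iso_gen _ (wreath_qpg G n_gt0) (wreath_qpg H n_gt0) _ _ F F'
  (@wreath_gens_generates G) (@wreath_gens_generates H)) => //.
- by move=> _ [[i [a ->]]|[i [j ->]]]; rewrite ?Fn ?Fn' ?Fp ?Fp' ?fK.
- by move=> _ [[i [a ->]]|[i [j ->]]]; rewrite ?Fn' ?Fn ?Fp' ?Fp ?gK.
have tFm := tmap_star_morphism Fm Fm.
move=> _ [[i [a ->]]|[i [j ->]]].
  rewrite Fn !wreath_comul_nu (sm_sum tFm); apply: eq_bigr => k _.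
  have nG l := wnu_morphism G n_gt0 l; have nH l := wnu_morphism H n_gt0 l.
  rewrite (smM tFm) tmap_tens // Fp (sm1 Fm) fc !tmap_comp //.
  by congr (tmap _ _ _ * _); apply/funext => x /=; rewrite Fn.
rewrite Fp !wreath_comul_p (sm_sum tFm).
by apply: eq_bigr => k _; rewrite tmap_tens // !Fp.
Qed.
End WreathIso.

(** * Functions preserved by a magic unitary *)

Section Preservation.
Variables (C : numClosedFieldType) (I : finType) (A : starAlgType C).
Variable u : I -> I -> A.

(* For a magic unitary u these say that every value of c, resp. e, is
   constant on the quantum orbits, resp. orbitals, of u. *)
Definition preserves1 (K : eqType) (c : I -> K) : Prop :=
  forall x z, c x != c z -> u x z = 0.
Definition preserves2 (K : eqType) (e : I -> I -> K) : Prop :=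
  forall x y z w, e x y != e z w -> u x z * u y w = 0.

Lemma preserves1_comp (K L : eqType) (c : I -> K) (g : K -> L) :
  preserves1 c -> preserves1 (g \o c).
Proof.
by move=> cP x z n; apply: cP; apply: contraNneq n => /= ->.
Qed.

Lemma preserves1_comp2 (K L M : eqType) (c : I -> K) (d : I -> L)
    (g : K -> L -> M) :
  preserves1 c -> preserves1 d -> preserves1 (fun x => g (c x) (d x)).
Proof.
move=> cP dP x z n; case: (eqVneq (c x) (c z)) => [cE|/cP//].
by apply: dP; apply: contraNneq n => dE; rewrite cE dE.
Qed.

Lemma preserves2_comp2 (K L M : eqType) (e : I -> I -> K) (d : I -> I -> L)
    (g : K -> L -> M) :
  preserves2 e -> preserves2 d -> preserves2 (fun x y => g (e x y) (d x y)).
Proof.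
move=> eP dP x y z w n; case: (eqVneq (e x y) (e z w)) => [eE|/eP//].
by apply: dP; apply: contraNneq n => dE; rewrite eE dE.
Qed.

Lemma preserves12l (K : eqType) (c : I -> K) :
  preserves1 c -> preserves2 (fun x _ => c x).
Proof. by move=> cP x y z w /cP ->; rewrite mul0r. Qed.

Lemma preserves12r (K : eqType) (c : I -> K) :
  preserves1 c -> preserves2 (fun _ y => c y).
Proof. by move=> cP x y z w /cP ->; rewrite mulr0. Qed.

Hypothesis um : magic_unitary u.

Lemma preserves2_eq : preserves2 (fun x y => x == y).
Proof.
move=> x y z w; case: (eqVneq x y) => [<-|nxy]; case: (eqVneq z w) => [<-|nzw] // _.
  by rewrite (magic_orthr um).
by rewrite (magic_orthc um).
Qed.

Lemma preserves2_sym (K : eqType) (e : I -> I -> K) :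
  preserves2 e -> preserves2 (fun x y => e y x).
Proof.
move=> eP x y z w n; rewrite -[LHS]starK starM !(magic_star um) eP //.
exact: star0.
Qed.

(** Multiplying the entry (x, w) of the commutation by [u x z] on the left and [u y w] on the right
    leaves one term on each side. Conversely, insert the column sum of [u t y] over t, replace
    [e z y] by [e x t] term by term, and sum over z. *)
Lemma commutes_adjP (e : rel I) : commutes_adj e u <-> preserves2 e.
Proof.
split=> [ce x y z w n|pe x y].
  have: u x z * (\sum_t u x t * (e t w)%:R) * u y w =
        u x z * (\sum_t (e x t)%:R * u t w) * u y w by rewrite ce.
  have boolC (b : bool) (a : A) : b%:R * a = a * b%:R.
    by case: b; rewrite ?mul1r ?mulr1 ?mul0r ?mulr0.
  rewrite mulr_sumr (bigD1 z) //= big1 ?addr0 => [|t ntz]; last first.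
    by rewrite mulrA (magic_orthr um) ?mul0r // eq_sym.
  rewrite mulrA (magic_idem um) -!mulrA mulr_suml (bigD1 y) //=.
  rewrite big1 ?addr0 => [|t nty]; last first.
    by rewrite -mulrA (magic_orthc um) ?mulr0 // eq_sym.
  rewrite -mulrA (magic_idem um) boolC [_%:R * _]boolC !mulrA.
  by case: (e x y) (e z w) n => [] [] // _; rewrite mulr1 mulr0.
transitivity (\sum_z \sum_t u x z * ((e x t)%:R * u t y)).
  apply: eq_bigr => z _.
  rewrite -[LHS]mulr1 -[X in _ * X = _](magic_col um y) mulr_sumr.
  apply: eq_bigr => t _.
  case: (boolP (e x t == e z y)) => [/eqP -> //|n]; first by rewrite -mulrA.
  have := pe x t z y n; case: (e x t) (e z y) n => [] [] // _ E;
  by rewrite ?mul1r ?mul0r ?mulr1 ?mulr0 ?mul0r ?E.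
rewrite exchange_big; apply: eq_bigr => t _ /=.
by rewrite -mulr_suml (magic_row um) mul1r.
Qed.

(** Summing the commutation with [e] over the columns and multiplying by [u x z] gives deg(z) u_xz =
    deg(x) u_xz, and distinct integers stay distinct in [C]. *)
Lemma preserves1_card (e : rel I) :
  preserves2 e -> preserves1 (fun x => #|[set y | e x y]|).
Proof.
move=> /commutes_adjP eP x z n.
have cardE t : \sum_y (e t y)%:R = #|[set y | e t y]|%:R :> A.
  by rewrite -natr_sum -sum1dep_card [in RHS]big_mkcond.
have: u x z * (\sum_y \sum_t u x t * (e t y)%:R) =
      u x z * (\sum_y \sum_t (e x t)%:R * u t y).
  by congr (_ * _); apply: eq_bigr => y _; apply: eP.
rewrite exchange_big [in X in _ = X]exchange_big /=.
under [X in _ * X = _]eq_bigr do rewrite -mulr_sumr cardE.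
under [X in _ = _ * X]eq_bigr do rewrite -mulr_sumr (magic_row um) mulr1.
rewrite cardE mulr_sumr (bigD1 z) //= big1 ?addr0 => [|t ntz]; last first.
  by rewrite mulrA (magic_orthr um) ?mul0r // eq_sym.
rewrite mulrA (magic_idem um) !mulr_natr => E.
have {E} : (#|[set y | e z y]|%:R - #|[set y | e x y]|%:R : C) *: u x z = 0.
  by rewrite scalerBl !scaler_nat E subrr.
move=> E; rewrite -[u x z]scale1r.
have nz : (#|[set y | e z y]|%:R - #|[set y | e x y]|%:R : C) != 0.
  by rewrite subr_eq0 eqr_nat eq_sym.
by rewrite -(mulVf nz) -scalerA E scaler0.
Qed.

Lemma preserves1_exists (e : rel I) :
  preserves2 e -> preserves1 (fun x => [exists y, e x y]).
Proof.
move=> /preserves1_card/(preserves1_comp (g := leq 1)).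
move=> eP x z n; apply: eP => /=; rewrite !card_gt0.
have E t : ([set y | e t y] != set0) = [exists y, e t y].
  by apply/set0Pn/existsP => -[y]; rewrite ?inE => ey; exists y; rewrite ?inE.
by rewrite !E.
Qed.

Section Function.
Variable f : I -> I.
Hypothesis fP : preserves2 (fun x y => f x == y).

(** The row of [f x] sums to 1, and [u x z] kills each of its entries except the one at [f z]. *)
Lemma preserves_funr x z : u x z = u x z * u (f x) (f z).
Proof.
rewrite -[LHS]mulr1 -(magic_row um (f x)) mulr_sumr (bigD1 (f z)) //=.
rewrite [X in _ + X]big1 ?addr0 // => w nw; apply: fP.
by rewrite eqxx [f z == w]eq_sym (negPf nw).
Qed.

Lemma preserves_funl x z : u x z = u (f x) (f z) * u x z.
Proof.
by rewrite -(magic_star um) {1}preserves_funr starM !(magic_star um).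
Qed.

Lemma preserves1_fun (K : eqType) (c : I -> K) :
  preserves1 c -> preserves1 (c \o f).
Proof. by move=> cP x z /cP E; rewrite preserves_funr E mulr0. Qed.

Lemma preserves2_funl (K : eqType) (e : I -> I -> K) :
  preserves2 e -> preserves2 (fun x y => e (f x) y).
Proof.
by move=> eP x y z w /eP E; rewrite preserves_funr -mulrA E mulr0.
Qed.

Lemma preserves1_fixed : preserves1 (fun x => f x == x).
Proof.
move=> x z n; rewrite preserves_funr.
by apply: preserves2_eq; rewrite [x == _]eq_sym [z == _]eq_sym.
Qed.
End Function.

Lemma preserves_iter (f : I -> I) n :
  preserves2 (fun x y => f x == y) -> preserves2 (fun x y => iter n f x == y).
Proof.
move=> fP; elim: n => [|n IHn]; first exact: preserves2_eq.
move=> x y z w; rewrite !iterSr; exact: (preserves2_funl fP IHn).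
Qed.

End Preservation.

(** Converse of [preserves_funr]: preservation of a function is one identity on entries, which is
    easier to verify on explicit matrices. *)
Lemma fun_preserves2 (C : numClosedFieldType) (I : finType) (A : starAlgType C)
    (u : I -> I -> A) (f : I -> I) :
  magic_unitary u -> (forall x z, u x z = u x z * u (f x) (f z)) ->
  preserves2 u (fun x y => f x == y).
Proof.
move=> um uf x y z w n; rewrite uf -mulrA.
by rewrite (preserves2_eq um n) mulr0.
Qed.

(** * The quantum automorphism group of a binary relation *)

Section Qrel.
Variables (C : numClosedFieldType) (I : finType) (e : rel I).

(** The relations of [Qu_rel] for any relation [e], so that they apply to the graph of a parent
    function, which is directed and has loops at the roots. *)
Definition Qrel_rel (A : starAlgType C) (u : I * I -> A) : Prop :=
  magic_unitary (fun x y => u (x, y)) /\ commutes_adj e (fun x y => u (x, y)).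

Lemma Qrel_magic : magic_unitary (fun x y => gen Qrel_rel (x, y)).
Proof. by apply: magic_gen => A f []. Qed.

Lemma Qrel_adj : commutes_adj e (fun x y => gen Qrel_rel (x, y)).
Proof.
move=> x y; apply: univ_eq => A f Pf; have lm := ulift_morphism Pf.
rewrite !(sm_sum lm).
under eq_bigr do rewrite (smM lm) (sm_bool _ lm) ulift_gen //.
under [RHS]eq_bigr do rewrite (smM lm) (sm_bool _ lm) ulift_gen //.
exact: (proj2 Pf).
Qed.

Lemma Qrel_comul : Qrel_rel (fun xy : I * I =>
  \sum_z tens (gen Qrel_rel (xy.1, z)) (gen Qrel_rel (z, xy.2))).
Proof.
split; first exact: magic_tens Qrel_magic Qrel_magic.
exact: commutes_adj_tens Qrel_adj Qrel_adj.
Qed.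

Definition Qrel (I_gt0 : (0 < #|I|)%N) : qpg C := {|
  pts_gt0 := I_gt0;
  fund := fun x y => gen Qrel_rel (x, y);
  fund_magic := Qrel_magic;
  fund_generates := gen_generates2 (P := Qrel_rel);
  comul_morphism := ulift_morphism Qrel_comul;
  comul_fund := fun x y => comul_ulift x y Qrel_comul
|}.

Lemma Qrel_preserves (I_gt0 : (0 < #|I|)%N) :
  preserves2 (fund (q := Qrel I_gt0)) e.
Proof. by apply/(commutes_adjP Qrel_magic)/Qrel_adj. Qed.

Section Lift.
Variables (A : starAlgType C) (v : I -> I -> A).
Hypotheses (vm : magic_unitary v) (vP : preserves2 v e).

Let vrel : Qrel_rel (fun xy => v xy.1 xy.2).
Proof. by split=> //; apply/commutes_adjP. Qed.

Definition Qrel_lift : univ Qrel_rel -> A := ulift (fun xy => v xy.1 xy.2).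

Lemma Qrel_lift_morphism : star_morphism Qrel_lift.
Proof. exact: (ulift_morphism vrel). Qed.

Lemma Qrel_lift_fund x y : Qrel_lift (gen Qrel_rel (x, y)) = v x y.
Proof. by rewrite /Qrel_lift (ulift_gen _ vrel). Qed.
End Lift.
End Qrel.
Arguments Qrel_lift {C I} e {A} v.
Arguments Qrel_preserves C {I} e I_gt0.

(** * Forests and their quantum automorphism groups *)

Lemma sum_codom (V : nmodType) (I J : finType) (f : J -> I) (F : I -> V) :
  injective f -> (forall i, i \notin codom f -> F i = 0) ->
  \sum_i F i = \sum_j F (f j).
Proof.
move=> f_inj F0; rewrite -(big_rmcond [in codom f]) //=.
rewrite (eq_bigl [in f @: setT]) => [|i]; last first.
  apply/codomP/imsetP => [[j ->]|[j _ ->]]; by exists j.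
rewrite big_imset /=; last by move=> ? ? _ _; apply: f_inj.
by apply: eq_bigl => j; rewrite inE.
Qed.

Lemma sum_option (V : nmodType) (I : finType) (F : option I -> V) :
  \sum_x F x = F None + \sum_x F (Some x).
Proof.
rewrite (bigD1 None) //=; congr (_ + _); rewrite big_mkcond /=.
rewrite (sum_codom (f := Some)) //=; first by move=> x y [].
by case=> [x|] //; rewrite codom_f.
Qed.

Section Magic.
Variables (C : numClosedFieldType) (I J : finType) (A : starAlgType C).
Variable u : I -> I -> A.
Hypothesis um : magic_unitary u.

Lemma magic_sub (f : J -> I) : injective f ->
  (forall i j, i \notin codom f -> u (f j) i = 0 /\ u i (f j) = 0) ->
  magic_unitary (fun j k => u (f j) (f k)).
Proof.
move=> f_inj u0; split=> [j k|j k|j|j|j k l nkl|j k l nkl].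
- exact: magic_star.
- exact: magic_idem.
- rewrite -(magic_row um (f j)) (sum_codom f_inj) //.
  by move=> i /(u0 i j) [].
- rewrite -(magic_col um (f j)) (sum_codom f_inj) //.
  by move=> i /(u0 i j) [].
- by rewrite (magic_orthr um) // (inj_eq f_inj).
- by rewrite (magic_orthc um) // (inj_eq f_inj).
Qed.

(** A fibre of a preserved function splits off as a diagonal block: the entries between it and its
    complement vanish. *)
Lemma magic_sub_preserved (f : J -> I) (K : eqType) (c : I -> K) (k : K) :
  preserves1 u c -> injective f -> (forall j, c (f j) = k) ->
  (forall i, c i = k -> i \in codom f) ->
  magic_unitary (fun j k => u (f j) (f k)).
Proof.
move=> cP f_inj cf ck; apply: magic_sub => // i j ni.
suff: c i != k by move=> nc; split; apply: cP; rewrite cf // eq_sym.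
by apply: contra ni => /eqP/ck.
Qed.

Lemma preserves2_sub (f : J -> I) (K : eqType) (e : I -> I -> K) :
  preserves2 u e ->
  preserves2 (fun j k => u (f j) (f k)) (fun x y => e (f x) (f y)).
Proof. by move=> eP x y z w n; apply: eP. Qed.
End Magic.

Section QrelIso.
Variable C : numClosedFieldType.

(** Relations preserved by the same magic unitaries have the same universal property. Later proofs
    thus only have to define two relations from each other. *)
Lemma Qrel_iso (I J : finType) (e : rel I) (e' : rel J) I0 J0
    (f : I -> J) : bijective f ->
  (forall (A : starAlgType C) (u : I -> I -> A), magic_unitary u ->
     preserves2 u e <-> preserves2 u (fun x y => e' (f x) (f y))) ->
  qpg_iso (@Qrel C I e I0) (@Qrel C J e' J0).
Proof.
case=> g fK gK ee'.
have f_inj := can_inj fK; have g_inj := can_inj gK.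
have fc y : y \in codom f by rewrite -[y]gK codom_f.
have gc x : x \in codom g by rewrite -[x]fK codom_f.
pose u x y : alg (Qrel C e I0) := fund (q := Qrel C e I0) (g x) (g y).
pose v x y : alg (Qrel C e' J0) := fund (q := Qrel C e' J0) (f x) (f y).
have vm : magic_unitary v.
  by apply: magic_sub => //; [exact: Qrel_magic|move=> i j; rewrite fc].
have um : magic_unitary u.
  by apply: magic_sub => //; [exact: Qrel_magic|move=> i j; rewrite gc].
have vP : preserves2 v e.
  by apply/ee' => //; exact: (preserves2_sub (f := f) (Qrel_preserves C e' J0)).
have uP : preserves2 u e'.
  have /ee' H := Qrel_preserves C e I0.
  have {H} := preserves2_sub (f := g) (H (Qrel_magic C e)).
  by move=> H x y z w n; apply: H; rewrite !gK.
apply: (@qpg_iso_fund _ (Qrel C e I0) (Qrel C e' J0) (Qrel_lift e v)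
  (Qrel_lift e' u)) => [||i j|i j|i j].
- exact: Qrel_lift_morphism.
- exact: Qrel_lift_morphism.
- by rewrite Qrel_lift_fund // Qrel_lift_fund // /u !fK.
- by rewrite Qrel_lift_fund // Qrel_lift_fund // /v !gK.
rewrite Qrel_lift_fund // (comul_fund (q := Qrel C e' J0)).
rewrite (sum_codom f_inj) => [|k]; last by rewrite fc.
by apply: eq_bigr => k _; rewrite !Qrel_lift_fund.
Qed.

Lemma Qu_Qrel (T : sgraph) :
  qpg_iso (Qu C T) (@Qrel C (vert T) (@edge T) (vert_gt0 T)).
Proof.
have H1 := conj (Qu_magic C T) (@Qu_adj C T).
have H2 := conj (Qrel_magic C (@edge T)) (@Qrel_adj C _ (@edge T)).
pose Q := Qrel C (@edge T) (vert_gt0 T).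
have P1 : Qu_rel C T (fun xy => fund (q := Q) xy.1 xy.2).
  exact: H2.
have P2 : Qrel_rel (@edge T) (fun xy => fund (q := Qu C T) xy.1 xy.2).
  exact: H1.
pose f : alg (Qu C T) -> alg Q := ulift (fun xy => fund (q := Q) xy.1 xy.2).
pose g : alg Q -> alg (Qu C T) := ulift (fun xy => fund (q := Qu C T) xy.1 xy.2).
have fE x y : f (fund (q := Qu C T) x y) = fund (q := Q) x y.
  exact: (ulift_gen (x, y) P1).
have gE x y : g (fund (q := Q) x y) = fund (q := Qu C T) x y.
  exact: (ulift_gen (x, y) P2).
apply: (@qpg_iso_fund _ (Qu C T) Q f g) => [||x y|x y|x y].
- exact: (ulift_morphism P1).
- exact: (ulift_morphism P2).
- by rewrite fE gE.
- by rewrite gE fE.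
rewrite fE (comul_fund (q := Q)).
by apply: eq_bigr => k _; rewrite !fE.
Qed.
End QrelIso.

(* The roots are the fixed points of [parent], and [height] only witnesses that
   iterating [parent] ends at a root. *)
Record forest := Forest {
  node : finType;
  parent : node -> node;
  height : node -> nat;
  height_parent : forall x, parent x != x -> (height (parent x) < height x)%N
}.

Section ForestTheory.
Variable F : forest.
Implicit Types x y : node F.

Definition is_root x := parent x == x.
(** Iterating beyond a root changes nothing, so one number of iterations serves all nodes and
    [preserves_iter] applies. *)
Definition root x := iter (\max_(y : node F) height y) (@parent F) x.

Lemma iter_parent_fixed n x :
  (height x <= n)%N -> is_root (iter n (@parent F) x).
Proof.
elim: n x => [|n IHn] x hx.
  apply: contraTT hx => /height_parent; rewrite -ltnNge.
  by case: (height x).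
rewrite iterSr; case: (eqVneq (parent x) x) => [px|/height_parent hp].
  by rewrite px; elim: n {IHn hx} => [|n IHn] /=; rewrite /is_root ?px // (eqP IHn).
by apply: IHn; rewrite -ltnS (leq_trans hp).
Qed.

Lemma root_is_root x : is_root (root x).
Proof. by apply: iter_parent_fixed; apply: leq_bigmax. Qed.

Lemma root_parent x : root (parent x) = root x.
Proof. by rewrite /root -iterSr iterS (eqP (root_is_root x)). Qed.

Lemma root_id x : is_root x -> root x = x.
Proof.
move=> /eqP px; rewrite /root; elim: (\max_y _)%N => //= n ->; exact: px.
Qed.

Lemma forest_ind (P : node F -> Prop) :
  (forall x, is_root x -> P x) ->
  (forall x, ~~ is_root x -> P (parent x) -> P x) -> forall x, P x.
Proof.
move=> Pr Pp x; move: {2}(height x) (leqnn (height x)) => n.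
elim: n x => [|n IHn] x hx.
  by apply: Pr; apply: (iter_parent_fixed (n := 0)).
case: (boolP (is_root x)) => [/Pr//|nx]; apply: Pp => //; apply: IHn.
by rewrite -ltnS (leq_trans (height_parent nx)).
Qed.

Section Magic.
Variables (C : numClosedFieldType) (A : starAlgType C).
Variable u : node F -> node F -> A.
Hypothesis um : magic_unitary u.
Hypothesis up : preserves2 u (fun x y => parent x == y).

Lemma preserves_root : preserves2 u (fun x y => root x == y).
Proof. exact: preserves_iter. Qed.

Lemma preserves_is_root : preserves1 u is_root.
Proof. exact: (preserves1_fixed um up). Qed.
End Magic.
End ForestTheory.

Definition forest_rel (F : forest) : rel (node F) := fun x y => parent x == y.

Definition Qforest (C : numClosedFieldType) (F : forest)
    (F_gt0 : (0 < #|node F|)%N) : qpg C := Qrel C (@forest_rel F) F_gt0.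

(** * The trivial quantum group *)

Section Trivial.
Variable C : numClosedFieldType.

Lemma scale1_morphism (A : starAlgType C) :
  star_morphism (fun c : C^o => (c : C) *: (1 : A)).
Proof.
apply: star_morphismP => [|x y|x y|k x|x].
- exact: scale1r.
- exact: scalerDl.
- by rewrite -sscalerAl mul1r scalerA.
- by rewrite scalerA.
- by rewrite starZ star1.
Qed.

Lemma free_trivial_iso (G : qpg C) : qpg_iso (free_qpg G (trivial_qpg C)) G.
Proof.
have lm := finl_morphism (alg G) C^o; have rm := finr_morphism (alg G) C^o.
have sm := scale1_morphism (alg G).
pose f : free_prod (alg G) C^o -> alg G := free_lift id (fun c : C^o => (c : C) *: (1 : alg _)).
have fm : star_morphism f.
  by apply: free_lift_morphism => //; apply: star_morphism_id.
have fl a : f (finl _ _ a) = a.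
  by apply: free_lift_inl => //; apply: star_morphism_id.
apply: (@qpg_iso_gen _ (free_qpg G (trivial_qpg C)) G
  (fun x => exists a, x = finl _ _ a) (fun _ => True) f (finl _ _)) => //.
- move=> P Ps Pg; apply: free_prod_generates => // _ [[a ->]|[c ->]].
    by apply: Pg; exists a.
  rewrite -[c]mulr1 [X in finr _ _ X](_ : _ = c *: 1) // (smZ rm) (sm1 rm).
  exact: (ssubZ Ps c (ssub1 Ps)).
- by move=> P Ps Pg a; apply: Pg.
- by move=> _ [a ->]; rewrite fl.
move=> _ [a ->]; rewrite fl.
have -> : comul (q := free_qpg G (trivial_qpg C)) (finl _ _ a) =
    tmap (finl _ _) (finl _ _) (comul a).
  apply: (free_lift_inl (f := fun a => tmap _ _ (comul a))).
    exact: star_morphism_comp (tmap_star_morphism lm lm) (comul_morphism _).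
  exact: star_morphism_comp (tmap_star_morphism rm rm) (comul_morphism (trivial_qpg C)).
rewrite tmap_comp //.
have -> : f \o finl (alg G) C^o = id by apply/funext => x /=; rewrite fl.
by rewrite tmap_id.
Qed.

Lemma delta_magic (I : finType) :
  magic_unitary (fun i j : I => (i == j)%:R : C^o).
Proof.
split=> [i j|i j|i|i|i j k njk|i j k njk].
- by case: eqP => _; rewrite ?star1 ?star0.
- by case: eqP => _; rewrite ?mulr1 ?mulr0.
- by rewrite (bigD1 i) //= eqxx big1 ?addr0 // => j /negPf; rewrite eq_sym => ->.
- by rewrite (bigD1 i) //= eqxx big1 ?addr0 // => j /negPf ->.
- by case: (eqVneq i j) njk => [<- /negPf ->|]; rewrite ?mulr0 ?mul0r.
- by case: (eqVneq k i) njk => [-> /negPf ->|]; rewrite ?mulr0 ?mul0r.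
Qed.

(** The hypothesis makes the fundamental matrix diagonal; its rows sum to 1, so it is the identity
    matrix and generates only the scalars. *)
Lemma Qrel_trivial (I : finType) (e : rel I) I0 :
  preserves1 (fund (q := @Qrel C I e I0)) id ->
  qpg_iso (Qrel C e I0) (trivial_qpg C).
Proof.
move=> dP; pose Q := Qrel C e I0; have um := fund_magic Q.
pose d : I -> I -> C^o := fun i j => (i == j)%:R.
have dm := delta_magic I.
have de : preserves2 d e.
  move=> x y z w; rewrite /d; case: (eqVneq x z) => [<-|_ _]; last by rewrite mul0r.
  by case: (eqVneq y w) => [<-|_ _]; rewrite ?eqxx ?mulr0.
have fE i j : fund (q := Q) i j = (i == j)%:R.
  case: eqVneq => [<-|n]; last by rewrite dP.
  rewrite -(magic_row um i) (bigD1 i) //= big1 ?addr0 // => k n.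
  by rewrite [LHS]dP // eq_sym.
apply: (@qpg_iso_fund _ Q (trivial_qpg C) (Qrel_lift e d) (fun c : C^o => (c : C) *: (1 : alg _))).
- exact: Qrel_lift_morphism.
- exact: scale1_morphism.
- move=> i j; rewrite Qrel_lift_fund // fE /d.
  by case: eqP; rewrite ?scale1r ?scale0r.
- by move=> i j; rewrite /= scale1r (sm1 (Qrel_lift_morphism dm de)).
move=> i j; rewrite Qrel_lift_fund // (bigD1 j) //= big1 => [|k n].
  rewrite !Qrel_lift_fund // addr0 /trivial_comul /d eqxx.
  by case: eqP.
by rewrite !Qrel_lift_fund // /d (negPf n) tens0r.
Qed.
End Trivial.

Section Forests.
Variable C : numClosedFieldType.

Lemma Qforest_preserves (F : forest) F0 :
  preserves2 (fund (q := @Qforest C F F0)) (fun x y => parent x == y).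
Proof. exact: Qrel_preserves. Qed.
Arguments Qforest_preserves {F} F0.

Definition forest_iso (F G : forest) (f : node F -> node G) : Prop :=
  bijective f /\ forall x, f (parent x) = parent (f x).

Lemma Qforest_iso (F G : forest) F0 G0 (f : node F -> node G) :
  forest_iso f -> qpg_iso (@Qforest C F F0) (@Qforest C G G0).
Proof.
case=> fb fp; apply: (Qrel_iso _ _ fb) => A u um.
suff -> : (fun x y => forest_rel (f x) (f y)) = @forest_rel F by [].
apply/funext => x; apply/funext => y.
by rewrite /forest_rel -fp (inj_eq (bij_inj fb)).
Qed.

Lemma path_height n (x : 'I_n.+1) :
  inord x.-1 != x -> ((inord x.-1 : 'I_n.+1) < x)%N.
Proof.
case: x => [[|x] xn] /=; first by rewrite -val_eqE /= inordK.
by rewrite inordK // ltnW.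
Qed.

(** A path with n + 1 nodes rooted at 0, which is its own parent because [0.-1] is 0. *)
Definition path_forest n : forest :=
  @Forest 'I_n.+1 (fun x => inord x.-1) (@nat_of_ord _) (@path_height n).

Lemma path_root n (x : node (path_forest n)) : is_root x = (x == ord0).
Proof.
case: x => [[|x] xn]; rewrite /is_root -!val_eqE /= inordK //.
  by rewrite ltn_eqF.
exact: ltnW.
Qed.

Lemma iter_path_root n k (x : node (path_forest n)) :
  is_root (iter k (@parent (path_forest n)) x) = ((x : 'I__) <= k)%N.
Proof.
rewrite path_root -val_eqE /= -subn_eq0; congr (_ == _).
elim: k => [|k IHk]; rewrite ?subn0 //= inordK IHk ?subnS //.
exact: leq_ltn_trans (leq_pred _) (leq_ltn_trans (leq_subr _ _) (ltn_ord x)).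
Qed.

(** A node of a path is determined by the number of steps after which it reaches the root, and every
    condition on these steps is preserved. *)
Lemma Qforest_path n F0 : qpg_iso (@Qforest C (path_forest n) F0) (trivial_qpg C).
Proof.
apply: Qrel_trivial; pose u := fund (q := Qforest C F0).
rewrite -/u; have um : magic_unitary u by apply: fund_magic.
have up : preserves2 u (fun x y => parent x == y) by apply: Qforest_preserves.
have ui k := preserves1_fun um (preserves_iter um (n := k) up) (preserves_is_root um up).
move=> x z; rewrite -val_eqE neq_ltn => /orP[] lxz.
  by apply: (ui x); rewrite /= !iter_path_root leqnn leqNgt lxz.
by apply: (ui z); rewrite /= !iter_path_root leqnn leqNgt lxz.
Qed.

Section Option.
Variable F : forest.

Definition add_root_parent (x : option (node F)) : option (node F) :=
  if x is Some y then if is_root y then None else Some (parent y) else None.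
Definition add_root_height (x : option (node F)) : nat :=
  if x is Some y then (height y).+1 else 0.

Lemma add_root_heightP x : add_root_parent x != x ->
  (add_root_height (add_root_parent x) < add_root_height x)%N.
Proof. by case: x => [y|] //=; case: ifP => //= /negbT/height_parent. Qed.

Definition add_root : forest := Forest add_root_heightP.

Lemma add_root_is_root (x : node add_root) : is_root x = (x == None).
Proof.
case: x => [x|] //; rewrite /is_root /=; case: ifP => // nx.
Qed.

Lemma add_root_gt0 : (0 < #|node add_root|)%N.
Proof. by rewrite card_option. Qed.

(** The new root is the only one, so its diagonal entry is 1 and the rest of its row and column is
    0. The other block satisfies the relations of [F]. *)
Lemma Qforest_add_root F0 F0' :
  qpg_iso (@Qforest C add_root F0') (@Qforest C F F0).
Proof.
pose Q := Qforest C F0; pose Q' := Qforest C F0'.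
pose u : node F -> node F -> alg Q := fund (q := Q).
pose w : node add_root -> node add_root -> alg Q' := fund (q := Q').
have um : magic_unitary u by apply: (fund_magic Q).
have wm : magic_unitary w by apply: (fund_magic Q').
have up : preserves2 u (fun x y => parent x == y) by apply: (Qforest_preserves F0).
have wp : preserves2 w (fun x y => parent x == y) by apply: (Qforest_preserves F0').
pose v (x y : option (node F)) : alg Q :=
  match x, y with
  | Some x, Some y => u x y
  | None, None => 1
  | _, _ => 0
  end.
pose u' (x y : node F) := w (Some x) (Some y).
have uN x y : (x == None) != (y == None) -> w x y = 0.
  by move=> n; apply: (preserves_is_root wm wp); rewrite !add_root_is_root.
have vm : magic_unitary v.
  split=> [[x|] [y|]|[x|] [y|]|[x|]|[x|]|[x|] [y|] [z|]|[x|] [y|] [z|]] //=;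
    rewrite ?sum_option /= ?star1 ?star0 ?mulr1 ?mulr0 ?mul0r ?add0r //.
  - exact: (magic_star um).
  - exact: (magic_idem um).
  - exact: (magic_row um).
  - by rewrite big1 ?addr0.
  - exact: (magic_col um).
  - by rewrite big1 ?addr0.
  - exact: (magic_orthr um).
  - exact: (magic_orthc um).
have vP : preserves2 v (@forest_rel add_root).
  apply: fun_preserves2 => // [] [x|] [y|] /=; rewrite ?mul0r ?mulr1 //.
  case: (boolP (is_root x)) (boolP (is_root y)) => rx [] ry /=.
  - by rewrite mulr1.
  - by rewrite mulr0 (preserves_is_root um up) // rx (negPf ry).
  - by rewrite mulr0 (preserves_is_root um up) // ry (negPf rx).
  - exact: preserves_funr.
have um2 : magic_unitary u'.
  apply: (magic_sub wm Some_inj) => -[i|] j; first by rewrite codom_f.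
  by rewrite !uN.
have uP2 : preserves2 u' (@forest_rel F).
  (* The roots of [F] are recognised in [add_root] as the old nodes whose parent is [None]. *)
  have w0 x y : is_root x != is_root y -> w (Some x) (Some y) = 0.
    move=> n; rewrite (preserves_funr wm wp) /= [X in _ * X]uN ?mulr0 //.
    by case: (is_root x) (is_root y) n => [] [].
  apply: fun_preserves2 => // x y; rewrite /u'.
  case: (eqVneq (is_root x) (is_root y)) => [|/w0 ->]; last by rewrite mul0r.
  case: (boolP (is_root x)) => [/eqP rx /esym/eqP ry|rx /esym/negbT ry].
    by rewrite rx ry (magic_idem wm).
  by rewrite [LHS](preserves_funr wm wp) /= (negPf rx) (negPf ry).
have u1 : w None None = 1.
  rewrite -(magic_row wm None) sum_option big1 ?addr0 // => i _.
  by rewrite uN.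
apply: (@qpg_iso_fund _ Q' Q (Qrel_lift _ v) (Qrel_lift _ u')).
- exact: Qrel_lift_morphism.
- exact: Qrel_lift_morphism.
- move=> [x|] [y|]; rewrite Qrel_lift_fund //=.
  + exact: Qrel_lift_fund.
  + by rewrite (sm0 (Qrel_lift_morphism um2 uP2)) -[RHS]/(w _ _) uN.
  + by rewrite (sm0 (Qrel_lift_morphism um2 uP2)) -[RHS]/(w _ _) uN.
  + by rewrite (sm1 (Qrel_lift_morphism um2 uP2)) -[RHS]/(w _ _) u1.
- by move=> x y; rewrite !Qrel_lift_fund.
move=> x y; under eq_bigr do rewrite !Qrel_lift_fund //.
have cm := comul_morphism Q.
rewrite Qrel_lift_fund // sum_option; case: x y => [x|] [y|].
- by rewrite tens0l add0r; apply: (comul_fund (q := Q)).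
- rewrite tens0l add0r big1 => [|i _]; first exact: (sm0 cm).
  by rewrite tens0r.
- rewrite tens0r add0r big1 => [|i _]; first exact: (sm0 cm).
  by rewrite tens0l.
rewrite tens1 big1 ?addr0 => [|i _]; last by rewrite tens0r.
exact: (sm1 cm).
Qed.
End Option.

Section Sum.
Variables F G : forest.

Definition sum_parent (x : node F + node G) : node F + node G :=
  match x with inl y => inl (parent y) | inr y => inr (parent y) end.
Definition sum_height (x : node F + node G) : nat :=
  match x with inl y => height y | inr y => height y end.

Lemma sum_heightP x : sum_parent x != x ->
  (sum_height (sum_parent x) < sum_height x)%N.
Proof.
by case: x => y /= n; apply: height_parent; apply: contra n => /eqP ->.
Qed.

Definition sum_forest : forest := Forest sum_heightP.

Lemma sum_is_root x : is_root (x : node sum_forest) =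
  match x with inl y => is_root y | inr y => is_root y end.
Proof. by case: x. Qed.

Definition is_left (x : node sum_forest) : bool := if x is inl _ then true else false.

Lemma sum_forest_gt0 : (0 < #|node F|)%N -> (0 < #|node sum_forest|)%N.
Proof. by move=> F0; rewrite card_sum ltn_addr. Qed.

(** As [is_left] is preserved, the fundamental matrix is block diagonal. Each block satisfies the
    relations of its own forest and nothing links the two, as in the free product. *)
Lemma Qforest_sum F0 G0 S0 :
  preserves1 (fund (q := @Qforest C sum_forest S0)) is_left ->
  qpg_iso (@Qforest C sum_forest S0) (free_qpg (@Qforest C F F0) (@Qforest C G G0)).
Proof.
pose Q := Qforest C S0; pose Q1 := Qforest C F0; pose Q2 := Qforest C G0.
move=> lP.
pose w : node sum_forest -> node sum_forest -> alg Q := fund (q := Q).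
have wm : magic_unitary w by apply: (fund_magic Q).
have wp : preserves2 w (fun x y => parent x == y) by apply: (Qforest_preserves S0).
pose u1 : node F -> node F -> alg Q1 := fund (q := Q1).
pose u2 : node G -> node G -> alg Q2 := fund (q := Q2).
have um1 : magic_unitary u1 by apply: (fund_magic Q1).
have um2 : magic_unitary u2 by apply: (fund_magic Q2).
have up1 : preserves2 u1 (fun x y => parent x == y) by apply: (Qforest_preserves F0).
have up2 : preserves2 u2 (fun x y => parent x == y) by apply: (Qforest_preserves G0).
pose v : node sum_forest -> node sum_forest -> free_prod (alg Q1) (alg Q2) :=
  fun x y => match x, y with
  | inl i, inl j => finl _ _ (u1 i j)
  | inr i, inr j => finr _ _ (u2 i j)
  | _, _ => 0
  end.
have vm : magic_unitary v by apply: (@diag_magic C Q1 Q2).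
have lm := finl_morphism (alg Q1) (alg Q2).
have rm := finr_morphism (alg Q1) (alg Q2).
have vP : preserves2 v (@forest_rel sum_forest).
  apply: fun_preserves2 => // -[x|x] [z|z] /=; rewrite ?mulr0 ?mul0r //.
    by rewrite -(smM lm) -(preserves_funr um1 up1).
  by rewrite -(smM rm) -(preserves_funr um2 up2).
pose a1 x y := w (inl x) (inl y).
pose a2 x y := w (inr x) (inr y).
have am1 : magic_unitary a1.
  apply: (magic_sub_preserved (k := true) wm lP) => //; first by move=> x y [].
  by case=> [x|//] _; rewrite codom_f.
have am2 : magic_unitary a2.
  apply: (magic_sub_preserved (k := false) wm lP) => //; first by move=> x y [].
  by case=> [//|x] _; rewrite codom_f.
have aP1 : preserves2 a1 (@forest_rel F).
  by apply: fun_preserves2 => // x y; apply: (preserves_funr wm wp).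
have aP2 : preserves2 a2 (@forest_rel G).
  by apply: fun_preserves2 => // x y; apply: (preserves_funr wm wp).
have m1 := Qrel_lift_morphism am1 aP1; have m2 := Qrel_lift_morphism am2 aP2.
pose g : free_prod (alg Q1) (alg Q2) -> alg Q :=
  free_lift (Qrel_lift (@forest_rel F) a1) (Qrel_lift (@forest_rel G) a2).
have gm : star_morphism g by apply: free_lift_morphism.
have fm := Qrel_lift_morphism vm vP.
have lw : preserves1 w is_left by [].
have gv x y : g (v x y) = w x y.
  case: x y => [x|x] [y|y] /=.
  - by rewrite /g free_lift_inl // Qrel_lift_fund.
  - by rewrite (sm0 gm) lw.
  - by rewrite (sm0 gm) lw.
  - by rewrite /g free_lift_inr // Qrel_lift_fund.
apply: (@qpg_iso_fund _ Q (free_qpg Q1 Q2) (Qrel_lift _ v) g) => // [x y|x y|x y].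
- by rewrite Qrel_lift_fund.
- by rewrite [g _]gv Qrel_lift_fund.
rewrite Qrel_lift_fund // (comul_fund (q := free_qpg Q1 Q2)).
by apply: eq_bigr => k _; rewrite !Qrel_lift_fund.
Qed.
End Sum.
End Forests.
Arguments Qforest_preserves C {F} F0.

(** * Copies of one tree and wreath products *)

Section Copies.
Variables (n : nat) (n_gt0 : (0 < n)%N) (M : forest).

Definition copies_parent (x : 'I_n * node M) : 'I_n * node M := (x.1, parent x.2).

Lemma copies_heightP (x : 'I_n * node M) : copies_parent x != x ->
  (height (copies_parent x).2 < height x.2)%N.
Proof. by case: x => i k; rewrite xpair_eqE eqxx /= => /height_parent. Qed.

Definition copies : forest := Forest copies_heightP.

Lemma copies_is_root (x : node copies) : is_root x = is_root x.2.
Proof. by case: x => i k; rewrite /is_root xpair_eqE eqxx. Qed.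

Lemma copies_gt0 : (0 < #|node M|)%N -> (0 < #|node copies|)%N.
Proof. by move=> M0; rewrite card_prod card_ord muln_gt0 n_gt0. Qed.

Variable r : node M.
Hypothesis rP : forall x : node M, is_root x -> x = r.
Let r_root : is_root r.
Proof. by rewrite -(rP (root_is_root r)) root_is_root. Qed.

Lemma copies_root (x : node copies) : root x = (x.1, r).
Proof.
have Ex : (root x).1 = x.1 by rewrite /root; elim: (\max_y _)%N.
have := root_is_root x; rewrite copies_is_root => /rP.
by case: (root x) Ex => i k /= -> ->.
Qed.

Variable C : numClosedFieldType.

Section CopiesMagic.
Variables (A : starAlgType C) (w : node copies -> node copies -> A).
Hypothesis wm : magic_unitary w.
Hypothesis wP : preserves2 w (fun x y => parent x == y).

(** [copies_p] and [copies_nu] recover p_ij and nu_i(u_kl) from the products w_(ik,jl) = nu_i(u_kl)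
    p_ij: the first from the entries at the roots, the second by summing over j. *)
Definition copies_p (i j : 'I_n) : A := w (i, r) (j, r).
Definition copies_nu (i : 'I_n) (k l : node M) : A := \sum_j w (i, k) (j, l).

Lemma copies_pr i k j l : w (i, k) (j, l) = w (i, k) (j, l) * copies_p i j.
Proof. by rewrite {1}(preserves_funr wm (preserves_root wm wP)) !copies_root. Qed.

Lemma copies_pl i k j l : w (i, k) (j, l) = copies_p i j * w (i, k) (j, l).
Proof. by rewrite {1}(preserves_funl wm (preserves_root wm wP)) !copies_root. Qed.

Lemma copies_p_magic : magic_unitary copies_p.
Proof.
apply: (magic_sub wm (f := fun i => (i, r))) => [i j []//|[i k] j nk].
have nr : ~~ is_root k.
  by apply: contra nk => /rP ->; apply: (codom_f (fun i => (i, r))).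
by split; apply: (preserves_is_root wm wP); rewrite !copies_is_root /= r_root (negPf nr).
Qed.
Let pm := copies_p_magic.

Lemma copies_nu_p i j k l : copies_nu i k l * copies_p i j = w (i, k) (j, l).
Proof.
rewrite mulr_suml (bigD1 j) //= -copies_pr big1 ?addr0 // => j' nj.
by rewrite copies_pr -mulrA (magic_orthr pm) ?mulr0.
Qed.

Lemma copies_p_nu i j k l : copies_p i j * copies_nu i k l = w (i, k) (j, l).
Proof.
rewrite mulr_sumr (bigD1 j) //= -copies_pl big1 ?addr0 // => j' nj.
by rewrite copies_pl mulrA (magic_orthr pm) ?mul0r // eq_sym.
Qed.

(** The product p_ij p_ij' = 0 can be inserted between the two factors. *)
Lemma copies_wM i j j' k l k' l' : j != j' ->
  w (i, k) (j, l) * w (i, k') (j', l') = 0.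
Proof.
move=> nj; rewrite copies_pr [X in _ * X]copies_pl mulrA -(mulrA (w _ _)).
by rewrite (magic_orthr pm) // mulr0 mul0r.
Qed.

Lemma copies_nuM i k l k' l' :
  copies_nu i k l * copies_nu i k' l' =
  \sum_j w (i, k) (j, l) * w (i, k') (j, l').
Proof.
rewrite mulr_suml; apply: eq_bigr => j _; rewrite mulr_sumr (bigD1 j) //=.
by rewrite big1 ?addr0 // => j' nj; rewrite copies_wM // eq_sym.
Qed.

Lemma copies_nu_magic i : magic_unitary (copies_nu i).
Proof.
split=> [k l|k l|k|k|k l l' nl|k l l' nl].
- by rewrite star_sum; apply: eq_bigr => j _; rewrite (magic_star wm).
- by rewrite copies_nuM; apply: eq_bigr => j _; rewrite (magic_idem wm).
- rewrite exchange_big -(magic_row wm (i, k)).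
  by rewrite (pair_bigA _ (fun j l => w (i, k) (j, l))); apply: eq_bigr => -[].
- rewrite exchange_big -(magic_row pm i); apply: eq_bigr => j _.
  (* Column (j, k) of [w] sums to 1; multiplied by p_ij, only its entries in the rows of copy i
     remain. *)
  rewrite -[RHS]mul1r -(magic_col wm (j, k)).
  rewrite [X in _ = X * _](_ : _ = \sum_i' \sum_l w (i', l) (j, k)); last first.
    by rewrite (pair_bigA _ (fun i' l => w (i', l) (j, k))); apply: eq_bigr => -[].
  rewrite mulr_suml (bigD1 i) //= [X in _ + X]big1 ?addr0 => [|i' ni].
    by rewrite mulr_suml; apply: eq_bigr => l _; apply: copies_pr.
  rewrite mulr_suml big1 // => l _.
  by rewrite copies_pr -mulrA (magic_orthc pm) ?mulr0.
- rewrite copies_nuM big1 // => j _; rewrite (magic_orthr wm) //.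
  by rewrite xpair_eqE eqxx.
- rewrite copies_nuM big1 // => j _; rewrite (magic_orthc wm) //.
  by rewrite xpair_eqE eqxx.
Qed.

Lemma copies_nu_preserves i : preserves2 (copies_nu i) (@forest_rel M).
Proof.
apply: fun_preserves2 => [|k l]; first exact: copies_nu_magic.
rewrite copies_nuM; apply: eq_bigr => j _.
exact: (preserves_funr wm wP).
Qed.
End CopiesMagic.

Lemma Qforest_copies M0 N0 :
  qpg_iso (@Qforest C copies N0) (wreath_qpg (@Qforest C M M0) n_gt0).
Proof.
pose Q := Qforest C N0; pose Q' := Qforest C M0.
pose w : node copies -> node copies -> alg Q := fund (q := Q).
have wm : magic_unitary w by apply: (fund_magic Q).
have wP : preserves2 w (fun x y => parent x == y) by apply: (Qforest_preserves C N0).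
pose u : node M -> node M -> alg Q' := fund (q := Q').
have um : magic_unitary u by apply: (fund_magic Q').
have up : preserves2 u (fun x y => parent x == y) by apply: (Qforest_preserves C M0).
pose v : node copies -> node copies -> wreath_alg Q' n_gt0 := @wreath_fund C Q' n n_gt0.
have vm : magic_unitary v by apply: (@wreath_magic C Q' n n_gt0).
have pm' := wp_magic Q' n_gt0; have num i := wnu_morphism Q' n_gt0 i.
have vE i k j l : v (i, k) (j, l) = wnu n_gt0 i (u k l) * wp Q' n_gt0 i j by [].
have vP : preserves2 v (@forest_rel copies).
  apply: fun_preserves2 => // -[i k] [j l].
  rewrite -[RHS]/(v (i, k) (j, l) * v (i, parent k) (j, parent l)) !vE.
  rewrite (wnuC n_gt0 i j (u (parent k) (parent l))) mulrA.
  rewrite -(mulrA _ (wp _ _ _ _) (wp _ _ _ _)) (magic_idem pm').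
  by rewrite -mulrA -wnuC mulrA -(smM (num i)) -(preserves_funr um up).
have pm := copies_p_magic wm wP.
pose f i : alg Q' -> alg Q := Qrel_lift (@forest_rel M) (copies_nu w i).
have fm i : star_morphism (f i).
  by apply: Qrel_lift_morphism; [apply: copies_nu_magic|apply: copies_nu_preserves].
have fE i k l : f i (u k l) = copies_nu w i k l.
  by apply: Qrel_lift_fund; [apply: copies_nu_magic|apply: copies_nu_preserves].
(* The elements satisfying this form a star subalgebra, and on the entries of [u] both sides are
   entries of [w]. *)
have fC i j a : f i a * copies_p w i j = copies_p w i j * f i a.
  pose P a := f i a * copies_p w i j = copies_p w i j * f i a.
  apply: (fund_generates (q := Q') (P := P)) => [|_ [k [l ->]]]; last first.
    by rewrite /P [f i _]fE copies_nu_p // copies_p_nu.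
  rewrite /P; split=> [|x y Px Py|x y Px Py|c x Px|x Px].
  - by rewrite (sm1 (fm i)) mul1r mulr1.
  - by rewrite (smD (fm i)) mulrDl mulrDr Px Py.
  - by rewrite (smM (fm i)) -mulrA Py !mulrA Px.
  - by rewrite (smZ (fm i)) -sscalerAl -sscalerAr Px.
  - by rewrite (smS (fm i)) -{1}(magic_star pm) -starM -Px starM (magic_star pm).
pose g : wreath_alg Q' n_gt0 -> alg Q := wlift f (copies_p w).
have gm : star_morphism g by apply: wlift_morphism.
have gv x y : g (v x y) = w x y.
  case: x y => [i k] [j l]; rewrite vE (smM gm) /g wlift_nu // wlift_p //.
  by rewrite fE copies_nu_p.
apply: (@qpg_iso_fund _ Q (wreath_qpg Q' n_gt0) (Qrel_lift _ v) g) => // [|x y|x y|x y].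
- exact: Qrel_lift_morphism.
- by rewrite Qrel_lift_fund.
- by rewrite [g _]gv Qrel_lift_fund.
rewrite Qrel_lift_fund // (comul_fund (q := wreath_qpg Q' n_gt0)).
by apply: eq_bigr => k _; rewrite !Qrel_lift_fund.
Qed.
End Copies.

(** * Quantum symmetries of forests preserve isomorphism classes of trees *)

(** By induction on [#|A|]: the counts provide an element of [B] equivalent to a given element of
    [A], and removing both lowers the same counts on the two sides. *)
Lemma class_matching (T : finType) (E : rel T) (A B : {set T}) :
  equivalence_rel E ->
  (forall k, #|[set a in A | E k a]| = #|[set b in B | E k b]|) ->
  exists s t : T -> T,
    (forall a, a \in A -> [/\ s a \in B, t (s a) = a & E a (s a)]) /\
    (forall b, b \in B -> t b \in A /\ s (t b) = b).
Proof.
move=> eqE; have Er x : E x x by have [] := eqE x x x.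
have El x y z : E x y -> E x z = E y z by move=> xy; have [_ ->] := eqE x y z.
have Es x y : E x y = E y x by apply/idP/idP => xy; rewrite -(El _ _ _ xy) Er.
move: {2}#|A| (erefl #|A|) => n; elim: n => [|n IHn] in A B * => cA AB.
  exists id, id; move/eqP: cA; rewrite cards_eq0 => /eqP A0; subst A.
  split=> [a|b bB]; first by rewrite inE.
  have /esym := AB b; rewrite (_ : [set a in set0 | E b a] = set0) ?cards0.
    move/eqP; rewrite cards_eq0 => /eqP/setP/(_ b); rewrite !inE bB Er //.
  by apply/setP => x; rewrite !inE.
have /card_gt0P[a aA] : (0 < #|A|)%N by rewrite cA.
have : (0 < #|[set b in B | E a b]|)%N.
  by rewrite -AB card_gt0; apply/set0Pn; exists a; rewrite inE aA Er.
case/card_gt0P => b; rewrite inE => /andP[bB ab].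
have cD (X : {set T}) x k : x \in X ->
    #|[set y in X | E k y]| = (E k x + #|[set y in X :\ x | E k y]|)%N.
  move=> xX; rewrite (cardsD1 x) inE xX /=; congr (_ + _)%N.
  by apply: eq_card => y; rewrite !inE andbA.
have [||s [t [sP tP]]] := IHn (A :\ a) (B :\ b).
- by move: cA; rewrite (cardsD1 a) aA => -[].
- move=> k; have := AB k; rewrite (cD A a) // (cD B b) //.
  by rewrite [E k a]Es (El _ _ _ ab) [E b k]Es => /addnI.
exists (fun x => if x == a then b else s x), (fun y => if y == b then a else t y).
split=> [x xA|y yB].
  case: eqVneq => [->|nxa]; first by rewrite eqxx.
  have [|sB tsx Exs] := sP x; first by rewrite !inE nxa.
  by move: sB; rewrite !inE => /andP[/negPf -> ->].
case: eqVneq => [->|nyb]; first by rewrite eqxx.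
have [|tA sty] := tP y; first by rewrite !inE nyb.
by move: tA; rewrite !inE => /andP[/negPf -> ->].
Qed.

Section Peel.
Variable F : forest.

Definition peel_node : finType := {x : node F | ~~ is_root x}.
(** The default value of [insubd] turns the children of the removed roots into roots. *)
Definition peel_parent (x : peel_node) : peel_node := insubd x (parent (val x)).

Lemma val_peel_parent x : val (peel_parent x) =
  if is_root (parent (val x)) then val x else parent (val x).
Proof. by rewrite val_insubd; case: ifP => [/negPf ->|/negbFE ->]. Qed.

Lemma peel_heightP x : peel_parent x != x ->
  (height (val (peel_parent x)) < height (val x))%N.
Proof.
rewrite -(inj_eq val_inj) val_peel_parent; case: ifP; rewrite ?eqxx //.
by move=> _ /height_parent.
Qed.

Definition peel : forest := Forest peel_heightP.

Lemma val_parent_peel (x : node peel) : val (parent x) =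
  if is_root (parent (val x)) then val x else parent (val x).
Proof. exact: val_peel_parent. Qed.

Lemma peel_is_root (x : node peel) : is_root x = is_root (parent (val x)).
Proof.
rewrite [LHS]/is_root -(inj_eq val_inj) val_parent_peel.
by case: ifP => // _; rewrite ?eqxx //; apply/negbTE/(valP x).
Qed.

Lemma root_val_peel (x : node peel) : root (val x) = parent (val (root x)).
Proof.
elim/forest_ind: x => x rx => [|IHx].
  by rewrite (root_id rx) -root_parent root_id // -peel_is_root.
by rewrite -(root_parent x) -IHx val_parent_peel -peel_is_root (negPf rx) root_parent.
Qed.

Lemma card_peel : (0 < #|node F|)%N -> (#|node peel| < #|node F|)%N.
Proof.
case/card_gt0P => x _; rewrite card_sub [X in (_ < X)%N](cardD1 (root x)) inE.
rewrite ltnS; apply: subset_leq_card; apply/subsetP => y.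
by rewrite !inE andbT => ny; apply: contraNneq ny => ->; apply: root_is_root.
Qed.

Section PeelMagic.
Variables (C : numClosedFieldType) (A : starAlgType C).
Variable u : node F -> node F -> A.
Hypothesis um : magic_unitary u.
Hypothesis up : preserves2 u (fun x y => parent x == y).

Definition peel_magic_fun (x y : node peel) : A := u (val x) (val y).

Lemma peel_magic : magic_unitary peel_magic_fun.
Proof.
apply: (magic_sub_preserved (k := false) um (preserves_is_root um up)).
- exact: val_inj.
- by move=> x; apply/negbTE/(valP x).
- move=> x /negbT nx; rewrite -[x](@SubK _ _ peel_node x nx); exact: codom_f.
Qed.

Lemma peel_preserves : preserves2 peel_magic_fun (fun x y => parent x == y).
Proof.
apply: fun_preserves2 => [|x y]; first exact: peel_magic.
rewrite /peel_magic_fun !val_parent_peel.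
case: (eqVneq (is_root (parent (val x))) (is_root (parent (val y)))) => [->|n].
  by case: ifP => _; [rewrite (magic_idem um)|apply: preserves_funr].
rewrite (_ : u (val x) (val y) = 0) ?mul0r // (preserves_funr um up).
by rewrite [X in _ * X](preserves_is_root um up) ?mulr0.
Qed.
End PeelMagic.
End Peel.

Section TreeIso.
Variable F : forest.

(** [f] and [g] are total functions, constrained only on the trees at [r] and [s]; [g] commutes with
    [parent] there because it inverts [f]. *)
Definition is_tree_iso (r s : node F) (f g : node F -> node F) : Prop :=
  (forall x, root x = r ->
     [/\ root (f x) = s, g (f x) = x & f (parent x) = parent (f x)]) /\
  (forall y, root y = s -> root (g y) = r /\ f (g y) = y).

Definition tree_iso (r s : node F) : Prop := exists f g, is_tree_iso r s f g.

Lemma tree_iso_refl r : tree_iso r r.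
Proof. by exists id, id. Qed.

Lemma tree_iso_sym r s : tree_iso r s -> tree_iso s r.
Proof.
case=> f [g [fP gP]]; exists g, f; split=> [y ry|x rx]; last first.
  by have [] := fP x rx.
have [rgy fgy] := gP y ry; have [_ _ fp] := fP _ rgy; split=> //.
rewrite -{1}fgy -fp; have [|_ -> //] := fP (parent (g y)).
by rewrite root_parent.
Qed.

Lemma tree_iso_trans r s t : tree_iso r s -> tree_iso s t -> tree_iso r t.
Proof.
case=> f [g [fP gP]] [f' [g' [fP' gP']]]; exists (f' \o f), (g \o g').
split=> [x rx|y ry] /=.
  have [sf gf fp] := fP x rx; have [tf gf' fp'] := fP' _ sf.
  by rewrite gf' fp.
have [sg fg'] := gP' y ry; have [rg fg] := gP _ sg.
by rewrite fg.
Qed.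

Lemma tree_iso_equivalence : equivalence_rel (fun r s => `[< tree_iso r s >]).
Proof.
move=> r s t; split=> [|/asboolP rs]; first exact/asboolP/tree_iso_refl.
apply/asboolP/asboolP => h; first exact: tree_iso_trans (tree_iso_sym rs) h.
exact: tree_iso_trans h.
Qed.

Lemma tree_iso_card r s : tree_iso r s ->
  #|[set x | root x == r]| = #|[set x | root x == s]|.
Proof.
case=> f [g [fP gP]].
rewrite -(card_in_imset (f := f) (D := [set x | root x == r])) => [|x y]; last first.
  rewrite !inE => /eqP/fP[_ gx _] /eqP/fP[_ gy _] e.
  by rewrite -gx e.
apply: eq_card => y; rewrite inE; apply/imsetP/eqP => [[x]|/gP[rg fg]].
  by rewrite inE => /eqP/fP[rf _ _] ->.
by exists (g y); rewrite ?inE ?rg.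
Qed.
End TreeIso.

Section Rigidity.
Variable C : numClosedFieldType.

(** Since [u c d] absorbs [u r (parent d)], the product [u c d * u r s] vanishes unless d is a child
    of s. The row sum of c can therefore be restricted to such d. *)
Lemma children_count (F : forest) (A : starAlgType C) (u : node F -> node F -> A)
    (r s : node F) (P : pred (node F)) (c : node F) :
  magic_unitary u -> preserves2 u (fun x y => parent x == y) ->
  parent c = r -> (forall d, u c d != 0 -> parent d = s -> P d) ->
  \sum_(d | P d) u c d * u r s = u r s.
Proof.
move=> um up cr cP; rewrite -[RHS]mul1r -(magic_row um c) mulr_suml.
rewrite big_rmcond // => d nPd; case: (eqVneq (u c d) 0) => [->|ucd].
  by rewrite mul0r.
rewrite (preserves_funr um up) cr -mulrA (magic_orthr um) ?mulr0 //.
by apply: contra nPd => /eqP/(cP _ ucd).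
Qed.

Lemma magicT (I : finType) (A : starAlgType C) (u : I -> I -> A) :
  magic_unitary u -> magic_unitary (fun x y => u y x).
Proof. by case. Qed.

(* If u r s != 0, then by induction u maps the children of r to children of s
   with isomorphic subtrees; summing the corresponding block of u times u r s over
   its rows and over its columns shows that r and s have equally many children in
   each isomorphism class. *)
Theorem magic_tree_iso (F : forest) (A : starAlgType C)
    (u : node F -> node F -> A) (r s : node F) :
  magic_unitary u -> preserves2 u (fun x y => parent x == y) ->
  is_root r -> is_root s -> u r s != 0 -> tree_iso r s.
Proof.
move: {2}#|node F| (leqnn #|node F|) => n.
elim: n => [|n IHn] in F A u r s * => cF um up rr rs urs.
  by move: cF; rewrite leqn0 => /eqP/card0_eq/(_ r).
have cF' : (#|node (peel F)| <= n)%N.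
  rewrite -ltnS; apply: leq_trans cF; apply: card_peel.
  by apply/card_gt0P; exists r.
pose u' := @peel_magic_fun F C A u.
have um' : magic_unitary u' by apply: peel_magic.
have up' : preserves2 u' (fun x y => parent x == y) by apply: peel_preserves.
(* For a root t these are its children, seen as roots of [peel F], where the induction hypothesis
   applies. *)
pose ch t := [set c : node (peel F) | is_root c && (parent (val c) == t)].
pose E (c d : node (peel F)) := `[< tree_iso c d >].
have chP t (c : node (peel F)) : is_root t -> parent (val c) = t -> c \in ch t.
  by move=> rt ct; rewrite inE peel_is_root ct rt eqxx.
have eqE : equivalence_rel E := @tree_iso_equivalence (peel F).
have uE k c d : c \in ch r -> d \in ch s -> u' c d != 0 -> E k c = E k d.
  rewrite !inE => /andP[rc _] /andP[rd _] ucd.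
  have cd : E c d by apply/asboolP; apply: (IHn _ A u').
  have Es a b : E a b = E b a.
    by apply/asboolP/asboolP; apply: tree_iso_sym.
  by rewrite ![E k _]Es; have [_ ->] := eqE c d k.
have lift_sum (P : pred (node (peel F))) (G : node F -> A) :
    \sum_(d | P d) G (val d) =
    \sum_(x | [exists d, P d && (val d == x)]) G x.
  rewrite (eq_bigl [in val @: P]) => [|x]; last first.
    apply/existsP/imsetP => [[d /andP[Pd /eqP <-]]|[d Pd ->]]; exists d => //.
    by rewrite eqxx andbT.
  by rewrite big_imset //= => a b _ _; apply: val_inj.
have nat_root d (c : node (peel F)) : u (val c) d != 0 -> ~~ is_root d.
  by apply: contra => rd; apply/eqP/(preserves_is_root um up); rewrite rd (negPf (valP c)).
have row k c : c \in ch r -> E k c ->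
    \sum_(d in [set d in ch s | E k d]) u' c d * u r s = u r s.
  move=> cr kc; rewrite (lift_sum _ (fun d => u (val c) d * u r s)).
  apply: children_count => //; first by move: cr; rewrite inE => /andP[_ /eqP].
  move=> d ucd ds; have nd := nat_root _ _ ucd.
  apply/existsP; exists (Sub d nd : node (peel F)).
  rewrite SubK eqxx andbT inE; have dch : (Sub d nd : node (peel F)) \in ch s.
    by apply: chP => //; rewrite SubK.
  by rewrite dch -(uE k c) // /u' /peel_magic_fun SubK.
(* The same count for the transposed matrix, with the roles of [r] and [s] exchanged. *)
have col k d : d \in ch s -> E k d ->
    \sum_(c in [set c in ch r | E k c]) u' c d * u r s = u r s.
  move=> ds kd; rewrite (lift_sum _ (fun c => u c (val d) * u r s)).
  apply: (children_count (u := fun x y => u y x) (s := r) (c := val d)).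
  - exact: magicT.
  - by move=> x y z w ne; apply: up; rewrite eq_sym.
  - by move: ds; rewrite inE => /andP[_ /eqP].
  move=> c ucd cr; have nc : ~~ is_root c.
    by apply: contra ucd => rc; apply/eqP/(preserves_is_root um up);
      rewrite rc (negPf (valP d)).
  apply/existsP; exists (Sub c nc : node (peel F)).
  rewrite SubK eqxx andbT inE; have cch : (Sub c nc : node (peel F)) \in ch r.
    by apply: chP => //; rewrite SubK.
  by rewrite cch (uE k _ d) // /u' /peel_magic_fun SubK.
(* Summing one block by rows and by columns gives [#|X|] and [#|Y|] times the nonzero element
   [u r s]. *)
have cards k : #|[set c in ch r | E k c]| = #|[set d in ch s | E k d]|.
  pose X := [set c in ch r | E k c]; pose Y := [set d in ch s | E k d].
  have XE : \sum_(c in X) \sum_(d in Y) u' c d * u r s = u r s *+ #|X|.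
    rewrite -sumr_const; apply: eq_bigr => c; rewrite inE => /andP[cr kc].
    exact: row.
  have YE : \sum_(c in X) \sum_(d in Y) u' c d * u r s = u r s *+ #|Y|.
    rewrite exchange_big -sumr_const; apply: eq_bigr => d; rewrite inE => /andP[ds kd].
    exact: col.
  apply/eqP; rewrite -(eqr_nat C) -subr_eq0; apply: contraNT urs => nXY.
  rewrite -[u r s]scale1r -(mulVf nXY) -scalerA scalerBl !scaler_nat.
  by rewrite -XE -YE subrr scaler0.
have [sg [ta [sgP taP]]] := class_matching eqE cards.
have /choice[h hP] : forall c, exists h :
    (node (peel F) -> node (peel F)) * (node (peel F) -> node (peel F)),
    c \in ch r -> is_tree_iso c (sg c) h.1 h.2.
  move=> c; case: (boolP (c \in ch r)) => [/sgP[_ _ /asboolP[f [g fg]]]|_].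
    by exists (f, g).
  by exists (id, id).
(* Roots go to [s], which matters only at [r], the sole root of its tree. Any other node follows the
   isomorphism chosen for the child of [r] above it. *)
pose f (x : node F) := if (insub x : option (node (peel F))) is Some x'
  then val ((h (root x')).1 x') else s.
pose g (y : node F) := if (insub y : option (node (peel F))) is Some y'
  then val ((h (ta (root y'))).2 y') else r.
have rootch t (x : node (peel F)) : is_root t -> root (val x) = t -> root x \in ch t.
  by move=> rt xt; apply: chP => //; rewrite -root_val_peel.
have f_root x : is_root x -> f x = s by move=> rx; rewrite /f insubN ?negbK.
have g_root x : is_root x -> g x = r by move=> rx; rewrite /g insubN ?negbK.
have f_val (x : node (peel F)) : f (val x) = val ((h (root x)).1 x).
  by rewrite /f valK.
have g_val (x : node (peel F)) : g (val x) = val ((h (ta (root x))).2 x).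
  by rewrite /g valK.
have valE x : ~~ is_root x -> exists x' : node (peel F), x = val x'.
  by move=> nx; exists (Sub x nx); rewrite SubK.
exists f, g; split=> [x rx|y ry].
  case: (boolP (is_root x)) => [xr|/valE[x' Ex]].
    rewrite (eqP xr) f_root // (eqP rs) g_root // root_id //.
    by rewrite -rx root_id.
  subst x; have cr := rootch _ _ rr rx; have [hf _] := hP _ cr.
  have [sr tr _] := sgP _ cr.
  have [rf gf pf] := hf x' erefl.
  rewrite f_val g_val rf tr gf; split=> //.
    rewrite root_val_peel rf.
    by move: sr; rewrite inE => /andP[_ /eqP].
  case: (boolP (is_root x')) => [xr|nx].
    rewrite f_root -?peel_is_root //; move: sr; rewrite inE => /andP[_ /eqP <-].
    rewrite -rf root_id // /is_root -pf (eqP xr) //.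
  have nf : ~~ is_root ((h (root x')).1 x').
    apply: contra nx; rewrite /is_root -pf => /eqP e.
    by have [|_ <- _] := hf (parent x'); rewrite ?root_parent // e gf.
  have vE (y : node (peel F)) : ~~ is_root y -> parent (val y) = val (parent y).
    by move=> ny; rewrite val_parent_peel -peel_is_root (negPf ny).
  by rewrite !vE // f_val root_parent pf.
case: (boolP (is_root y)) => [yr|/valE[y' Ey]].
  by rewrite g_root // f_root // root_id // -ry root_id.
subst y; have ds := rootch _ _ rs ry; have [tr st] := taP _ ds.
have [_ hg] := hP _ tr; rewrite st in hg.
have [rg fg] := hg y' erefl.
rewrite g_val f_val rg fg; split=> //.
by rewrite root_val_peel rg; move: tr; rewrite inE => /andP[_ /eqP].
Qed.
End Rigidity.

(** * Decomposition of forests *)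

Lemma inj_surj_bij (T U : Type) (f : T -> U) :
  injective f -> (forall y, exists x, f x = y) -> bijective f.
Proof.
move=> f_inj /choice[g gK]; exists g => //.
by move=> x; apply: f_inj; rewrite gK.
Qed.

Section SubForest.
Variables (F : forest) (P : pred (node F)).
Hypothesis Pp : forall x, P (parent x) = P x.

Definition sub_node : finType := {x : node F | P x}.
Definition sub_parent (x : sub_node) : sub_node := insubd x (parent (val x)).

Lemma val_sub_parent x : val (sub_parent x) = parent (val x).
Proof. by rewrite val_insubd Pp (valP x). Qed.

Lemma sub_heightP x : sub_parent x != x ->
  (height (val (sub_parent x)) < height (val x))%N.
Proof. by rewrite -(inj_eq val_inj) val_sub_parent => /height_parent. Qed.

Definition sub_forest : forest := Forest sub_heightP.

Lemma val_parent_sub (x : node sub_forest) : val (parent x) = parent (val x).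
Proof. exact: val_sub_parent. Qed.

Lemma sub_is_root (x : node sub_forest) : is_root x = is_root (val x).
Proof. by rewrite /is_root -(inj_eq val_inj) val_parent_sub. Qed.

Lemma sub_forest_gt0 x : P x -> (0 < #|node sub_forest|)%N.
Proof. by move=> Px; apply/card_gt0P; exists (Sub x Px). Qed.

Lemma card_sub_forest y : ~~ P y -> (#|node sub_forest| < #|node F|)%N.
Proof.
move=> nPy; rewrite card_sub [X in (_ < X)%N](cardD1 y) inE ltnS.
apply: subset_leq_card; apply/subsetP => z; rewrite !inE andbT => Pz.
by apply: contraNneq nPy => <-.
Qed.
End SubForest.

Section ForestDecomposition.
Variable C : numClosedFieldType.

Lemma Qforest_split (F : forest) F0 (P : pred (node F))
    (Pp : forall x, P (parent x) = P x)
    (Pp' : forall x, ~~ P (parent x) = ~~ P x) P0 P0' :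
  (forall (A : starAlgType C) (u : node F -> node F -> A), magic_unitary u ->
    preserves2 u (fun x y => parent x == y) -> preserves1 u P) ->
  qpg_iso (@Qforest C F F0)
    (free_qpg (@Qforest C (sub_forest Pp) P0)
              (@Qforest C (@sub_forest F (fun x => ~~ P x) Pp') P0')).
Proof.
move=> PP; pose S := sum_forest (sub_forest Pp) (sub_forest Pp').
pose f (x : node S) : node F := match x with inl y => val y | inr y => val y end.
have S0 : (0 < #|node S|)%N by apply: sum_forest_gt0.
have fP x : P (f x) = is_left x.
  by case: x => x /=; [exact: (valP x)|exact/negbTE/(valP x)].
have f_inj : injective f.
  move=> x y e; have := fP x; rewrite e fP.
  by case: x y e => x [] y //= /val_inj ->.
have fp x : f (parent x) = parent (f x).
  by case: x => x; [exact: val_sub_parent|exact: val_sub_parent].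
have fs y : exists x, f x = y.
  by case: (boolP (P y)) => Py; [exists (inl (Sub y Py))|exists (inr (Sub y Py))].
have fb := inj_surj_bij f_inj fs; have [g fK gK] := fb.
apply: (qpg_iso_trans (H := Qforest C S0)).
  by apply/qpg_iso_sym/(@Qforest_iso _ _ _ _ _ f).
apply: Qforest_sum => x z.
pose w : node S -> node S -> alg (Qforest C S0) := fund (q := Qforest C S0).
rewrite -/(w x z) -!fP => nxz.
(* The hypothesis concerns matrices indexed by [F], so the fundamental matrix of the sum is
   transported there. *)
pose u a b := w (g a) (g b).
have um : magic_unitary u.
  apply: magic_sub; [exact: (fund_magic (Qforest C S0))|exact: can_inj gK|].
  by move=> a b; rewrite -[a]fK codom_f.
have up : preserves2 u (fun x y => parent x == y).
  move=> a b c d n; apply: (Qforest_preserves C S0).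
  by rewrite -!(inj_eq f_inj) !fp !gK.
have := PP _ u um up _ _ nxz.
by rewrite /u !fK.
Qed.

(** [F] is [peel F] with a new root put on top: [insub] sends [r], the only node that was removed,
    to [None]. *)
Lemma Qforest_peel (F : forest) F0 (r : node F) P0 :
  (forall x, is_root x -> x = r) ->
  qpg_iso (@Qforest C F F0) (@Qforest C (peel F) P0).
Proof.
move=> rP; have r_root : is_root r by rewrite -(rP _ (root_is_root r)) root_is_root.
apply: (qpg_iso_trans (H := Qforest C (add_root_gt0 (peel F)))); last first.
  exact: Qforest_add_root.
pose f (x : node F) : node (add_root (peel F)) := insub x.
apply: (@Qforest_iso C _ _ _ _ f); split.
  exists (fun o => if o is Some x then val x else r) => [x|[x|]] /=.
  - by rewrite /f; case: insubP => [y _ //|]; rewrite negbK => /rP ->.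
  - by rewrite /f valK.
  - by rewrite /f insubN // r_root.
move=> x; rewrite {2}/f; case: insubP => [y nx yx|]; last first.
  by rewrite negbK => rx; rewrite (eqP rx) /f insubN // rx.
rewrite /= peel_is_root -yx; case: ifP => rp; first by rewrite /f insubN ?rp.
by rewrite /f -(valK (peel_parent y)) val_peel_parent rp.
Qed.

Section TreeClass.
Variables (F : forest) (r : node F).
Hypothesis r_root : is_root r.

Definition in_class (x : node F) : bool := `[< tree_iso r (root x) >].

Lemma in_class_parent x : in_class (parent x) = in_class x.
Proof. by rewrite /in_class root_parent. Qed.

(** A nonzero [u x z] forces a nonzero entry at the roots of x and z, whose trees are then
    isomorphic by [magic_tree_iso]. *)
Lemma in_class_preserved (A : starAlgType C) (u : node F -> node F -> A) :
  magic_unitary u -> preserves2 u (fun x y => parent x == y) ->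
  preserves1 u in_class.
Proof.
move=> um up x z; case: (eqVneq (u x z) 0) => // uxz /eqP[].
have urr : u (root x) (root z) != 0.
  apply: contra uxz => /eqP u0.
  by rewrite (preserves_funr um (preserves_root um up)) u0 mulr0.
have xz := magic_tree_iso um up (root_is_root x) (root_is_root z) urr.
by apply/asboolP/asboolP => h; [|move/tree_iso_sym in xz]; exact: tree_iso_trans xz.
Qed.

Definition is_under (x : node F) : bool := root x == r.

Lemma is_under_parent x : is_under (parent x) = is_under x.
Proof. by rewrite /is_under root_parent. Qed.

Definition tree_at : forest := sub_forest is_under_parent.

Lemma tree_at_gt0 : (0 < #|node tree_at|)%N.
Proof. by apply: (sub_forest_gt0 _ (x := r)); rewrite /is_under root_id. Qed.

(** There is one copy per root. An isomorphism chosen from the tree at [r] to each tree identifies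
    [F] with the copies. *)
Lemma Qforest_class F0 : (forall x, in_class x) ->
  exists n (n_gt0 : (0 < n)%N),
  qpg_iso (@Qforest C F F0) (wreath_qpg (Qforest C tree_at_gt0) n_gt0).
Proof.
move=> allP; pose K := [set s : node F | is_root s].
have rK : r \in K by rewrite inE.
have K0 : (0 < #|K|)%N by apply/card_gt0P; exists r.
exists #|K|, K0.
have /choice[h hP] : forall s, exists h : (node F -> node F) * (node F -> node F),
    s \in K -> is_tree_iso r s h.1 h.2.
  move=> s; case: (boolP (s \in K)) => [|_]; last by exists (id, id).
  rewrite inE => rs; have /asboolP := allP s; rewrite root_id // => -[f [g fg]].
  by exists (f, g).
have ru : is_under r by rewrite /is_under root_id.
pose r' : node tree_at := Sub r ru.
have r'P (x : node tree_at) : is_root x -> x = r'.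
  rewrite sub_is_root => rx; apply: val_inj; rewrite SubK.
  by have /eqP := valP x; rewrite root_id.
have M0 := tree_at_gt0; have N0 := copies_gt0 K0 M0.
apply: (qpg_iso_trans (H := Qforest C N0)); last exact: (Qforest_copies _ r'P).
pose f (x : node (copies #|K| tree_at)) : node F := (h (enum_val x.1)).1 (val x.2).
have fP i := hP _ (enum_valP i).
have under (x : node tree_at) : root (val x) = r by apply/eqP/(valP x).
have fr x : root (f x) = enum_val x.1.
  by case: x => i x; have [H _] := fP i; have [] := H _ (under x).
apply/qpg_iso_sym/(@Qforest_iso _ _ _ _ _ f); split.
  apply: inj_surj_bij => [[i x] [j y] e|y].
    have ij : i = j by apply: enum_val_inj; rewrite -(fr (i, x)) e fr.
    subst j; congr (_, _); apply: val_inj; have [H _] := fP i.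
    have [_ <- _] := H _ (under x); have [_ <- _] := H _ (under y).
    by move: e; rewrite /f /= => ->.
  have yK : root y \in K by rewrite inE root_is_root.
  pose i := enum_rank_in yK (root y).
  have iy : enum_val i = root y by rewrite enum_rankK_in.
  have [_ H] := fP i; have [rg fg] := H y (esym iy).
  have gu : is_under ((h (enum_val i)).2 y) by rewrite /is_under rg.
  by exists (i, Sub _ gu); rewrite /f SubK.
case=> i x; rewrite /f /= (val_sub_parent is_under_parent); have [H _] := fP i.
by have [_ _ ->] := H _ (under x).
Qed.
End TreeClass.

Theorem Qforest_family (I : qpg C -> Prop) (F : forest) F0 :
  iso_invariant I -> free_wreath_closed I -> I (@Qforest C F F0).
Proof.
move=> Ii [I1 If Iw]; move: {2}#|node F| (leqnn #|node F|) => n.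
elim: n => [|n IHn] in F F0 * => cF; first by have := F0; rewrite ltnNge cF.
have /card_gt0P[x0 _] := F0; pose r := root x0.
have rr : is_root r by apply: root_is_root.
have sub_lt m : (m < #|node F|)%N -> (m <= n)%N.
  by move=> mF; rewrite -ltnS; apply: leq_trans cF.
case: (pselect (forall x : node F, is_root x -> x = r)) => [rP|].
  (* A forest reduced to its root is treated apart, as [Qforest] requires a node. *)
  case: (posnP #|node (peel F)|) => [P0|P0].
    apply: (Ii (trivial_qpg C)) => //; apply/qpg_iso_sym/Qrel_trivial.
    have all_r x : x = r.
      case: (boolP (is_root x)) => [/rP//|nx].
      by have := card0_eq P0 (Sub x nx); rewrite inE.
    by move=> x z; rewrite (all_r x) (all_r z) eqxx.
  apply: (Ii (Qforest C P0)); last by apply: IHn; apply/sub_lt/card_peel.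
  by apply/qpg_iso_sym/(Qforest_peel _ _ rP).
move/existsNP => [s /not_implyP[rs nsr]].
(* Either all trees are isomorphic, and the second root [s] shows that one tree is smaller than [F],
   or the class of [r] and its complement are both smaller. *)
case: (pselect (forall x, in_class r x)) => [allP|/existsNP[y /negP ny]].
  have [m [m0 mi]] := Qforest_class rr F0 allP.
  apply: (Ii _ _ (qpg_iso_sym mi)); apply: Iw; apply: IHn.
  apply: sub_lt; apply: (card_sub_forest _ (y := s)).
  by rewrite /is_under root_id //; apply/eqP.
have Pp := @in_class_parent F r.
have Pp' x : ~~ in_class r (parent x) = ~~ in_class r x by rewrite Pp.
have r_in : in_class r r by apply/asboolP; rewrite root_id //; apply: tree_iso_refl.
have P0 := sub_forest_gt0 Pp r_in.
have P0' := sub_forest_gt0 (P := fun x => ~~ in_class r x) Pp' ny.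
have split_iso := Qforest_split F0 P0 P0' (@in_class_preserved F r).
apply: (Ii _ _ (qpg_iso_sym split_iso)); apply: If; apply: IHn; apply: sub_lt.
  exact: (card_sub_forest _ ny).
by apply: (card_sub_forest _ (y := r)); rewrite negbK.
Qed.
End ForestDecomposition.

(** * From trees to forests: pruning leaves *)

Section Pruning.
Variable T : sgraph.
Local Notation V := (vert T).
Local Notation e := (@edge T).

Definition nbr (S : {set V}) (x : V) : {set V} := [set y in S | e x y].

(** Otherwise a path in [S] could always be prolonged at its first vertex, without repetition for
    lack of cycles, and would outgrow the vertex set. *)
Lemma acyclic_leaf (S : {set V}) :
  (forall c : seq V, (2 < size c)%N -> ~ ucycle e c) ->
  S != set0 -> exists2 x, x \in S & (#|nbr S x| <= 1)%N.
Proof.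
move=> acyc /set0Pn[x0 x0S].
case: (pselect (exists2 x, x \in S & (#|nbr S x| <= 1)%N)) => // H; exfalso.
have deg x : x \in S -> (1 < #|nbr S x|)%N.
  by move=> xS; rewrite ltnNge; apply/negP => dx; apply: H; exists x.
have step n : exists x p,
    [/\ uniq (x :: p), path e x p, {subset x :: p <= S} & size p = n].
  elim: n => [|n [x [p [up pp pS sp]]]].
    by exists x0, [::]; split=> // y; rewrite inE => /eqP ->.
  have xS : x \in S by apply: pS; rewrite mem_head.
  (* [head x p] is the vertex next to x on the path; for an empty path it is x itself, which is not
     its own neighbour. *)
  have /card_gt0P[z] : (0 < #|nbr S x :\ head x p|)%N.
    have := deg x xS; rewrite (cardsD1 (head x p)).
    by case: (_ \in nbr S x) => // /ltnW.
  rewrite !inE => /and3P[zh zS xz].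
  have nzx : z != x by apply: contraTneq xz => ->; rewrite edge_irrefl.
  case: (boolP (z \in p)) => [zp|nzp].
    case/splitPr: zp up pp zh {pS sp} => p1 p2.
    rewrite -cat_rcons -cat_cons cat_uniq cat_path => /andP[up _] /andP[pp _] zh.
    (* If z is on the path, the segment from x to z closes up; it has at least three vertices
       because z is not next to x. *)
    exfalso; apply: (acyc (x :: rcons p1 z)).
      by case: p1 zh {up pp} => [|y p1] /=; rewrite ?eqxx // size_rcons.
    rewrite /ucycle up andbT /= rcons_path pp last_rcons.
    by rewrite (edge_sym z x) xz.
  exists z, (x :: p); split=> /=.
  - by rewrite inE negb_or nzx nzp.
  - by rewrite (edge_sym z x) xz.
  - by move=> y; rewrite inE => /predU1P[->|/pS].
  - by rewrite sp.
have [x [p [up _ _ sp]]] := step #|V|.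
by have := max_card [in x :: p]; rewrite (card_uniqP up) /= sp ltnn.
Qed.

Fixpoint core (i : nat) : {set V} :=
  if i is j.+1 then [set x in core j | (1 < #|nbr (core j) x|)%N] else setT.

Lemma core_subset i j : (i <= j)%N -> core j \subset core i.
Proof.
elim: j => [|j IHj]; first by rewrite leqn0 => /eqP ->.
rewrite leq_eqVlt => /predU1P[-> //|/IHj]; apply: subset_trans.
by apply/subsetP => x; rewrite inE => /andP[].
Qed.

Lemma core_nbr i x y z : x \in core i -> x \notin core i.+1 ->
  y \in core i -> e x y -> z \in core i -> e x z -> y = z.
Proof.
rewrite [core i.+1]/= inE => -> /=; rewrite -leqNgt => /card_le1_eqP H.
by move=> yc xy zc xz; apply: H; rewrite inE ?yc ?zc.
Qed.

Definition connected_in (S : {set V}) : Prop := forall x y, x \in S -> y \in S ->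
  exists p, [/\ path e x p, last x p = y, uniq (x :: p) & {subset p <= S}].

(** A path without repetition in [core i] stays in [core i.+1] when its ends do, since an inner
    vertex has two distinct neighbours on it. *)
Lemma core_connected i : (forall x y, connect e x y) -> connected_in (core i).
Proof.
move=> conn; elim: i => [|i IHi] x y xc yc.
  have /connectP[p pp ->] := conn x y; case/shortenP: pp => q qp uq _.
  by exists q; split=> // z _; rewrite inE.
have sub : core i.+1 \subset core i by apply: core_subset.
have [p [pp py up pc]] := IHi x y (subsetP sub _ xc) (subsetP sub _ yc).
exists p; split=> // z zp; move: (zp) pc pp py up.
case/splitPr => p1 p2 pc; rewrite cat_path last_cat /= => /and3P[_ lz].
have xc' : x \in core i by apply: (subsetP sub).
have lc : last x p1 \in core i.
  case/lastP: p1 pc {lz} => // p1 t pc; rewrite last_rcons; apply: pc.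
  by rewrite mem_cat mem_rcons mem_head.
case: p2 pc => [|w p2] pc; first by move=> /= _ -> _.
case/andP=> zw _ _ up; rewrite inE pc ?mem_cat ?mem_head ?orbT //=.
have wc : w \in core i by apply: pc; rewrite mem_cat !inE eqxx !orbT.
have nlw : last x p1 != w.
  move: up; rewrite -[_ && _]/(uniq ((x :: p1) ++ z :: w :: p2)) cat_uniq.
  case/and3P => _ /hasPn up _.
  have := up w; rewrite !inE eqxx orbT => /(_ isT).
  by apply: contraNneq => <-; apply: mem_last.
rewrite (cardsD1 (last x p1)) (cardsD1 w) !inE lc wc edge_sym lz zw.
by rewrite (eq_sym w) nlw.
Qed.

Hypothesis treeT : is_tree T.

Lemma core_eventually x : exists i, x \notin core i.
Proof.
have cP i : (#|core i| <= #|V| - i)%N.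
  elim: i => [|i IHi]; first by rewrite subn0 max_card.
  case: (eqVneq (core i) set0) => [c0|cn].
    have /subset_leq_card := core_subset (leqnSn i).
    by rewrite c0 cards0 leqn0 => /eqP ->.
  have [y yc dy] := acyclic_leaf (proj2 treeT) cn.
  rewrite subnS -ltnS; apply: leq_trans (_ : #|core i| <= _)%N; last first.
    by apply: leq_trans IHi _; apply: leqSpred.
  rewrite (cardsD1 y (core i)) yc ltnS; apply: subset_leq_card.
  apply/subsetP => z; rewrite !inE => /andP[zc dz]; rewrite zc andbT.
  by apply: contraTneq dz => ->; rewrite -leqNgt.
by exists #|V|; have := cP #|V|; rewrite subnn leqn0 cards_eq0 => /eqP ->; rewrite inE.
Qed.

Definition level (x : V) : nat := ex_minn (core_eventually x).

Lemma coreE x i : (x \in core i) = (i < level x)%N.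
Proof.
rewrite /level; case: ex_minnP => n xn nmin; rewrite ltnNge.
case: (leqP n i) => ni.
  by apply: contraNF xn; apply: (subsetP (core_subset ni)).
by apply: contraTT ni => /nmin; rewrite -leqNgt.
Qed.

Lemma level_gt0 x : (0 < level x)%N.
Proof. by rewrite -coreE inE. Qed.

Definition climbs (x y : V) : bool := e x y && (level x < level y)%N.

(** x is removed from the last core containing it because it has at most one neighbour there, and y
    and z both lie in that core. *)
Lemma level_nbr x y z : e x y -> e x z ->
  (level x <= level y)%N -> (level x <= level z)%N -> y = z.
Proof.
have lx := prednK (level_gt0 x); move=> xy xz ly lz.
by apply: (core_nbr (i := (level x).-1) (x := x)) => //; rewrite coreE lx ?ltnn.
Qed.

(** By [level_nbr] the choice is unique, and the default value makes a root of every vertex that has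
    no neighbour of higher level. *)
Definition prune_parent (x : V) : V := odflt x [pick y | climbs x y].

Lemma prune_parentE x y : (prune_parent x == y) =
  climbs x y || (x == y) && ~~ [exists z, climbs x z].
Proof.
rewrite /prune_parent; case: pickP => [z xz|nx] /=; last first.
  by rewrite nx /= (_ : [exists z, climbs x z] = false) ?andbT //; apply/existsP => -[z]; rewrite nx.
have -> : [exists z, climbs x z] by apply/existsP; exists z.
rewrite andbF orbF; apply/eqP/idP => [<- //|xy].
have [/andP[xz1 /ltnW xz2] /andP[xy1 /ltnW xy2]] := (xz, xy).
exact: level_nbr xz1 xy1 xz2 xy2.
Qed.

Definition prune_height (x : V) : nat := (\max_y level y - level x)%N.

Lemma prune_heightP x : prune_parent x != x ->
  (prune_height (prune_parent x) < prune_height x)%N.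
Proof.
have := prune_parentE x (prune_parent x); rewrite eqxx => /esym/orP[/andP[_ lx] _|].
  by apply: ltn_sub2l => //; apply: leq_trans lx _; apply: leq_bigmax.
by rewrite eq_sym => /andP[-> _].
Qed.

Definition prune : forest := Forest prune_heightP.

Lemma prune_is_root (x : node prune) : is_root x = ~~ [exists z, climbs x z].
Proof.
by rewrite /is_root /= prune_parentE eqxx /climbs ltnn andbF.
Qed.

(* The core in which a root x is a leaf is connected; the neighbour of x there is
   a leaf as well, so that this core is an edge (or x alone). *)
Lemma prune_roots (x y : node prune) : is_root x -> is_root y -> x != y -> e x y.
Proof.
wlog lxy : x y / (level x <= level y)%N => [H rx ry nxy|].
  case/orP: (leq_total (level x) (level y)) => l; first exact: H.
  by rewrite edge_sym; apply: H => //; rewrite eq_sym.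
rewrite prune_is_root => nx _ nxy.
have lx := prednK (level_gt0 x).
have xc : x \in core (level x).-1 by rewrite coreE lx.
have yc : y \in core (level x).-1 by rewrite coreE lx.
have [[|z p] [pp py upp pc]] := core_connected (proj1 treeT) xc yc.
  by rewrite /= in py; rewrite py eqxx in nxy.
have [xz zp] := andP pp; have zc : z \in core (level x).-1 by apply: pc; rewrite mem_head.
case: p pp py upp pc zp => [|w p] pp py upp pc zp; first by rewrite /= in py; rewrite -py.
have /andP[zw _] := zp; have wc : w \in core (level x).-1 by apply: pc; rewrite !inE eqxx orbT.
have xw : x = w.
  apply: (core_nbr zc) => //; last by rewrite edge_sym.
  rewrite coreE lx -leqNgt; apply: contraNT nx; rewrite -ltnNge => lxz.
  by apply/existsP; exists z; rewrite /climbs xz.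
by move: upp; rewrite xw /= !inE eqxx orbT.
Qed.

(** Adjacent vertices of different levels are child and parent. With equal levels, each is the only
    neighbour of the other at that level or above, so both are roots. *)
Lemma edge_prune (x y : node prune) :
  e x y = (x != y) && [|| parent x == y, parent y == x | is_root x && is_root y].
Proof.
apply/idP/andP => [xy|[nxy]]; last first.
  rewrite /= !prune_parentE [y == x]eq_sym (negPf nxy) /= !orbF.
  have := prune_roots (x := x) (y := y).
  case: (is_root x) (is_root y) => [] [] /= H; rewrite ?orbF ?orbT.
  - by move=> _; apply: H.
  - by case/orP => /andP[]; rewrite 1?edge_sym.
  - by case/orP => /andP[]; rewrite 1?edge_sym.
  - by case/orP => /andP[]; rewrite 1?edge_sym.
split; first by apply: contraTneq xy => ->; rewrite edge_irrefl.
have yx : e y x by rewrite edge_sym.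
rewrite /= !prune_parentE /climbs xy yx /=.
case: (ltngtP (level x) (level y)) => lxy //; rewrite ?orbT //.
apply/orP; right; apply/orP; right; rewrite !prune_is_root.
apply/andP; split; apply/existsPn => z; apply/negP => /andP[ez lz].
  have E : y = z by apply: (level_nbr xy) => //; rewrite ?lxy // ltnW // -lxy.
  by move: lz; rewrite -E lxy ltnn.
have E : x = z by apply: (level_nbr yx) => //; rewrite ?lxy // ltnW // lxy.
by move: lz; rewrite -E lxy ltnn.
Qed.

Section Magic.
Variables (C : numClosedFieldType) (A : starAlgType C) (u : V -> V -> A).
Hypothesis um : magic_unitary u.

Lemma core_preserved i : preserves2 u e -> preserves1 u (fun x => x \in core i).
Proof.
move=> eP; elim: i => [|i IHi] /=; first by move=> x z; rewrite !inE eqxx.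
have dP : preserves1 u (fun x => #|nbr (core i) x|).
  apply: (preserves1_card um (e := fun x y => (y \in core i) && e x y)).
  exact: (preserves2_comp2 (g := andb)) (preserves12r IHi) eP.
move=> x z; rewrite !inE => n.
exact: (preserves1_comp2 (g := fun b d => b && (1 < d)%N) IHi dP n).
Qed.

Lemma level_preserved : preserves2 u e -> preserves1 u level.
Proof.
move=> eP x z; rewrite neq_ltn => /orP[] l.
  by apply: (core_preserved (i := level x) eP); rewrite !coreE l ltnn.
by apply: (core_preserved (i := level z) eP); rewrite !coreE l ltnn.
Qed.

Lemma prune_preserves : preserves2 u e <-> preserves2 u (@forest_rel prune).
Proof.
split=> [eP|pP].
  have lP := level_preserved eP.
  have uP : preserves2 u climbs.
    apply: (preserves2_comp2 (g := andb) eP).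
    exact: (preserves2_comp2 (g := ltn)) (preserves12l lP) (preserves12r lP).
  have xP := preserves1_exists um uP.
  have H := preserves2_comp2 (g := fun b c => b && ~~ c) (preserves2_eq um) (preserves12l xP).
  move=> x y z w n; apply: (preserves2_comp2 (g := orb) uP H).
  by move: n; rewrite /forest_rel /= !prune_parentE.
have rP := preserves_is_root (F := prune) um pP.
have sP := preserves2_sym um pP.
have rrP := preserves2_comp2 (g := andb) (preserves12l rP) (preserves12r rP).
have oP := preserves2_comp2 (g := orb) pP (preserves2_comp2 (g := orb) sP rrP).
have H := preserves2_comp2 (g := fun b c => ~~ b && c) (preserves2_eq um) oP.
by move=> x y z w n; apply: H; move: n; rewrite !edge_prune.
Qed.
End Magic.

Lemma Qu_prune (C : numClosedFieldType) :
  qpg_iso (Qu C T) (@Qforest C prune (vert_gt0 T)).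
Proof.
apply: (qpg_iso_trans (Qu_Qrel C T)).
apply: (Qrel_iso _ _ (f := id)) => [|A u um]; first by exists id.
exact: prune_preserves.
Qed.
End Pruning.

(** * From forests to trees *)

Section TreeOfForest.
Variables (F : forest) (r : node F).
Hypothesis rP : forall x : node F, is_root x -> x = r.

Lemma unique_root : is_root r.
Proof. by rewrite -(rP (root_is_root r)) root_is_root. Qed.

Definition tree_edge : rel (node F) :=
  fun x y => (x != y) && ((parent x == y) || (parent y == x)).

Lemma tree_edge_sym : symmetric tree_edge.
Proof. by move=> x y; rewrite /tree_edge eq_sym orbC. Qed.

Lemma tree_edge_irrefl : irreflexive tree_edge.
Proof. by move=> x; rewrite /tree_edge eqxx. Qed.

Lemma tree_vert_gt0 : (0 < #|node F|)%N.
Proof. by apply/card_gt0P; exists r. Qed.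

Definition tree_of : sgraph := SGraph tree_edge_sym tree_edge_irrefl tree_vert_gt0.

Lemma parent_edge x : x != r -> tree_edge x (parent x).
Proof.
move=> nx; rewrite /tree_edge eqxx orTb andbT eq_sym.
by apply: contra nx => px; apply/eqP; apply: rP.
Qed.

(** On a cycle, both neighbours of a node of maximal height would have to be its parent.
    Connectedness follows by climbing to the root. *)
Lemma tree_of_is_tree : is_tree tree_of.
Proof.
split=> [x y|c sc uc].
  have toroot z : connect tree_edge z r.
    elim/forest_ind: z => z rz; first by rewrite (rP rz) connect0.
    apply: connect_trans; apply: connect1; apply: parent_edge.
    by apply: contraNneq rz => ->; apply: unique_root.
  apply: (connect_trans (toroot x)).
  by rewrite (sym_connect_sym tree_edge_sym) toroot.
have [x xc xmax] : exists2 x, x \in c & forall y, y \in c -> (height y <= height x)%N.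
  case: c sc {uc} => // x0 c _.
  case: (@arg_maxnP _ x0 [in x0 :: c] (@height F)) => [|x xc xm].
    exact: mem_head.
  by exists x.
have edge_max y : y \in c -> tree_edge x y -> y = parent x.
  move=> /xmax yx /andP[nxy /orP[/eqP ->//|/eqP px]].
  by have := @height_parent F y; rewrite px nxy ltnNge yx => /(_ isT).
case/rot_to: xc => i s cs.
have memc y : y \in x :: s -> y \in c by rewrite -cs mem_rot.
have := uc; rewrite -(rot_ucycle i) cs /ucycle /=.
have : (1 < size s)%N by rewrite -ltnS -[(size s).+1]/(size (x :: s)) -cs size_rot.
case: s memc {cs} => // y s memc; rewrite /= ltnS.
case/lastP: s memc => // s z memc _; rewrite rcons_path last_rcons.
case/andP=> /and3P[xy _ zx] /and3P[_ ny _].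
have yE : y = parent x by apply: edge_max => //; apply: memc; rewrite !inE eqxx orbT.
have zE : z = parent x.
  apply: edge_max; last by rewrite -[tree_edge x z]tree_edge_sym.
  by apply: memc; rewrite !inE mem_rcons mem_head !orbT.
by move: ny; rewrite yE zE mem_rcons mem_head.
Qed.

Lemma reaches_root x : exists n, iter n (@parent F) x == r.
Proof. by exists (\max_(y : node F) height y)%N; apply/eqP/rP/root_is_root. Qed.

(** Unlike [height], this is determined by the tree, so it can be preserved. *)
Definition root_dist x := ex_minn (reaches_root x).

Lemma root_distE x n : (root_dist x <= n)%N = (iter n (@parent F) x == r).
Proof.
rewrite /root_dist; case: ex_minnP => m /eqP xm mmin; apply/idP/idP => [mn|/mmin//].
rewrite -(subnK mn) iterD xm; elim: (n - m)%N => //= k /eqP ->.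
exact: unique_root.
Qed.

Lemma root_dist0 x : (root_dist x == 0) = (x == r).
Proof. by rewrite -leqn0 root_distE. Qed.

Lemma root_dist_parent x : x != r -> (root_dist (parent x) < root_dist x)%N.
Proof.
rewrite -root_dist0 -lt0n => l0; rewrite -(prednK l0) ltnS root_distE -iterSr prednK //.
by rewrite -root_distE.
Qed.

(** Balls around the root are defined from edges alone, which gives the induction step of
    [root_dist_preserved]; the base case recognises the root by its degree. *)
Lemma root_distS x n : (root_dist x <= n.+1)%N =
  (root_dist x <= n)%N || [exists y, tree_edge x y && (root_dist y <= n)%N].
Proof.
apply/idP/orP => [|[/leqW //|/existsP[y /andP[/andP[_ /orP[/eqP <-|/eqP yx]] yn]]]].
- case: (eqVneq x r) => [->|nx] xn; first by left;
  have /eqP -> : root_dist r == 0 by rewrite root_dist0.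
  right; apply/existsP; exists (parent x); rewrite parent_edge //=.
  by rewrite -ltnS (leq_trans (root_dist_parent nx)).
- by move: yn; rewrite !root_distE iterSr.
move: yn; rewrite !root_distE -yx -!iterSr !iterS => /eqP ->.
by rewrite !(eqP unique_root).
Qed.

Lemma parent_levelE x y : (parent x == y) =
  (tree_edge x y && (root_dist y < root_dist x)%N) || ((x == y) && (x == r)).
Proof.
apply/idP/orP => [/eqP <-|[/andP[/andP[nxy /orP[//|/eqP yx]] lyx]|]].
- case: (eqVneq x r) => [->|nx]; last by left; rewrite parent_edge ?root_dist_parent.
  by right; rewrite (eqP unique_root) eqxx.
- have nyr : y != r.
    apply: contra nxy => /eqP yr; rewrite -yx yr.
    exact: unique_root.
  by have := root_dist_parent nyr; rewrite yx ltnNge ltnW.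
by case/andP => /eqP <- /eqP ->; apply: unique_root.
Qed.

Hypothesis r_degree : forall x, x != r ->
  #|[set y | tree_edge x y]| != #|[set y | tree_edge r y]|.

Section Magic.
Variables (C : numClosedFieldType) (A : starAlgType C) (u : node F -> node F -> A).
Hypothesis um : magic_unitary u.

Lemma root_dist_preserved : preserves2 u tree_edge -> preserves1 u root_dist.
Proof.
move=> eP; have lP n : preserves1 u (fun x => (root_dist x <= n)%N).
  elim: n => [|n IHn].
    have := preserves1_comp (g := eq_op #|[set y | tree_edge r y]|) (preserves1_card um eP).
    have E x : (root_dist x <= 0)%N = (#|[set y | tree_edge r y]| == #|[set y | tree_edge x y]|).
      rewrite leqn0 root_dist0; apply/eqP/eqP => [->//|e].
      by apply: contra_eq e => /r_degree; rewrite eq_sym.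
    by move=> H x z n; apply: H; rewrite /= -!E.
  have := preserves2_comp2 (g := andb) eP (preserves12r IHn).
  move=> /(preserves1_exists um)/(preserves1_comp2 (g := orb) IHn) H x z n1.
  by apply: H; rewrite -!root_distS.
move=> x z; rewrite neq_ltn => /orP[] l.
  by apply: (lP (root_dist x)); rewrite leqnn leqNgt l.
by apply: (lP (root_dist z)); rewrite leqnn leqNgt l.
Qed.

Lemma tree_of_preserves : preserves2 u tree_edge <-> preserves2 u (@forest_rel F).
Proof.
split=> [eP|pP]; last first.
  have sP := preserves2_sym um pP.
  have oP := preserves2_comp2 (g := orb) pP sP.
  exact: (preserves2_comp2 (g := fun b c => ~~ b && c) (preserves2_eq um) oP).
have lP := root_dist_preserved eP.
have llP := preserves2_comp2 (g := fun m n => (n < m)%N) (preserves12l lP) (preserves12r lP).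
have elP := preserves2_comp2 (g := andb) eP llP.
have rP1 : preserves1 u (fun x => x == r).
  by move=> x z n; apply: (preserves1_comp (g := eq_op^~ 0%N) lP); rewrite /= !root_dist0.
have rrP := preserves2_comp2 (g := andb) (preserves2_eq um) (preserves12l rP1).
move=> x y z w n; apply: (preserves2_comp2 (g := orb) elP rrP).
by rewrite -!parent_levelE.
Qed.
End Magic.

Lemma Qu_tree_of (C : numClosedFieldType) F0 :
  qpg_iso (Qu C tree_of) (@Qforest C F F0).
Proof.
apply: (qpg_iso_trans (Qu_Qrel C tree_of)).
apply: (Qrel_iso _ _ (f := id)) => [|A u um]; first by exists id.
exact: tree_of_preserves.
Qed.
End TreeOfForest.

(** * Realizing every forest by a tree *)

Section Realization.
Variable C : numClosedFieldType.

Lemma is_left_root (F G : forest) (x : node (sum_forest F G)) :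
  is_left (root x) = is_left x.
Proof. by rewrite /root; elim: (\max_y _)%N => //= n <-; case: (iter _ _ _). Qed.

(* Every tree of F is smaller than the tree G, hence not isomorphic to it. *)
Lemma Qforest_sum_larger (F G : forest) F0 G0 S0 (g : node G) :
  (forall x : node G, is_root x -> x = g) -> (#|node F| < #|node G|)%N ->
  qpg_iso (@Qforest C (sum_forest F G) S0)
          (free_qpg (@Qforest C F F0) (@Qforest C G G0)).
Proof.
move=> gP FG; apply: Qforest_sum => x z.
pose S := sum_forest F G; pose Q := Qforest C S0.
pose w : node S -> node S -> alg Q := fund (q := Q).
have wm : magic_unitary w by apply: (fund_magic Q).
have wp : preserves2 w (fun x y => parent x == y) by apply: (Qforest_preserves C S0).
rewrite -/(w x z) => nxz; apply/eqP; apply: contraT => wxz; exfalso.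
have wr : w (root x) (root z) != 0.
  apply: contra wxz => /eqP w0.
  by rewrite (preserves_funr wm (preserves_root wm wp)) w0 mulr0.
have := tree_iso_card (magic_tree_iso wm wp (root_is_root x) (root_is_root z) wr).
have lt a b : is_left a -> ~~ is_left b ->
    (#|[set y : node S | root y == root a]| < #|[set y : node S | root y == root b]|)%N.
  move=> la lb; apply: leq_trans (_ : #|node G| <= _)%N.
    rewrite -ltnS ltnS; apply: leq_ltn_trans FG.
    rewrite -cardsT -(card_imset _ (@inl_inj (node F) (node G))).
    apply: subset_leq_card; apply/subsetP => y; rewrite inE => /eqP ya.
    have : is_left y by rewrite -is_left_root ya is_left_root.
    by case: y {ya} => // y _; apply: imset_f; rewrite inE.
  rewrite -cardsT -(card_imset _ (@inr_inj (node F) (node G))).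
  apply: subset_leq_card; apply/subsetP => _ /imsetP[y _ ->]; rewrite inE.
  have rootr c : ~~ is_left c -> root c = inr g.
    rewrite -is_left_root; have := root_is_root c.
    by case: (root c) => // t; rewrite sum_is_root => /gP ->.
  by rewrite !rootr.
case lx : (is_left x) nxz; case lz : (is_left z) => // _ E.
  by have := lt x z lx; rewrite lz E ltnn => /(_ isT).
by have := lt z x lz; rewrite lx E ltnn => /(_ isT).
Qed.

(** New roots stacked on top enlarge the forest, leave a single root and do not change the quantum
    group. *)
Lemma larger_forest n (F : forest) F0 : exists (G : forest) G0 (g : node G),
  [/\ forall x : node G, is_root x -> x = g, (n < #|node G|)%N &
      qpg_iso (@Qforest C G G0) (@Qforest C F F0)].
Proof.
have rootN (G : forest) (x : node (add_root G)) : is_root x -> x = None.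
  by rewrite add_root_is_root => /eqP.
elim: n => [|n [G [G0 [g [gP nG GF]]]]].
  exists (add_root F), (add_root_gt0 F), None; split; first exact: rootN.
    by rewrite card_option.
  exact: Qforest_add_root.
exists (add_root G), (add_root_gt0 G), None; split; first exact: rootN.
  by rewrite card_option ltnS.
exact: qpg_iso_trans (Qforest_add_root _ _ _) GF.
Qed.

Definition children (F : forest) (x : node F) : {set node F} := [set y | parent y == x].

Lemma path_children n (x : node (path_forest n)) : (#|children x| <= 2)%N.
Proof.
(* The root 0 is its own child. At the last node [inord] takes its default value, harmless for an
   upper bound. *)
apply: leq_trans (_ : #|[set x; inord x.+1 : 'I_n.+1]| <= 2)%N; last first.
  by rewrite cards2; case: (_ == _).
apply: subset_leq_card; apply/subsetP => y; rewrite !inE => /eqP <- /=.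
case: y => [[|y] yn] /=; first by rewrite -val_eqE /= inordK.
apply/orP; right; rewrite -val_eqE /= !inordK ?eqxx //; exact: ltnW.
Qed.

Lemma sum_children (F G : forest) (x : node (sum_forest F G)) :
  #|children x| = match x with inl y => #|children y| | inr y => #|children y| end.
Proof.
case: x => x.
  rewrite -[RHS](card_imset _ (@inl_inj (node F) (node G))).
  apply: eq_card => y; rewrite inE; apply/idP/imsetP => [|[z zx ->]].
    by case: y => // y yx; exists y; rewrite ?inE.
  by move: zx; rewrite inE => /eqP zx; rewrite /= zx.
rewrite -[RHS](card_imset _ (@inr_inj (node F) (node G))).
apply: eq_card => y; rewrite inE; apply/idP/imsetP => [|[z zx ->]].
  by case: y => // y yx; exists y; rewrite ?inE.
by move: zx; rewrite inE => /eqP zx; rewrite /= zx.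
Qed.

(* Each step adds a path with one node more than the forest has: a root, no new
   branching, and no quantum symmetry. *)
Lemma many_roots n d (F : forest) F0 : (1 < d)%N ->
  (forall x : node F, #|children x| <= d)%N ->
  exists (G : forest) G0,
  [/\ forall x : node G, (#|children x| <= d)%N,
      (n <= #|[set x : node G | is_root x]|)%N &
      qpg_iso (@Qforest C G G0) (@Qforest C F F0)].
Proof.
move=> d1 Fd; elim: n => [|n [G [G0 [Gd nG GF]]]].
  by exists F, F0; split=> //; apply: qpg_iso_refl.
pose P := path_forest #|node G|; have P0 : (0 < #|node P|)%N by rewrite card_ord.
have S0 : (0 < #|node (sum_forest G P)|)%N by apply: sum_forest_gt0.
exists (sum_forest G P), S0; split.
- by case=> x; rewrite sum_children //; apply: leq_trans (path_children x) d1.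
- have e : [set x : node (sum_forest G P) | is_root x] =
    inl @: [set x : node G | is_root x] :|: [set inr (ord0 : node P)].
    apply/setP => -[x|x]; rewrite !inE sum_is_root.
      rewrite orbF; apply/idP/imsetP => [rx|[y yr [->]]].
        by exists x; rewrite ?inE.
      by rewrite inE in yr.
    rewrite path_root; apply/idP/orP => [/eqP ->|[/imsetP[]//|/eqP[->]//]].
    by right.
  rewrite e cardsU (card_imset _ (@inl_inj _ _)) cards1 disjoint_setI0 ?cards0 ?subn0 ?addn1 //.
  by rewrite disjoint_sym disjoints1; apply/imsetP => -[].
apply: qpg_iso_trans GF; apply: (qpg_iso_trans (H := free_qpg (Qforest C G0) (Qforest C P0))).
  apply: (@Qforest_sum_larger _ _ _ _ _ (ord0 : node P)) => [x|].
    by rewrite path_root => /eqP.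
  by rewrite card_ord.
apply: qpg_iso_trans (free_trivial_iso _); apply: free_qpg_iso; first exact: qpg_iso_refl.
exact: Qforest_path.
Qed.

Theorem Qforest_tree (F : forest) F0 :
  exists2 T, is_tree T & qpg_iso (Qu C T) (@Qforest C F F0).
Proof.
(* The added 2 gives [1 < d], as the paths of [many_roots] require. With [d.+2] roots below it, the
   new root has larger degree than the other nodes, which have at most d children and one parent. *)
pose d := (\max_(x : node F) #|children x|).+2.
have [||G [G0 [Gd nG GF]]] := @many_roots d.+2 d F F0 => //.
  by move=> x; rewrite ltnW // ltnW // ltnS; apply: (leq_bigmax x).
have rN (x : node (add_root G)) : is_root x -> x = None.
  by rewrite add_root_is_root => /eqP.
exists (tree_of (None : node (add_root G))); first exact: tree_of_is_tree rN.
apply: qpg_iso_trans (qpg_iso_trans (Qforest_add_root _ G0 (add_root_gt0 G)) GF).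
apply: (Qu_tree_of rN) => -[x|//] _; rewrite neq_ltn; apply/orP; left.
apply: (leq_trans (n := d.+2)).
  rewrite ltnS; apply: leq_trans (_ : #|parent (Some x : node (add_root G)) |:
    Some @: children x| <= _)%N.
    apply: subset_leq_card; apply/subsetP => y; rewrite !inE /tree_edge.
    case/andP => nxy /orP[/eqP ->|]; first by rewrite eqxx.
    case: y nxy => [y|//] nxy /=; case: ifP => // _ /eqP[yx].
    by apply/orP; right; apply: imset_f; rewrite inE yx.
  rewrite cardsU1 -add1n; apply: leq_add; first by case: (_ \in _).
  by rewrite card_imset //; apply: Some_inj.
apply: leq_trans nG _; rewrite -(card_imset _ Some_inj).
apply: subset_leq_card; apply/subsetP => _ /imsetP[x' rx' ->]; rewrite inE in rx'.
by rewrite inE /tree_edge /= rx'.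
Qed.
End Realization.

Theorem theorem6p30 (R : realType) :
  (iso_invariant (@tree_family R[i]) /\
   free_wreath_closed (@tree_family R[i])) /\
  (forall I : qpg R[i] -> Prop,
     iso_invariant I -> free_wreath_closed I ->
     forall G : qpg R[i], tree_family G -> I G).
Proof.
have iso : iso_invariant (@tree_family R[i]).
  by move=> G H GH [T tT TG]; exists T => //; apply: qpg_iso_trans GH.
(* Trees and forests give the same family, so the closure properties can be proved by constructing
   forests. *)
have forest_tree F F0 : tree_family (@Qforest R[i] F F0) := Qforest_tree _ F0.
have tree_forest (G : qpg R[i]) : tree_family G ->
    exists F F0, qpg_iso (@Qforest R[i] F F0) G.
  case=> T tT TG; exists (prune tT), (vert_gt0 T).
  exact: qpg_iso_trans (qpg_iso_sym (Qu_prune tT _)) TG.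
split=> [|I Ii Ic G [T tT TG]]; last first.
  apply: (Ii _ _ TG); apply: (Ii _ _ (qpg_iso_sym (Qu_prune tT _))).
  exact: Qforest_family.
split=> //; split=> [|G H|G n n_gt0].
- have P0 : (0 < #|node (path_forest 0)|)%N by rewrite card_ord.
  exact: (iso _ _ (Qforest_path _ P0)).
- case/tree_forest => F [F0 FG] /tree_forest[F' [F'0 FH]].
  (* The second forest is made a single tree larger than [F], so that no quantum symmetry mixes the
     two summands. *)
  have [K [K0 [k [kP FK KF']]]] := larger_forest R[i] #|node F| F'0.
  apply: (iso _ _ (free_qpg_iso FG (qpg_iso_trans KF' FH))).
  apply: (iso _ _ (Qforest_sum_larger R[i] F0 K0 (sum_forest_gt0 K F0) kP FK)).
  exact: forest_tree.
case/tree_forest => F [F0 FG].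
(* Here only the single root matters, whence the bound 0. *)
have [K [K0 [k [kP _ KF]]]] := larger_forest R[i] 0 F0.
apply: (iso _ _ (wreath_qpg_iso n_gt0 (qpg_iso_trans KF FG))).
apply: (iso _ _ (Qforest_copies n_gt0 kP _ K0 (copies_gt0 n_gt0 K0))).
exact: forest_tree.
Qed.
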